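(* Assume that $f$ admits a continuous fourth-order derivative $f^{(4)}$ on $[0,1]$; that $(\gamma_n)\in\mathcal{GS}(-\alpha)$ with $\alpha\in(\frac12,1]$; that $(m_n)\in\mathcal{GS}(a)$ with $a\in(0,1)$; and that $\lim_{n\to\infty}(n\gamma_n)\in\left(\min\left(2a,\frac{2\alpha-a}{4}\right),\infty\right]$. Put $\xi=\lim_{n\to\infty}(n\gamma_n)^{-1}$, and let $f_n$ be the recursive Bernstein density estimator with stepsize $(\gamma_n)$ and order $(m_n)$. For $x\in(0,1)$, we have: 1. If $\gamma_n^{-1/2}m_n^{-9/4}\to c$ for some constant $c\ge0$, then $$\gamma_n^{-1/2}m_n^{-1/4}\left(f_n(x)-f(x)\right)\stackrel{\mathcal{D}}{\rightarrow}\mathcal{N}\left(-\frac{2c}{1-2a\xi}\Delta_2(x),\ \frac{2}{4-(2\alpha-a)\xi}C_3f(x)\psi(x)\right).$$ 2. If $\gamma_n^{-1/2}m_n^{-9/4}\to\infty$, then $$m_n^{2}\left(f_n(x)-f(x)\right)\stackrel{\mathbb{P}}{\rightarrow}-\frac{2}{1-2a\xi}\Delta_2(x).$$ Here $\stackrel{\mathcal{D}}{\rightarrow}$ denotes convergence in distribution, $\mathcal{N}$ the Gaussian distribution (with mean and variance as arguments), and $\stackrel{\mathbb{P}}{\rightarrow}$ convergence in probability.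
   Context: Class $\mathcal{GS}$: for $\gamma\in\mathbb{R}$, a nonrandom positive sequence $(v_n)_{n\ge1}$ belongs to $\mathcal{GS}(\gamma)$ if $\lim_{n\to\infty}n\left[1-\frac{v_{n-1}}{v_n}\right]=\gamma$. Estimator: $X_1,X_2,\dots$ are i.i.d. random variables with common unknown density $f$ supported on $[0,1]$. Let $b_k(m,x)=\binom mk x^k(1-x)^{m-k}$ be the Bernstein polynomial of order $m$, and set $$T_{n,m}(x)=m\sum_{k=0}^{m-1}\mathbb{I}\left\{\tfrac km<X_n\le\tfrac{k+1}m\right\}b_k(m-1,x).$$ Given a stepsize sequence $(\gamma_n)$ and an order sequence $(m_n)$, put $Z_n(x)=2T_{n,m}(x)-T_{n,m/2}(x)$ with $m=m_n$. The recursive estimator is defined by $f_0(x)=0$ and, for $n\ge1$, $f_n(x)=(1-\gamma_n)f_{n-1}(x)+\gamma_nZ_n(x)$. Notation: $\psi(x)=(4\pi x(1-x))^{-1/2}$; $C_3=\frac1{\sqrt2}+4\left(1-\sqrt{\frac23}\right)$; $$\Delta_2(x)=\tfrac16(1-6x(1-x))f''(x)+\tfrac5{12}x(1-x)(1-2x)f^{(3)}(x)+\tfrac18x^2(1-x)^2f^{(4)}(x).$$ Limits are as $n\to\infty$.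
   Formalization: No integer sequence lies in GS(a) for 0<a<1, so (m_n) is taken real and the Bernstein orders in f_n are any positive even integers N_n with N_n/m_n → 1; in part 1, if 1−2aξ=0 (which forces c=0), the mean is read as 0. *)

(* Defs.v *)
From HB Require Import structures.
From mathcomp Require Import all_boot all_order all_algebra.
From mathcomp Require Import all_classical all_reals all_analysis.
From mathcomp Require Import measurable_realfun.

Set Implicit Arguments.
Unset Strict Implicit.
Unset Printing Implicit Defensive.

Import Order.TTheory GRing.Theory Num.Theory.
Import numFieldTopology.Exports numFieldNormedType.Exports.

Local Open Scope classical_set_scope.
Local Open Scope ring_scope.

(* Sequences indexed by n >= 1 are functions on nat whose value at 0 plays no
   role. *)

Definition GS {R : realType} (g : R) (v : nat -> R) : Prop :=
  (forall n, (0 < n)%N -> 0 < v n) /\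
  (n%:R * (1 - v n.-1 / v n) @[n --> \oo] --> g).

(* An integer-valued sequence is never in GS(a) for 0 < a < 1: its increments
   are 0 or at least 1 in absolute value, while GS(a) makes them equivalent to
   a v_n / n, hence eventually positive and tending to 0. The order sequence (m_n) of GS(a) is therefore
   real-valued, and the Bernstein polynomials are taken at positive integers N n
   equivalent to m_n, even so that N n / 2 is again an order; any rounding of
   m_n to an even integer is allowed. *)
Definition even_orders {R : realType} (m : nat -> R) (N : nat -> nat) : Prop :=
  (forall n, (0 < n)%N -> (0 < N n)%N /\ ~~ odd (N n)) /\
  ((N n)%:R / m n @[n --> \oo] --> (1 : R)).

Section Estimator.
Context {R : realType}.
Implicit Types (x y : R).

Definition bernstein (k m : nat) x : R :=
  'C(m, k)%:R * x ^+ k * (1 - x) ^+ (m - k).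

(* T_{n,m}(x) as a function of the observation y = X_n *)
Definition bernstein_kernel (m : nat) x y : R :=
  m%:R * \sum_(k < m)
    \1_(`]k%:R / m%:R, k.+1%:R / m%:R]%classic : set R) y * bernstein k m.-1 x.

Definition corrected_kernel (m : nat) x y : R :=
  2 * bernstein_kernel m x y - bernstein_kernel m./2 x y.

Fixpoint recursive_estimator {T : Type} (gam : nat -> R) (N : nat -> nat)
    (X : nat -> T -> R) x (n : nat) (w : T) : R :=
  if n is n'.+1 then
    (1 - gam n) * recursive_estimator gam N X x n' w
    + gam n * corrected_kernel (N n) x (X n w)
  else 0.

End Estimator.

Lemma measurable_recursive_estimator {R : realType} {d : measure_display}
    {T : measurableType d} (gam : nat -> R) (N : nat -> nat)
    (X : nat -> {mfun T >-> R}) (x : R) (n : nat) :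
  measurable_fun [set: T] (recursive_estimator gam N X x n).
Proof.
have mK m : measurable_fun [set: R] (bernstein_kernel m x).
  apply: measurable_funM => //; apply: measurable_sum => k.
  by apply: measurable_funM => //; exact: measurable_indic.
elim: n => [|n IH] /=; first exact: measurable_cst.
apply: measurable_funD; first exact: measurable_funM.
apply: measurable_funM => //.
apply: (measurableT_comp (f := corrected_kernel _ x)); last exact: measurable_funPT.
by apply: measurable_funB => //; exact: measurable_funM.
Qed.

Section Regularity.
Context {R : realType}.

(* relative to A: one-sided at the endpoints when A is an interval *)
Definition derivative_on (A : set R) (f f' : R -> R) : Prop :=
  forall x, A x ->
    (f y - f x) / (y - x) @[y --> within (A `\ x) (nbhs x)] --> f' x.

Definition Ck_on (k : nat) (A : set R) (f : R -> R) : Prop :=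
  exists g : nat -> R -> R,
    [/\ g 0%N = f,
        forall i, (i < k)%N -> derivative_on A (g i) (g i.+1) &
        {within A, continuous (g k)}].

Definition psi (x : R) : R := (Num.sqrt (4 * pi * x * (1 - x)))^-1.

Definition C3 : R := (Num.sqrt 2)^-1 + 4 * (1 - Num.sqrt (2 / 3)).

Definition Delta2 (f : R -> R) (x : R) : R :=
  1 / 6 * (1 - 6 * x * (1 - x)) * (f^`(2))%classic x
  + 5 / 12 * x * (1 - x) * (1 - 2 * x) * (f^`(3))%classic x
  + 1 / 8 * x ^+ 2 * (1 - x) ^+ 2 * (f^`(4))%classic x.

End Regularity.

Section Probability.
Context {d : measure_display} {T : measurableType d} {R : realType}.
Variable P : probability T R.

Definition mutually_independent (I : set nat) (X : nat -> {RV P >-> R}) : Prop :=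
  forall (J : seq nat) (A : nat -> set R),
    uniq J -> [set` J] `<=` I -> (forall i, measurable (A i)) ->
    P (\bigcap_(i in [set` J]) X i @^-1` A i)
    = (\prod_(i <- J) P (X i @^-1` A i))%E.

Definition has_density (X : {RV P >-> R}) (f : R -> R) : Prop :=
  [/\ measurable_fun [set: R] f, forall y, 0 <= f y &
      forall A : set R, measurable A ->
        distribution P X A = (\int[lebesgue_measure]_(y in A) (f y)%:E)%E].

Definition iid_density01 (X : nat -> {RV P >-> R}) (f : R -> R) : Prop :=
  [/\ mutually_independent [set n | (0 < n)%N] X,
      forall n, (0 < n)%N -> has_density (X n) f &
      forall y, y \notin `[0, 1] -> f y = 0].

Definition cvg_in_law (Y : nat -> T -> R) 
    (nu : probability (measurableTypeR R) R) : Prop :=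
  let F (t : R) := nu `]-oo, t]%classic in
  forall t, {for t, continuous F} ->
    P [set w | Y n w <= t] @[n --> \oo] --> F t.

Definition cvg_in_prob (Y : nat -> T -> R) (l : R) : Prop :=
  forall e : R, 0 < e ->
    P [set w | e < `|Y n w - l|] @[n --> \oo] --> 0%E.

End Probability.

(* N(mu, v), v being the variance; the point mass at mu when v = 0 (which
   happens when f(x) = 0). The library's normal_prob is parametrized by the
   standard deviation and is not a point mass when that is 0. *)
Definition gaussian {R : realType} (mu v : R) :
    probability (measurableTypeR R) R :=
  if v == 0
  then (@dirac _ (measurableTypeR R) mu R : probability (measurableTypeR R) R)
  else (normal_prob mu (Num.sqrt v) : probability (measurableTypeR R) R).

(* Main.v *)
From HB Require Import structures.
Require Import Defs.
From mathcomp Require Import all_boot all_order all_algebra.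
From mathcomp Require Import all_classical all_reals all_analysis.
From mathcomp Require Import measurable_realfun ring lra.
Import Order.TTheory GRing.Theory Num.Theory.
Import numFieldTopology.Exports numFieldNormedType.Exports.
Local Open Scope classical_set_scope.
Local Open Scope ring_scope.

(* For N = m_n even, Z_n(x) depends on X_n only through the cell of the grid of
   mesh 1/N that X_n hits. So f_n(x) takes finitely many values, and its law is an
   iterated finite sum, on which the whole argument is carried out.
   - One step: a fourth-order Taylor expansion of f and the central moments of
     the binomial law give N^2 (E Z_n - f(x)) -> -2 Delta_2(x); the local limit
     theorem for the binomial law, with Gaussian domination, gives
     N^(-1/2) Var Z_n -> C_3 f(x) psi(x) and |Z_n| = O(N^(1/2)).
   - Recursion: A_n = (1 - gamma_n)^p A_(n-1) + gamma_n u_n with v in GS(g) and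
     v_n u_n -> U implies v_n A_n -> U / (p - g xi). This is applied to the mean
     (p = 1), the variance (p = 2) and the Lyapunov error terms (p = 3, 4), with
     v_n a power of gamma_n^(-1/2) m_n^(-1/4) or of m_n.
   - Normality: Lindeberg's replacement against the test functions
     s |-> Phi((z - s) tau^(-1/2)), for which adding an independent Gaussian
     amounts to increasing tau; indicators are recovered by letting tau -> 0. *)

(** * Recursions with weights in GS *)

(** The peak of the binomial law is not computed directly: every weight is first compared with the
    weight at the mode through ratios of neighbours, and the height of the peak is then forced by
    the total mass being 1. In the bias, the combination of the orders [m] and [m/2] kills all
    contributions proportional to [1 / m]; the moments of order two to four then all count at order
    [m^-2], whence the three derivatives in [Delta2]. The square of the limit kernel gives three
    Gaussian integrals, the three terms of [C3]. The functions $\Phi((z-s)\tau^{-1/2})$ satisfy a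
    heat equation in $(s,\tau)$: the second-order term in space cancels the first-order term in
    variance, and the family is stable under each replacement, so no auxiliary Gaussian variable is
    constructed. Positivity of [p - g xi] is settled by $\gamma_n^{-1/2}m_n^{-9/4}$, which lies in
    $GS(\kappa-2a)$ for $\kappa=(2\alpha-a)/4$: a finite limit forces $\kappa\le 2a$, an infinite
    one $2a\le\kappa$, so the minimum in the hypothesis is each time the index needed. A nonzero
    finite limit forces $\kappa=2a$, hence the denominator $1-2a\xi$ of the mean. *)

Lemma eqW (R : realType) (a b : R) : a = b -> a <= b.
Proof. by move=> ->. Qed.

(** Once the error of [y] is below [e / 2], the excess of [|l - A|] over [e / 2] is multiplied at
    each step by at most [1 - th <= exp (- th)], and the divergence of the series kills it. *)
Lemma sa_cvg (R : realType) (A th y : nat -> R) (l : R) :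
  (\forall n \near \oo, A n.+1 = (1 - th n) * A n + th n * y n) ->
  (\forall n \near \oo, 0 <= th n <= 1) ->
  series th @ \oo --> +oo ->
  y n @[n --> \oo] --> l -> A n @[n --> \oo] --> l.
Proof.
move=> [N1 _ recA] [N2 _ th01] divth /cvgrPdist_le yl.
apply/cvgrPdist_le => e e0.
have e20 : 0 < e / 2 by rewrite divr_gt0.
have [N3 _ yN] := yl _ e20.
pose N := maxn N1 (maxn N2 N3).
pose K := `|l - A N|.
have bnd k : `|l - A (N + k)%N| <=
    e / 2 + K * expR (- (series th (N + k)%N - series th N)).
  elim: k => [|k IH].
    by rewrite addn0 subrr oppr0 expR0 mulr1 lerDr ltW.
  have Nk : (N <= N + k)%N by rewrite leq_addr.
  have N1k : (N1 <= N + k)%N by apply: leq_trans Nk; rewrite leq_maxl.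
  have N2k : (N2 <= N + k)%N.
    by apply: leq_trans Nk; rewrite /N maxnCA leq_maxl.
  have N3k : (N3 <= N + k)%N.
    by apply: leq_trans Nk; rewrite /N maxnA leq_maxr.
  rewrite addnS recA //.
  have /andP[t0 t1] := th01 _ N2k.
  have y3 := yN _ N3k.
  have -> : l - ((1 - th (N + k)%N) * A (N + k)%N + th (N + k)%N * y (N + k)%N) =
    (1 - th (N + k)%N) * (l - A (N + k)%N) + th (N + k)%N * (l - y (N + k)%N).
    by ring.
  apply: (le_trans (ler_normD _ _)).
  rewrite !normrM (ger0_norm t0) [`|1 - _|]ger0_norm ?subr_ge0//.
  have ex : 1 - th (N + k)%N <= expR (- th (N + k)%N) by exact: expR_ge1Dx.
  have -> : series th (N + k).+1 - series th N =
     th (N + k)%N + (series th (N + k)%N - series th N).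
    by rewrite !seriesEnat /= big_nat_recr//=; ring.
  rewrite opprD expRD.
  have K0 : 0 <= K by exact: normr_ge0.
  set E := expR (- (_ - _)) in IH *.
  have E0 : 0 <= E by exact: expR_ge0.
  set s := th _ in t0 t1 ex *.
  have IH' : (1 - s) * `|l - A (N + k)%N| <= (1 - s) * (e / 2 + K * E).
    by rewrite ler_wpM2l// subr_ge0.
  have y' : s * `|l - y (N + k)%N| <= s * (e / 2) by rewrite ler_wpM2l.
  have KE : (1 - s) * (K * E) <= expR (- s) * (K * E).
    by rewrite ler_wpM2r// mulr_ge0.
  lra.
have [M _ HM] : \forall n \near \oo, K * expR (- (series th n - series th N)) <= e / 2.
  have := divth; move/cvgryPge => /(_ (series th N + K / (e / 2))) [M _ HM].
  exists M => // n /= Mn; have := HM n Mn => Hn.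
  have K0 : 0 <= K by exact: normr_ge0.
  set D := series th n - series th N.
  have D0 : K / (e / 2) <= D by rewrite lerBrDl.
  rewrite expRN ler_pdivrMr ?expR_gt0//.
  have : 1 + D <= expR D by exact: expR_ge1Dx.
  move: D0; rewrite ler_pdivrMr// => D0 D1.
  apply: (le_trans D0); rewrite mulrC ler_pM2l//.
  apply: le_trans D1; by rewrite lerDr.
exists (maxn N M) => // n /=; rewrite geq_max => /andP[Nn Mn].
have := bnd (n - N)%N; rewrite subnKC// => /le_trans; apply.
have := HM n Mn; lra.
Qed.

(* With [th n ~ c / n] the divergence is that of the harmonic series. *)
Lemma dvg_series_ge_harmonic (R : realType) (th : nat -> R) (c : R) : 0 < c ->
  (\forall n \near \oo, c / n.+1%:R <= th n) -> series th @ \oo --> +oo.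
Proof.
move=> c0 [N _ hth].
have dvgH : series (@harmonic R) @ \oo --> +oo.
  have nd : nondecreasing_seq (series (@harmonic R)).
    by apply/nondecreasing_seqP => n; rewrite seriesSr lerDl /=.
  apply: nondecreasing_dvgn_lt => //.
  exact: dvg_harmonic.
have bnd k : c * (series harmonic (N + k)%N - series harmonic N) <=
    series th (N + k)%N - series th N.
  elim: k => [|k IH]; first by rewrite addn0 !subrr mulr0.
  rewrite addnS !seriesSr.
  have /= h := hth (N + k)%N (leq_addr _ _).
  set a := _.+1%:R^-1 in h *; set b := series _ _ in IH *; set b0 := series _ _ in IH *.
  have -> : c * (b + a - b0) = c * (b - b0) + c * a by ring.
  by rewrite addrAC lerD.
apply/cvgryPge => A.
move: dvgH => /cvgryPge/(_ (series harmonic N + (A - series th N) / c)) [M _ HM].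
exists (maxn N M) => // n /=; rewrite geq_max => /andP[Nn Mn].
have := bnd (n - N)%N; rewrite subnKC// => b.
have /= := HM n Mn; rewrite -lerBrDl ler_pdivrMr// mulrC => b'.
lra.
Qed.

Section GSsec.
Context {R : realType}.
Implicit Types (v w gam : nat -> R) (g xi : R).

Lemma cvg_succ (u : nat -> R) (l : R) :
  u n.+1 @[n --> \oo] --> l <-> u n @[n --> \oo] --> l.
Proof.
split=> [H|H]; last by apply: (cvg_comp S u _ H) => A [N _ NA]; exists N => // n /= Nn; apply: NA => /=; exact: leqW.
apply/cvgrPdist_le => e e0.
move/cvgrPdist_le : H => /(_ _ e0)[N _ HN].
by exists N.+1 => // -[//|n] /= Nn; exact: HN.
Qed.

Lemma cvg_harmonic0 : (n%:R : R)^-1 @[n --> \oo] --> (0 : R).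
Proof. by apply/cvg_succ; exact: cvg_harmonic. Qed.

Lemma GS_ratio g v : GS g v -> v n.-1 / v n @[n --> \oo] --> (1 : R).
Proof.
move=> [v0 vg].
have : 1 - (n%:R)^-1 * (n%:R * (1 - v n.-1 / v n)) @[n --> \oo] --> (1 - 0 * g : R).
  by apply: cvgB; [exact: cvg_cst|apply: cvgM => //; exact: cvg_harmonic0].
rewrite mul0r subr0; apply: cvg_trans; apply: near_eq_cvg.
exists 1%N => // n /= n0; rewrite mulrA mulVf ?pnatr_eq0 -?lt0n//; ring.
Qed.

(** For the two ratios of consecutive terms, $n(1-qr) = n(1-q) + q\,n(1-r)$ with $q \to 1$. *)
Lemma GS_mul g h v w : GS g v -> GS h w -> GS (g + h) (fun n => v n * w n).
Proof.
move=> vg wh; split=> [n n0|]; first by apply: mulr_gt0; [apply vg.1|apply wh.1].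
have : n%:R * (1 - v n.-1 / v n) + (v n.-1 / v n) * (n%:R * (1 - w n.-1 / w n))
    @[n --> \oo] --> (g + 1 * h : R).
  by apply: cvgD; [exact vg.2|apply: cvgM; [exact: (GS_ratio _ _ vg)|exact wh.2]].
rewrite mul1r; apply: cvg_trans; apply: near_eq_cvg.
exists 1%N => // n /= n0.
have := vg.1 n n0; have := wh.1 n n0 => w0 v0.
by field; rewrite !gt_eqF.
Qed.

(** With [q] the ratio of consecutive terms, [n (1 - q^r)] is the slope of [x^r] between 1 and [q]
    times [n (1 - q)]. *)
Lemma GS_powR g v r : GS g v -> GS (r * g) (fun n => v n `^ r).
Proof.
move=> vg; split=> [n n0|]; first by rewrite powR_gt0// vg.1.
pose q n := v n.-1 / v n.
have q1 : q n @[n --> \oo] --> (1 : R) by exact: GS_ratio vg.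
have d1 : is_derive (1 : R) (1 : R) (fun x => x `^ r) (r * 1 `^ (r - 1)).
  exact: is_derive1_powR.
(* slope of [x `^ r] at 1, completed by its limit at [x = 1] *)
pose sl x := if x == 1 then r else (x `^ r - 1) / (x - 1).
have slc : sl x @[x --> (1 : R)] --> r.
  have H : h^-1 *: ((1 + h) `^ r - 1) @[h --> (0 : R)^'] --> r.
    case: d1 => dd e; rewrite powR1 mulr1 in e.
    have dd' : h^-1 *: ((h *: (1 : R) + 1) `^ r - 1 `^ r) @[h --> (0 : R)^'] --> r.
      by rewrite -[X in _ --> X]e; exact: dd.
    apply: cvg_trans dd'; apply: near_eq_cvg.
    near=> h; by rewrite /= powR1 -[h *: _]/(h * _) mulr1 (addrC h).
  apply/cvgrPdist_le => e e0.
  move/cvgrPdist_le : H => /(_ _ e0); rewrite near_withinE.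
  move=> /nbhs_ballP[dl /= dl0 Hd]; apply/nbhs_ballP; exists dl => //= x.
  rewrite /sl /ball /= => xd; case: ifP => [_|/negbT x1]; first by rewrite subrr normr0 ltW.
  have := Hd (x - 1); rewrite /ball /= sub0r normrN distrC => /(_ xd).
  rewrite subr_eq0 => /(_ x1).
  by rewrite addrCA subrr addr0 -[_ *: _]/(_ * _) mulrC.
have lim : sl (q n) * (n%:R * (1 - q n)) @[n --> \oo] --> (r * g : R).
  apply: cvgM; last exact vg.2.
  exact: (cvg_comp _ _ q1 slc).
(* [v 0] has no prescribed sign, so the identity between ratios starts at [n = 2]. *)
apply: cvg_trans lim; apply: near_eq_cvg; exists 2%N => // n /= n1.
have n0 : (0 < n)%N by exact: leq_trans n1.
have v0 := vg.1 n n0.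
have v1 : 0 < v n.-1 by apply: vg.1; move: n1; case: n n0 {v0} => [|[]].
have -> : v n.-1 `^ r / v n `^ r = q n `^ r.
  rewrite /q powRM ?invr_ge0 ?ltW//; congr (_ * _).
  by rewrite -powRN -(powR_inv1 (ltW v0)) -powRrM mulN1r.
rewrite /sl; case: eqP => [->|/eqP q1']; first by rewrite powR1 subrr !mulr0.
field; by rewrite subr_eq0.
Unshelve. all: by end_near. Qed.

Lemma GS_inv g v : GS g v -> GS (- g) (fun n => (v n)^-1).
Proof.
move=> vg; have [p c] := GS_powR g v (-1) vg.
split=> [n n0|]; first by rewrite invr_gt0 vg.1.
rewrite mulN1r in c; apply: cvg_trans c; apply: near_eq_cvg; exists 2%N => // n /= n1.
have n0 : (0 < n)%N by exact: leq_trans n1.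
have v1 : 0 < v n.-1 by apply: vg.1; move: n1; case: n n0 {p} => [|[]].
by rewrite !powR_inv1// ltW// vg.1.
Qed.

(** Membership of [1 / v] in its class says that $v_{n+1} = (1-\theta_n) v_n$ with $n\theta_n \to -g
    > 0$: a recursion with target 0 whose weights have a divergent sum. *)
Lemma GS_cvg0 g v : GS g v -> g < 0 -> v n @[n --> \oo] --> (0 : R).
Proof.
move=> vg g0.
pose th n := 1 - v n.+1 / v n.
have [w0 wg] := GS_inv _ _ vg.
have hth : n.+1%:R * th n @[n --> \oo] --> - g.
  have : n.+1%:R * (1 - (v n)^-1 / (v n.+1)^-1) @[n --> \oo] --> - g.
    by move: wg => /(cvg_succ _ _).2.
  apply: cvg_trans; apply: near_eq_cvg; near=> n.
  by rewrite /th invrK (mulrC (v n.+1)).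
have th0 : th n @[n --> \oo] --> (0 : R).
  have : harmonic n * (n.+1%:R * th n) @[n --> \oo] --> 0 * (- g).
    by apply: cvgM => //; exact: cvg_harmonic.
  rewrite mul0r; apply: cvg_trans; apply: near_eq_cvg; near=> n.
  by rewrite /harmonic /= mulrA mulVf ?mul1r// pnatr_eq0.
have gth : \forall n \near \oo, - g / 2 <= n.+1%:R * th n.
  by apply: cvgr_ge (hth) _ _; lra.
have gth' : \forall n \near \oo, (- g / 2) / n.+1%:R <= th n.
  by case: gth => M _ gth; exists M => // n /= Mn; rewrite ler_pdivrMr ?ltr0n// [leRHS]mulrC; exact: gth.
apply: (@sa_cvg _ _ th (fun=> 0)).
- exists 1%N => // n /= n0; rewrite mulr0 addr0 /th opprB addrCA subrr addr0 mulfVK//.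
  by rewrite gt_eqF// vg.1.
- near=> n; apply/andP; split.
    apply: (@le_trans _ _ ((- g / 2) / n.+1%:R)).
      by rewrite divr_ge0//; lra.
    by near: n.
  by near: n; apply: cvgr_le (th0) _ _.
- by apply: (@dvg_series_ge_harmonic _ _ (- g / 2)) => //; lra.
- exact: cvg_cst.
Unshelve. all: by end_near. Qed.

Lemma GS_inv_cvg0 g v : GS g v -> 0 < g -> (v n)^-1 @[n --> \oo] --> (0 : R).
Proof. by move=> /GS_inv vg g0; apply: GS_cvg0 vg _; lra. Qed.

(* The relative weight [(1 - gam)^p (v_n / v_{n-1})] of the rescaled recursion is
   [1 - (p - g xi + o(1)) gam]. *)
Lemma sa_rate (A u v gam : nat -> R) (p : nat) g xi (U : R) :
  (\forall n \near \oo, A n.+1 = (1 - gam n.+1) ^+ p * A n + gam n.+1 * u n.+1) ->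
  GS g v ->
  (forall n, (0 < n)%N -> 0 < gam n) ->
  gam n @[n --> \oo] --> (0 : R) ->
  (n%:R * gam n)^-1 @[n --> \oo] --> xi ->
  0 < p%:R - g * xi ->
  v n * u n @[n --> \oo] --> U ->
  v n * A n @[n --> \oo] --> U / (p%:R - g * xi).
Proof.
move=> recA vg gam0 gamc xic D0 vu.
set D := p%:R - g * xi in D0 *.
pose q n := v n.-1 / v n.
have q1 : q n @[n --> \oo] --> (1 : R) by exact: GS_ratio vg.
(* th n / gam n *)
pose rho n := (\sum_(i < p) (1 - gam n) ^+ i - (n%:R * (1 - q n)) * (n%:R * gam n)^-1) / q n.
have geo : \sum_(i < p) (1 - gam n) ^+ i @[n --> \oo] --> (p%:R : R).
  have -> : (p%:R : R) = \sum_(i < p) (1 - 0) ^+ i.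
    rewrite subr0 (eq_bigr (fun=> 1)) => [|i _]; last by rewrite expr1n.
    by rewrite sumr_const card_ord.
  apply: cvg_big => [|i _]; first exact: add_continuous.
  by apply: (@cvg_comp _ _ _ (fun n => 1 - gam n) (fun x : R => x ^+ i) _ (nbhs (1 - 0 : R)));
    [apply: cvgB => //; exact: cvg_cst|exact: exprn_continuous].
have rhoc : rho n @[n --> \oo] --> D.
  rewrite -[D]divr1; apply: cvgM; last by apply: cvgV => //; exact: oner_neq0.
  by apply: cvgB => //; apply: cvgM => //; exact vg.2.
pose th n := gam n * rho n.
have q0 : \forall n \near \oo, 0 < q n by apply: cvgr_gt (q1) _ _.
have rho0 : \forall n \near \oo, D / 2 < rho n.
  by apply: cvgr_gt (rhoc) _ _; rewrite ltr_pdivrMr//; lra.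
have thc : th n @[n --> \oo] --> (0 : R).
  by rewrite -[0](mul0r D); exact: cvgM.
have th1 : \forall n \near \oo, th n <= 1 by apply: cvgr_le (thc) _ _.
(* A bound on [(n gam n)^-1] makes [gam n] at least a multiple of [1 / n]; [|xi| + 1] is positive
   even when [xi = 0]. *)
have xib : \forall n \near \oo, (n%:R * gam n)^-1 < `|xi| + 1.
  by apply: cvgr_lt (xic) _ _; rewrite (le_lt_trans (ler_norm _))// ltrDl.
pose c := (D / 2) / (`|xi| + 1).
have x10 : 0 < `|xi| + 1 by rewrite ltr_pwDr.
have c0 : 0 < c by rewrite /c divr_gt0// divr_gt0.
(* The rescaled increment [gam v u] equals [th (v u / rho)], so the new target is [v u / rho]. *)
apply: (@sa_cvg _ _ (fun n => th n.+1) (fun n => v n.+1 * u n.+1 / rho n.+1)).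
- have recS : \forall n \near \oo, 0 < q n.+1 /\ D / 2 < rho n.+1.
    case: q0 => N1 _ q0; case: rho0 => N2 _ rho0.
    exists (maxn N1 N2) => // n /=; rewrite geq_max => /andP[? ?].
    by split; [apply: q0|apply: rho0] => /=; exact: leqW.
  near=> n.
  have -> : A n.+1 = (1 - gam n.+1) ^+ p * A n + gam n.+1 * u n.+1 by near: n.
  have [qn rn] : 0 < q n.+1 /\ D / 2 < rho n.+1 by near: n.
  have n0 : (0 < n)%N by near: n; exists 1%N.
  have vn := vg.1 n n0; have vn1 := vg.1 n.+1 isT; have gn := gam0 n.+1 isT.
  have rn0 : 0 < rho n.+1 by apply: lt_trans rn; rewrite divr_gt0.
  have thE : th n.+1 = 1 - (1 - gam n.+1) ^+ p / q n.+1.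
    rewrite /th /rho.
    have -> : \sum_(i < p) (1 - gam n.+1) ^+ i = (1 - (1 - gam n.+1) ^+ p) / gam n.+1.
      rewrite -[X in X / _]opprB subrX1; field; exact: lt0r_neq0.
    field; by rewrite -/(q n.+1) !lt0r_neq0// ltr0n.
  rewrite thE.
  have -> : (1 - (1 - gam n.+1) ^+ p / q n.+1) * (v n.+1 * u n.+1 / rho n.+1) =
     v n.+1 * (gam n.+1 * u n.+1).
    by rewrite -thE /th; field; rewrite lt0r_neq0.
  rewrite /q /=; field; by rewrite !lt0r_neq0.
- have : \forall n \near \oo, 0 <= th n <= 1.
    near=> n; apply/andP; split; last by near: n.
    rewrite mulr_ge0//; first by apply/ltW/gam0; near: n; exists 1%N.
    apply/ltW; apply: (@lt_trans _ _ (D / 2)); first by rewrite divr_gt0.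
    by near: n.
  by case=> N _ H; exists N => // n /= Nn; apply: H => /=; exact: leqW.
- apply: (@dvg_series_ge_harmonic _ _ c) => //.
  have : \forall n \near \oo, c / n%:R <= th n.
    near=> n.
    have n0 : (0 < n)%N by near: n; exists 1%N.
    have gn := gam0 n n0.
    have b1 : (n%:R * gam n)^-1 < `|xi| + 1 by near: n.
    have b2 : D / 2 < rho n by near: n.
    rewrite ler_pdivrMr ?ltr0n// /th /c ler_pdivrMr//.
    have ng0 : 0 < n%:R * gam n by rewrite mulr_gt0// ltr0n.
    have b3 : 1 <= (n%:R * gam n) * (`|xi| + 1).
      by rewrite mulrC -ler_pdivrMr// div1r ltW.
    rewrite [leRHS](_ : _ = rho n * ((n%:R * gam n) * (`|xi| + 1))); last by ring.
    rewrite -[leLHS]mulr1; apply: ler_pM => //; first by rewrite divr_ge0// ltW.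
    exact: ltW.
  by case=> N _ H; exists N => // n /= Nn; apply: H => /=; exact: leqW.
- have : v n * u n / rho n @[n --> \oo] --> U / D.
    by apply: cvgM => //; apply: cvgV => //; exact: lt0r_neq0.
  by move/(cvg_succ _ _).2.
Unshelve. all: by end_near. Qed.

End GSsec.

(** * Bernstein polynomials: moments and local limit theorem *)

Section BinomialMoments.
Context {R : realType}.
Variable x : R.
Implicit Types (n k : nat) (h : nat -> R).

(** Expectation of [h(S)] for [S] binomial with parameters [n] and [x]. *)
Definition bin_mean n h : R := \sum_(k < n.+1) bernstein k n x * h k.

Lemma bernstein0S n : bernstein 0 n.+1 x = (1 - x) * bernstein 0 n x.
Proof. by rewrite /bernstein !bin0 !subn0 !expr0 !mulr1 !mul1r exprS. Qed.

Lemma bernsteinSS n k : bernstein k.+1 n.+1 x =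
  x * bernstein k n x + (1 - x) * bernstein k.+1 n x.
Proof.
rewrite /bernstein binS natrD subSS.
have [kn|nk] := ltnP k n.
  by rewrite -(subnSK kn) !exprS; ring.
rewrite bin_small ?ltnS// !mul0r mulr0 addr0 add0r exprS; ring.
Qed.

Lemma bernstein_small n k : (n < k)%N -> bernstein k n x = 0.
Proof. by move=> nk; rewrite /bernstein bin_small// !mul0r. Qed.

(** Conditioning on one trial, that is, Pascal's rule in the form [bernsteinSS]. *)
Lemma bin_meanS n h :
  bin_mean n.+1 h = x * bin_mean n (fun k => h k.+1) + (1 - x) * bin_mean n h.
Proof.
rewrite /bin_mean big_ord_recl bernstein0S.
under eq_bigr do rewrite bernsteinSS mulrDl.
rewrite big_split/= addrCA; congr (_ + _).
  by rewrite mulr_sumr; apply: eq_bigr => k _; rewrite mulrA.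
rewrite [in RHS]big_ord_recl mulrDr; congr (_ + _); first by rewrite -mulrA.
rewrite big_ord_recr/= (bernstein_small n n.+1)// mulr0 mul0r addr0 mulr_sumr.
by apply: eq_bigr => k _; exact: esym (mulrA _ _ _).
Qed.

Lemma bin_meanD n h1 h2 :
  bin_mean n (fun k => h1 k + h2 k) = bin_mean n h1 + bin_mean n h2.
Proof. by rewrite -big_split; apply: eq_bigr => k _; rewrite mulrDr. Qed.

Lemma bin_meanZ n c h : bin_mean n (fun k => c * h k) = c * bin_mean n h.
Proof. by rewrite mulr_sumr; apply: eq_bigr => k _; rewrite mulrCA. Qed.

Lemma eq_bin_mean n h1 h2 : (forall k, h1 k = h2 k) -> bin_mean n h1 = bin_mean n h2.
Proof. by move=> h12; apply: eq_bigr => k _; rewrite h12. Qed.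

Definition bin_moment i n := bin_mean n (fun k => (k%:R - n%:R * x) ^+ i).

(** One more trial adds [1 - x] or [- x] to the centred sum; expanding the powers turns this into
    recursions in [n] for the central moments. *)
Lemma bin_momentS i n : bin_moment i n.+1 =
  bin_mean n (fun k => x * (k%:R - n%:R * x + (1 - x)) ^+ i
                     + (1 - x) * (k%:R - n%:R * x - x) ^+ i).
Proof.
rewrite /bin_moment bin_meanS -!bin_meanZ -bin_meanD; apply: eq_bin_mean => k.
by congr (x * _ ^+ _ + (1 - x) * _ ^+ _); rewrite -!natr1; ring.
Qed.

Lemma bin_moment0 n : bin_moment 0 n = 1.
Proof.
elim: n => [|n IH].
  by rewrite /bin_moment /bin_mean big_ord1 /bernstein !expr0 bin0 !mulr1.
rewrite -[RHS]IH bin_momentS; apply: eq_bin_mean => k; rewrite !expr0; ring.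
Qed.

Lemma bin_moment_at0 i : bin_moment i.+1 0 = 0.
Proof.
by rewrite /bin_moment /bin_mean big_ord1 mul0r subr0 expr0n mulr0.
Qed.

Local Notation s := (x * (1 - x)).

Lemma bin_moment1 n : bin_moment 1 n = 0.
Proof.
elim: n => [|n IH]; first by rewrite bin_moment_at0.
rewrite -[RHS]IH bin_momentS; apply: eq_bin_mean => k; rewrite !expr1; ring.
Qed.

Lemma bin_moment2 n : bin_moment 2 n = n%:R * s.
Proof.
elim: n => [|n IH]; first by rewrite bin_moment_at0 mul0r.
rewrite bin_momentS.
transitivity (bin_moment 2 n + s * bin_moment 0 n).
  rewrite -bin_meanZ -bin_meanD; apply: eq_bin_mean => k; ring.
by rewrite IH bin_moment0 -natr1; ring.
Qed.

Lemma bin_moment3 n : bin_moment 3 n = n%:R * (s * (1 - 2 * x)).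
Proof.
elim: n => [|n IH]; first by rewrite bin_moment_at0 mul0r.
rewrite bin_momentS.
transitivity (bin_moment 3 n + (3 * s) * bin_moment 1 n + (s * (1 - 2 * x)) * bin_moment 0 n).
  rewrite -!bin_meanZ -!bin_meanD; apply: eq_bin_mean => k; ring.
by rewrite IH bin_moment0 bin_moment1 -natr1; ring.
Qed.

Lemma bin_moment4 n :
  bin_moment 4 n = 3 * (n%:R * s) ^+ 2 + n%:R * (s * (1 - 6 * s)).
Proof.
elim: n => [|n IH]; first by rewrite bin_moment_at0; ring.
rewrite bin_momentS.
transitivity (bin_moment 4 n + (6 * s) * bin_moment 2 n
  + (4 * (s * (1 - 2 * x))) * bin_moment 1 n + (s * (1 - 3 * s)) * bin_moment 0 n).
  rewrite -!bin_meanZ -!bin_meanD; apply: eq_bin_mean => k; ring.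
by rewrite IH bin_moment0 bin_moment1 bin_moment2 -natr1; ring.
Qed.

(** Passing from [n] to [n + 1] adds at most [45 n^2 + 50 n + 1], less than the increment
    [50 (3 n^2 + 3 n + 1)] of the bound. Only the order [n^3] matters later. *)
Lemma bin_moment6_le n : 0 <= x <= 1 -> bin_moment 6 n <= 50 * n%:R ^+ 3.
Proof.
move=> /andP[x0 x1].
elim: n => [|n IH]; first by rewrite bin_moment_at0; rewrite expr0n mulr0.
rewrite bin_momentS.
rewrite (_ : bin_mean _ _ = bin_moment 6 n + (15 * s) * bin_moment 4 n
  + (20 * (s * (1 - 2 * x))) * bin_moment 3 n
  + (15 * (s * (1 - 3 * s))) * bin_moment 2 n
  + (6 * (x * (1 - x) ^+ 5 - (1 - x) * x ^+ 5)) * bin_moment 1 n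
  + (x * (1 - x) ^+ 6 + (1 - x) * x ^+ 6) * bin_moment 0 n); last first.
  rewrite -!bin_meanZ -!bin_meanD; apply: eq_bin_mean => k; ring.
rewrite bin_moment4 bin_moment3 bin_moment2 bin_moment1 bin_moment0 -[n.+1%:R]natr1.
have s0 : 0 <= s by rewrite mulr_ge0// subr_ge0.
have s1 : s <= 1 / 4 by have := sqr_ge0 (2 * x - 1); rewrite expr2; lra.
have x6 : x * (1 - x) ^+ 6 + (1 - x) * x ^+ 6 <= 1.
  have : (1 - x) ^+ 6 <= 1 by rewrite exprn_ile1//; lra.
  have : x ^+ 6 <= 1 by rewrite exprn_ile1//; lra.
  set a := x ^+ 6; set b := (1 - x) ^+ 6 => a1 b1; nra.
have n0 : 0 <= n%:R :> R by rewrite ler0n.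
set N : R := n%:R in IH n0 *; set S := s in s0 s1 IH *.
have h9 : (S * (1 - 2 * x)) * (S * (1 - 2 * x)) <= 1.
  have a1 : -1 <= S * (1 - 2 * x) <= 1.
    rewrite -ler_norml normrM -[leRHS]mulr1 ler_pM ?normr_ge0// ler_norml; lra.
  case/andP: a1; set y := S * (1 - 2 * x) => a1 a2.
  have : 0 <= (1 - y) * (1 + y) by rewrite mulr_ge0//; lra.
  lra.
have SS0 : 0 <= S * S by rewrite mulr_ge0.
have h4 : S * (1 - 6 * S) <= 1 / 4 by lra.
have e4 : 15 * S * (3 * (N * S) ^+ 2 + N * (S * (1 - 6 * S))) <= 15 * (3 * N ^+ 2 + N).
  have S2 : S ^+ 2 <= 1 by rewrite exprn_ile1//; lra.
  have a1 : 3 * (N * S) ^+ 2 + N * (S * (1 - 6 * S)) <= 3 * N ^+ 2 + N.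
    rewrite exprMn; apply: lerD.
      by rewrite ler_pM2l// ler_piMr// exprn_ge0.
    by rewrite -[leRHS]mulr1 ler_wpM2l//; lra.
  have a2 : 0 <= 3 * N ^+ 2 + N by rewrite addr_ge0// mulr_ge0// exprn_ge0.
  have a3 : 15 * S * (3 * (N * S) ^+ 2 + N * (S * (1 - 6 * S))) <= 15 * S * (3 * N ^+ 2 + N).
    by rewrite ler_wpM2l// mulr_ge0.
  apply: (le_trans a3); rewrite ler_wpM2r//; lra.
have e3 : 20 * (S * (1 - 2 * x)) * (N * (S * (1 - 2 * x))) <= 20 * N.
  rewrite (_ : 20 * (S * (1 - 2 * x)) * (N * (S * (1 - 2 * x))) =
    20 * N * ((S * (1 - 2 * x)) * (S * (1 - 2 * x)))); last by ring.
  by rewrite -[leRHS]mulr1 ler_wpM2l// mulr_ge0.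
have e2 : 15 * (S * (1 - 3 * S)) * (N * S) <= 15 * N.
  rewrite (_ : 15 * (S * (1 - 3 * S)) * (N * S) = 15 * N * (S * (1 - 3 * S) * S)); last by ring.
  rewrite -[leRHS]mulr1 ler_wpM2l//; first by rewrite mulr_ge0.
  have SSS : 0 <= S * S * S by rewrite mulr_ge0.
  have : S * S <= S * 1 by rewrite ler_wpM2l//; lra.
  lra.
rewrite mulr0 addr0 mulr1.
move: e4 e3 e2; set A4 := _ * _ => e4; set A3 := _ * _ => e3; set A2 := _ * _ => e2.
have N2 : 0 <= N ^+ 2 by exact: exprn_ge0.
rewrite (_ : (N + 1) ^+ 3 = N ^+ 3 + 3 * N ^+ 2 + 3 * N + 1); last by ring.
lra.
Qed.

End BinomialMoments.

(** * Binomial weights compared with the weight at the mode *)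

Section LocalLimit.
Context {R : realType}.
Variable x : R.
Hypothesis x01 : 0 < x < 1.
Implicit Types (n k : nat).

Local Notation q := (1 - x).
Local Notation s := (x * (1 - x)).

Let x0 : 0 < x. Proof. by case/andP: x01. Qed.
Let q0 : 0 < q. Proof. by rewrite subr_gt0; case/andP: x01. Qed.
Let s0 : 0 < s. Proof. exact: mulr_gt0. Qed.

Lemma bernstein_ge0 k n : 0 <= bernstein k n x.
Proof. by rewrite /bernstein !mulr_ge0// exprn_ge0// ltW. Qed.

Lemma bernstein_gt0 k n : (k <= n)%N -> 0 < bernstein k n x.
Proof. by move=> kn; rewrite /bernstein !mulr_gt0 ?exprn_gt0// ltr0n bin_gt0. Qed.

Lemma bernstein_ratio k n : (k < n)%N ->
  bernstein k.+1 n x * (k.+1%:R * q) = bernstein k n x * ((n%:R - k%:R) * x).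
Proof.
move=> kn; rewrite /bernstein -(subnSK kn) !exprS.
have : k.+1%:R * 'C(n, k.+1)%:R = (n%:R - k%:R) * 'C(n, k)%:R :> R.
  by rewrite -natrB 1?ltnW// -!natrM mul_bin_left.
set a := 'C(n, k.+1)%:R; set b := 'C(n, k)%:R => e.
rewrite (_ : _ * (k.+1%:R * q) = (k.+1%:R * a) * (x * x ^+ k * (1 - x) ^+ (n - k.+1) * q)); last by ring.
rewrite e; ring.
Qed.

(** By [bernstein_ratio], the weights increase up to this index and decrease after it. *)
Definition mode n : nat := Num.truncn (n.+1%:R * x).

Lemma mode_bounds n :
  - (1 / 2) <= (mode n)%:R - n%:R * x - x + 1 / 2 <= 1 / 2.
Proof.
have h : 0 <= n.+1%:R * x by rewrite mulr_ge0// ltW.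
have /andP[] := truncn_itv h; rewrite -/(mode n) -[n.+1%:R]natr1 -[(mode n).+1%:R]natr1 => h1 h2.
apply/andP; split; lra.
Qed.

Lemma mode_le n : (mode n <= n)%N.
Proof.
have h : 0 <= n.+1%:R * x by rewrite mulr_ge0// ltW.
have /andP[h1 _] := truncn_itv h.
rewrite -ltnS -(ltr_nat R); apply: (le_lt_trans h1).
by rewrite gtr_pMr ?ltr0n//; case/andP: x01.
Qed.

(** The weight divided by a Gaussian profile of variance [n], wider than the true variance, and
    centred at [(n + 1) x - 1/2]. With this centre the monotonicity of the profile and that of the
    weights both change with the sign of [k - n x + q]. *)
Let wt n k := bernstein k n x * expR ((k%:R - n%:R * x - x + 1 / 2) ^+ 2 / (2 * n%:R)).

Let wt_step n k : (0 < n)%N ->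
  expR ((k.+1%:R - n%:R * x - x + 1 / 2) ^+ 2 / (2 * n%:R)) =
  expR ((k%:R - n%:R * x - x + 1 / 2) ^+ 2 / (2 * n%:R)) *
  expR ((k%:R - n%:R * x + q) / n%:R).
Proof.
move=> n0; rewrite -expRD; congr expR; rewrite -[k.+1%:R]natr1; field.
by rewrite pnatr_eq0 -lt0n.
Qed.

(** The ratio of neighbouring weights has the form [1 + u <= exp u], and [(n - k) x <= n] makes the
    profile vary more slowly: [wt] still increases up to the mode. *)
Let wt_up n k : (k < n)%N -> k%:R - n%:R * x + q <= 0 -> wt n k <= wt n k.+1.
Proof.
move=> kn d0; have n0 : (0 < n)%N by case: n kn d0.
have n0R : 0 < n%:R :> R by rewrite ltr0n.
rewrite /wt wt_step// mulrCA -[leLHS]mulrC ler_wpM2l ?expR_ge0//.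
have kn0 : 0 < (n%:R - k%:R) * x by rewrite mulr_gt0// subr_gt0 ltr_nat.
have e := bernstein_ratio k n kn.
have -> : bernstein k n x = bernstein k.+1 n x * ((k.+1%:R * q) / ((n%:R - k%:R) * x)).
  by rewrite mulrA e; field; rewrite !gt_eqF// subr_gt0 ltr_nat.
rewrite ler_wpM2l ?bernstein_ge0//.
have -> : (k.+1%:R * q) / ((n%:R - k%:R) * x) = 1 + (k%:R - n%:R * x + q) / ((n%:R - k%:R) * x).
  rewrite -[k.+1%:R]natr1; field; by rewrite !gt_eqF// subr_gt0 ltr_nat.
apply: le_trans (expR_ge1Dx _); rewrite lerD2l.
apply: ler_wnM2l => //; rewrite lef_pV2//.
have k0 : 0 <= k%:R :> R by [].
case/andP: (x01) => x0' x1.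
apply: (@le_trans _ _ (n%:R - k%:R)); last by lra.
by rewrite ger_pMr ?subr_gt0 ?ltr_nat// ltW.
Qed.

Let wt_down n k : (k < n)%N -> 0 <= k%:R - n%:R * x + q -> wt n k.+1 <= wt n k.
Proof.
move=> kn d0; have n0 : (0 < n)%N by case: n kn d0.
have n0R : 0 < n%:R :> R by rewrite ltr0n.
rewrite /wt wt_step// mulrCA -[leRHS]mulrC ler_wpM2l ?expR_ge0//.
rewrite -ler_pdivlMr ?expR_gt0// -expRN.
have kq0 : 0 < k.+1%:R * q by rewrite mulr_gt0// ltr0n.
have e := bernstein_ratio k n kn.
have -> : bernstein k.+1 n x = bernstein k n x * (((n%:R - k%:R) * x) / (k.+1%:R * q)).
  by rewrite mulrA -e; field; rewrite !gt_eqF// ltr0n.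
rewrite ler_wpM2l ?bernstein_ge0//.
have -> : ((n%:R - k%:R) * x) / (k.+1%:R * q) = 1 + (- ((k%:R - n%:R * x + q) / (k.+1%:R * q))).
  rewrite -[k.+1%:R]natr1; field; by rewrite !gt_eqF// ltr0n.
apply: le_trans (expR_ge1Dx _); rewrite lerD2l lerN2.
apply: ler_wpM2l => //; rewrite lef_pV2//.
case/andP: (x01) => x0' x1.
apply: (@le_trans _ _ k.+1%:R); last by rewrite ler_nat.
by rewrite ger_pMr ?ltr0n// gerBl ltW.
Qed.

Let wt_mode n k : (k <= n)%N -> wt n k <= wt n (mode n).
Proof.
move=> kn; have /andP[m1 m2] := mode_bounds n; have mn := mode_le n.
have [mk|km] := leqP (mode n) k.
  have H i : (mode n + i <= n)%N -> wt n (mode n + i) <= wt n (mode n).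
    elim: i => [|i IH]; first by rewrite addn0.
    rewrite addnS => mi; apply: le_trans (IH (ltnW mi)).
    apply: wt_down => //; rewrite natrD; have : 0 <= i%:R :> R by []. lra.
  by have := H (k - mode n)%N; rewrite subnKC//; apply.
have H i : (i <= mode n)%N -> wt n (mode n - i) <= wt n (mode n).
  elim: i => [|i IH]; first by rewrite subn0.
  move=> mi; apply: le_trans (IH (ltnW mi)).
  rewrite -(subnSK mi); apply: wt_up.
    by rewrite (subnSK mi) (leq_trans (leq_subr _ _)).
  rewrite natrB// -[i.+1%:R]natr1; have : 0 <= i%:R :> R by []. lra.
by have := H (mode n - k)%N (leq_subr _ _); rewrite subKn 1?ltnW.
Qed.

(** Since [wt] is largest at the mode, the profile bounds the weights. The factor [exp 2] and the
    loss from 1/2 to 1/4 in the exponent pay for the shifted centre and for the offset of the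
    mode. *)
Lemma bernstein_le_mode n k : (0 < n)%N -> bernstein k n x <=
  expR 2 * bernstein (mode n) n x * expR (- (1 / 4 * (k%:R - n%:R * x) ^+ 2 / n%:R)).
Proof.
move=> n0; have [nk|kn] := ltnP n k.
  by rewrite bernstein_small// mulr_ge0 ?expR_ge0// mulr_ge0 ?expR_ge0//; exact: bernstein_ge0.
have n0R : 0 < n%:R :> R by rewrite ltr0n.
have n1R : 1 <= n%:R :> R by rewrite ler1n.
have := wt_mode n k kn; rewrite /wt.
set d := k%:R - n%:R * x; have /andP[m1 m2] := mode_bounds n.
set dm := (mode n)%:R - _ - x + 1 / 2 in m1 m2 *.
move: (bernstein k n x) (bernstein (mode n) n x) (bernstein_ge0 (mode n) n) => b bm bm0.
rewrite -ler_pdivlMr ?expR_gt0// -expRN => /le_trans; apply.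
rewrite -[leLHS]mulrA [leRHS]mulrAC [leRHS]mulrC ler_wpM2l//.
rewrite -!expRD ler_expR.
have dm2 : dm ^+ 2 <= 1 by nra.
have i0 : 0 < n%:R^-1 :> R by rewrite invr_gt0.
have i1 : n%:R^-1 <= 1 :> R by rewrite invf_le1.
rewrite invfM; set i := n%:R^-1 in i0 i1 *.
have xb : (x - 1/2) ^+ 2 <= 1 by case/andP: (x01) => ? ?; nra.
have dd : d ^+ 2 / 2 - 1 <= (d - x + 1 / 2) ^+ 2.
  have -> : d - x + 1 / 2 = d - (x - 1 / 2) by ring.
  move: xb; set r := x - 1 / 2 => xb.
  have := sqr_ge0 (d - 2 * r); nra.
set e := (d - x + _) ^+ 2 in dd *; set dm' := dm ^+ 2 in dm2 *.
have h1 : (d ^+ 2 / 2 - 1) * i <= e * i by rewrite ler_wpM2r// ltW.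
have h2 : dm' * i <= 1 * i by rewrite ler_wpM2r// ltW.
move: h1 h2 i1; rewrite mulrBl; set u := d ^+ 2; lra.
Qed.

Lemma ln1B_approx (t : R) : t <= 1 / 2 -> `|ln (1 - t) + t| <= 2 * t ^+ 2.
Proof.
move=> t2; have p : 0 < 1 - t by lra.
have up : ln (1 - t) <= - t by apply: le_ln1Dx; lra.
have lo : - (t / (1 - t)) <= ln (1 - t).
  have : ln (1 + t / (1 - t)) <= t / (1 - t).
    by apply: le_ln1Dx; rewrite ltr_pdivlMr//; lra.
  have -> : 1 + t / (1 - t) = (1 - t)^-1 by field; exact: lt0r_neq0.
  by rewrite lnV ?posrE// lerNl.
have h : t / (1 - t) - t <= 2 * t ^+ 2.
  have -> : t / (1 - t) - t = t ^+ 2 / (1 - t) by field; exact: lt0r_neq0.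
  rewrite mulrC ler_wpM2r ?sqr_ge0// -[leRHS]invrK lef_pV2 ?posrE ?invr_gt0//; lra.
have := sqr_ge0 t; rewrite ler_norml => ?; apply/andP; split; lra.
Qed.

(** Logarithm of the weight over the Gaussian profile, now with the exact variance [n x (1 - x)];
    near the centre it is almost constant. *)
Let lw n k := ln (bernstein k n x) +
  (k%:R - n%:R * x - x + 1 / 2) ^+ 2 / (2 * (n%:R * s)).

Let lw_step n k (D : R) : (k < n)%N -> `|k%:R - n%:R * x| + 1 <= D ->
  4 * D <= n%:R * s -> `|lw n k.+1 - lw n k| <= 10 * D ^+ 2 / (n%:R * s) ^+ 2.
Proof.
move=> kn dD Dn; have n0 : (0 < n)%N by case: n kn dD Dn.
have n0R : 0 < n%:R :> R by rewrite ltr0n.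
have ns0 : 0 < n%:R * s by rewrite mulr_gt0.
case/andP: (x01) => x0' x1.
set d := k%:R - n%:R * x in dD *.
pose K := k.+1%:R * q.
have K0 : 0 < K by rewrite mulr_gt0// ltr0n.
(* [1 - t] is the ratio of the weights at [k + 1] and [k]. *)
pose t := (d + q) / K.
have dn := ler_norm d; have dn' := ler_norm (- d); rewrite normrN in dn'.
have KE : K = n%:R * s + (d + 1) * q by rewrite /K /d -[k.+1%:R]natr1; ring.
have dq : `|(d + 1) * q| <= D.
  rewrite normrM (gtr0_norm q0) (le_trans _ dD)//.
  have h1 : `|d + 1| <= `|d| + 1 by rewrite (le_trans (ler_normD _ _))// normr1.
  apply: (le_trans _ h1); rewrite -[leRHS]mulr1 ler_wpM2l//.
  by rewrite gerBl ltW.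
have Kh : n%:R * s / 2 <= K.
  by move: dq; rewrite KE ler_norml => /andP[? ?]; lra.
have dqn : `|d + q| <= D.
  by rewrite (le_trans (ler_normD _ _))// (gtr0_norm q0); lra.
have D0 : 0 <= D by exact: le_trans dqn.
have tb : `|t| <= 2 * D / (n%:R * s).
  rewrite normrM normfV (gtr0_norm K0) ler_pdivrMr//.
  rewrite (le_trans dqn)//.
  have -> : 2 * D / (n%:R * s) * K = D * (K / (n%:R * s / 2)).
    by field; rewrite !lt0r_neq0.
  by rewrite -[leLHS]mulr1 ler_wpM2l// ler_pdivlMr ?divr_gt0// mul1r.
have t12 : t <= 1 / 2.
  rewrite (le_trans (ler_norm _))// (le_trans tb)// ler_pdivrMr//; lra.
have := ln1B_approx t t12.
have -> : ln (1 - t) = ln (bernstein k.+1 n x) - ln (bernstein k n x).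
  rewrite -ln_div ?posrE ?bernstein_gt0// 1?ltnW//; congr ln.
  have b0 := bernstein_gt0 k n (ltnW kn).
  apply: (mulIf (lt0r_neq0 b0)); rewrite divfK ?lt0r_neq0//.
  apply: (mulIf (lt0r_neq0 K0)); rewrite -/K in KE *.
  rewrite -[RHS]/(_ * (k.+1%:R * q)) bernstein_ratio//.
  rewrite /t mulrAC mulrBl mul1r divfK ?lt0r_neq0// mulrC; congr (_ * _).
  by rewrite /K /d -[k.+1%:R]natr1; ring.
move=> hln.
have tt : `|t - (d + q) / (n%:R * s)| <= 2 * D ^+ 2 / (n%:R * s) ^+ 2.
  have -> : t - (d + q) / (n%:R * s) = - (t * (((d + 1) * q) / (n%:R * s))).
    rewrite /t; rewrite KE in K0 *; field; by rewrite !lt0r_neq0.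
  have h : `|(d + 1) * q / (n%:R * s)| <= D / (n%:R * s).
    by rewrite normrM normfV (gtr0_norm ns0) ler_wpM2r// invr_ge0 ltW.
  rewrite normrN normrM.
  rewrite (_ : 2 * D ^+ 2 / (n%:R * s) ^+ 2 = (2 * D / (n%:R * s)) * (D / (n%:R * s))); last first.
    by field; rewrite !lt0r_neq0.
  exact: ler_pM.
have t2 : 2 * t ^+ 2 <= 8 * D ^+ 2 / (n%:R * s) ^+ 2.
  rewrite -real_normK ?num_real//.
  rewrite (_ : 8 * D ^+ 2 / (n%:R * s) ^+ 2 = 2 * (2 * D / (n%:R * s)) ^+ 2); last first.
    by field; rewrite !lt0r_neq0.
  by rewrite ler_wpM2l// lerXn2r// nnegrE divr_ge0 ?mulr_ge0// ltW.
have -> : lw n k.+1 - lw n k =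
  (ln (bernstein k.+1 n x) - ln (bernstein k n x) + t) - (t - (d + q) / (n%:R * s)).
  rewrite /lw -[k.+1%:R]natr1 -/d /d; field; by rewrite !lt0r_neq0.
rewrite (le_trans (ler_normB _ _))// (le_trans (lerD hln tt))//.
apply: (le_trans (lerD t2 (lexx _))); rewrite -!mulrDl; lra.
Qed.

(** At most [2 D] steps separate [k] from the mode, each costing [10 D^2 / (n s)^2]. For [D] of
    order [sqrt n] the total is of order [1 / sqrt n]. *)
Let lw_mode n k (D : R) : (k <= n)%N -> `|k%:R - n%:R * x| + 2 <= D ->
  4 * D <= n%:R * s -> `|lw n k - lw n (mode n)| <= 20 * D ^+ 3 / (n%:R * s) ^+ 2.
Proof.
move=> kn dD Dn.
have /andP[m1 m2] := mode_bounds n; have mn := mode_le n.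
case/andP: (x01) => x0' x1'.
have dm : `|(mode n)%:R - n%:R * x| <= 1 by rewrite ler_norml; apply/andP; split; lra.
have D0 : 2 <= D by have := normr_ge0 (k%:R - n%:R * x); lra.
have E0 : 0 <= 10 * D ^+ 2 / (n%:R * s) ^+ 2.
  by apply: divr_ge0; [apply: mulr_ge0 => //|]; exact: sqr_ge0.
(* every integer between [i] and [i + j] is as close to [n x] as the endpoints *)
have H i j : (i + j <= n)%N -> `|i%:R - n%:R * x| + 1 <= D ->
    `|(i + j)%:R - n%:R * x| + 1 <= D ->
    `|lw n (i + j) - lw n i| <= j%:R * (10 * D ^+ 2 / (n%:R * s) ^+ 2).
  move=> ijn iD ijD.
  have : forall l, (l <= j)%N -> `|lw n (i + l) - lw n i| <= l%:R * (10 * D ^+ 2 / (n%:R * s) ^+ 2).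
    elim=> [_|l IH lj]; first by rewrite addn0 subrr normr0 mul0r.
    rewrite addnS -[l.+1%:R]natr1 mulrDl mul1r.
    rewrite (_ : _ - lw n i = (lw n (i + l) - lw n i) + (lw n (i + l).+1 - lw n (i + l))); last by ring.
    rewrite (le_trans (ler_normD _ _))// lerD ?IH 1?ltnW// lw_step//.
      by rewrite (leq_trans _ ijn)// ltn_add2l.
    have lj' : l%:R + 1 <= j%:R :> R by rewrite natr1 ler_nat.
    move: iD ijD; rewrite !natrD -!lerBrDr !ler_norml => /andP[? ?] /andP[? ?].
    have : 0 <= l%:R :> R by [].
    by move=> ?; apply/andP; split; lra.
  by apply.
have cnt i j : (i <= j)%N -> `|i%:R - n%:R * x| <= D -> `|j%:R - n%:R * x| <= D ->
    (j - i)%:R * (10 * D ^+ 2 / (n%:R * s) ^+ 2) <= 20 * D ^+ 3 / (n%:R * s) ^+ 2.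
  move=> ij; rewrite !ler_norml => /andP[? ?] /andP[? ?].
  rewrite (_ : 20 * D ^+ 3 / (n%:R * s) ^+ 2 = 2 * D * (10 * D ^+ 2 / (n%:R * s) ^+ 2)); last by ring.
  rewrite ler_wpM2r// natrB//; lra.
have [mk|km] := leqP (mode n) k.
  have := H (mode n) (k - mode n)%N; rewrite subnKC// => /(_ kn) h.
  rewrite (le_trans (h _ _))//; [lra|lra|].
  by apply: cnt => //; lra.
have := H k (mode n - k)%N; rewrite (subnKC (ltnW km)) => /(_ mn) h.
rewrite distrC (le_trans (h _ _))//; [lra|lra|].
by apply: cnt; [exact: ltnW|lra|lra].
Qed.

Lemma expR_sub1_le (y : R) : `|expR y - 1| <= `|y| * expR `|y|.
Proof.
have h1 := expR_ge1Dx y; have h2 := expR_ge1Dx (- y).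
have e0 := expR_gt0 y.
have h3 : expR y - 1 <= y * expR y.
  have : (1 - y) * expR y <= expR (- y) * expR y by apply: ler_wpM2r; [exact: ltW e0|exact: h2].
  rewrite expRN mulVf ?gt_eqF//; lra.
have h4 : expR y <= expR `|y| by rewrite ler_expR ler_norm.
have h5 : 1 <= expR `|y| by rewrite -expR0 ler_expR.
have h6 : `|y| <= `|y| * expR `|y| by rewrite -[leLHS]mulr1 ler_wpM2l.
have h7 : y * expR y <= `|y| * expR `|y|.
  apply: (@le_trans _ _ (`|y| * expR y)); first by apply: ler_wpM2r; [exact: ltW e0|exact: ler_norm].
  by rewrite ler_wpM2l.
have h8 := ler_norm (- y); rewrite normrN in h8.
by rewrite ler_norml; apply/andP; split; lra.
Qed.

Lemma mode_ratio_approx (A : R) : 0 <= A -> exists C : R, 0 <= C /\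
  forall n k, (0 < n)%N ->
  4 * ((A + 2) * Num.sqrt n%:R) <= n%:R * s ->
  `|k%:R - n%:R * x| <= A * Num.sqrt n%:R ->
  (k <= n)%N /\
  `|bernstein k n x / bernstein (mode n) n x
    - expR (- ((k%:R - n%:R * x) ^+ 2 / (2 * (n%:R * s))))| <= C / Num.sqrt n%:R.
Proof.
move=> A0.
case/andP: (x01) => x0' x1'.
(* The three terms bound the drift of [lw], the shift of the centre by [1/2 - x], and the offset of
   the mode from the centre. *)
pose C0 := 20 * (A + 2) ^+ 3 / s ^+ 2 + (A + 1) / (2 * s) + 1 / (2 * s).
have C0p : 0 <= C0.
  by rewrite /C0 !addr_ge0// divr_ge0 ?mulr_ge0 ?exprn_ge0//; lra.
exists (C0 * expR C0); split; first by rewrite mulr_ge0// expR_ge0.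
move=> n k n0; set r := Num.sqrt n%:R => rs.
have n1R : 1 <= n%:R :> R by rewrite ler1n.
have n0R : 0 < n%:R :> R by rewrite ltr0n.
have r1 : 1 <= r by rewrite -[leLHS]sqrtr1 ler_wsqrtr.
have r0 : 0 < r by lra.
have nE : n%:R = r ^+ 2 by rewrite sqr_sqrtr// ler0n.
set d := k%:R - n%:R * x => dA.
have kn : (k <= n)%N.
  rewrite -(ler_nat R); move: dA; rewrite ler_norml => /andP[_].
  have : n%:R * s <= n%:R * q.
    by rewrite ler_wpM2l// -[leRHS]mul1r ler_wpM2r// ltW.
  have h0 : 0 <= A * r by rewrite mulr_ge0// ltW.
  have e : (A + 2) * r = A * r + 2 * r by ring.
  move: rs; rewrite e /d; set Ar := A * r in h0 *; clearbody r Ar; lra.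
split => //.
have dD : `|d| + 2 <= (A + 2) * r by rewrite mulrDl; lra.
have hlw := lw_mode n k ((A + 2) * r) kn dD rs.
have b0 := bernstein_gt0 k n kn.
have bm0 := bernstein_gt0 (mode n) n (mode_le n).
have /andP[m1 m2] := mode_bounds n.
set dm := (mode n)%:R - n%:R * x - x + 1 / 2 in m1 m2.
pose y := - (d ^+ 2 / (2 * (n%:R * s))).
have ns0 : 0 < n%:R * s by rewrite mulr_gt0// ltr0n.
pose eta := (lw n k - lw n (mode n)) - (2 * d * (1/2 - x) + (1/2 - x) ^+ 2) / (2 * (n%:R * s))
  + dm ^+ 2 / (2 * (n%:R * s)).
have -> : bernstein k n x / bernstein (mode n) n x = expR (y + eta).
  rewrite -[LHS]lnK ?posrE ?divr_gt0// ln_div//; congr expR.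
  rewrite /eta /lw -/d -/dm /y; field; by rewrite !lt0r_neq0.
have i0 : 0 <= (2 * (n%:R * s))^-1 by rewrite invr_ge0 mulr_ge0// ltW.
have etab : `|eta| <= C0 / r.
  rewrite /C0 2!(mulrDl _ _ r^-1) /eta.
  rewrite (le_trans (ler_normD _ _))// lerD//.
    rewrite (le_trans (ler_normB _ _))// lerD//.
      apply: (le_trans hlw); rewrite nE; apply: eqW.
      by field; rewrite !lt0r_neq0.
    rewrite normrM normfV [`|2 * _|]gtr0_norm ?mulr_gt0//.
    rewrite (_ : (A + 1) / (2 * s) / r = ((A + 1) * r) / (2 * (n%:R * s))); last first.
      by rewrite nE; field; rewrite !lt0r_neq0.
    apply: (ler_wpM2r i0).
    have h : `|1 / 2 - x| <= 1 / 2 by rewrite ler_norml; apply/andP; split; lra.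
    have : `|2 * d * (1 / 2 - x)| <= A * r.
      rewrite 2!normrM (ger0_norm (_ : 0 <= 2 :> R))// mulrAC -[leRHS]mul1r.
      by apply: ler_pM => //; lra.
    have : `|(1 / 2 - x) ^+ 2| <= 1.
      by rewrite normrX exprn_ile1//; lra.
    have := ler_normD (2 * d * (1 / 2 - x)) ((1 / 2 - x) ^+ 2).
    have -> : (A + 1) * r = A * r + r by ring.
    move: (2 * d * _) (_ ^+ 2) (A * r) => a b c h1 h2 h3.
    by rewrite (le_trans h1)// lerD// (le_trans h2 r1).
  rewrite normrM normfV [`|2 * _|]gtr0_norm ?mulr_gt0//.
  rewrite (_ : 1 / (2 * s) / r = r / (2 * (n%:R * s))); last first.
    by rewrite nE; field; rewrite !lt0r_neq0.
  apply: (ler_wpM2r i0).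
  apply: (le_trans _ r1); rewrite normrX exprn_ile1// ler_norml; apply/andP; split; lra.
have -> : expR (y + eta) - expR y = expR y * (expR eta - 1) by rewrite expRD; ring.
rewrite normrM gtr0_norm ?expR_gt0//.
have y0 : expR y <= 1 by rewrite expR_le1 oppr_le0 divr_ge0 ?sqr_ge0// mulr_ge0// ltW.
rewrite (le_trans (_ : _ <= 1 * `|expR eta - 1|))//; first by rewrite ler_wpM2r.
rewrite mul1r (le_trans (expR_sub1_le _))// mulrAC ler_pM ?expR_ge0//.
rewrite ler_expR (le_trans etab)// -[leRHS]mulr1 ler_wpM2l// invf_le1//.
Qed.

End LocalLimit.

(** * Gaussian integrals and lattice sums *)

Section GaussInt.
Context {R : realType}.
Notation mu := (@lebesgue_measure R).

Lemma normal_pdf_gauss (c v : R) : 0 < c ->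
  normal_pdf 0 (Num.sqrt (1 / (2 * c))) v = (Num.sqrt (pi / c))^-1 * expR (- (c * v ^+ 2)).
Proof.
move=> c0.
have t0 : 0 < 1 / (2 * c) by rewrite divr_gt0// mulr_gt0.
rewrite normal_pdfE; last by rewrite gt_eqF// sqrtr_gt0.
rewrite /normal_peak /normal_fun subr0 sqr_sqrtr ?ltW//.
congr ((Num.sqrt _)^-1 * expR _).
  by field; rewrite gt_eqF.
by field; rewrite gt_eqF.
Qed.

Lemma integrable_gauss (c C : R) : 0 < c ->
  mu.-integrable setT (EFin \o (fun v => C * expR (- (c * v ^+ 2)))).
Proof.
move=> c0.
have p0 : 0 < Num.sqrt (pi / c) by rewrite sqrtr_gt0 divr_gt0// pi_gt0.
have -> : EFin \o (fun v => C * expR (- (c * v ^+ 2))) =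
  (fun v => (C * Num.sqrt (pi / c))%:E * (normal_pdf 0 (Num.sqrt (1 / (2 * c))) v)%:E)%E.
  apply/funext => v /=; rewrite -EFinM normal_pdf_gauss//; congr EFin.
  by field; rewrite gt_eqF.
apply: integrableZl => //; exact: integrable_normal_pdf.
Qed.

Lemma gauss_integral_scaled (c C : R) : 0 < c ->
  Rintegral mu setT (fun v => C * expR (- (c * v ^+ 2))) = C * Num.sqrt (pi / c).
Proof.
move=> c0.
have p0 : 0 < Num.sqrt (pi / c) by rewrite sqrtr_gt0 divr_gt0// pi_gt0.
rewrite /Rintegral.
have E v : (C * expR (- (c * v ^+ 2)))%:E = ((C * Num.sqrt (pi / c))%:E *
   (normal_pdf 0 (Num.sqrt (1 / (2 * c))) v)%:E)%E.
  by rewrite -EFinM normal_pdf_gauss//; congr EFin; field; rewrite gt_eqF.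
under eq_integral => v _ do rewrite E.
rewrite integralZl//; last exact: integrable_normal_pdf.
by rewrite integral_normal_pdf ?mule1// gt_eqF// sqrtr_gt0 divr_gt0// mulr_gt0.
Qed.

Lemma sqrt_nat_inv_cvg0 : (Num.sqrt (n%:R : R))^-1 @[n --> \oo] --> (0 : R).
Proof.
have -> : (fun n : nat => (Num.sqrt (n%:R : R))^-1) = (fun n => Num.sqrt (n%:R^-1)).
  by apply/funext => n; rewrite sqrtrV// ler0n.
rewrite -[X in _ --> X]sqrtr0.
apply: (@cvg_comp _ _ _ (fun n : nat => (n%:R : R)^-1) Num.sqrt _ (nbhs (0 : R))).
  exact: cvg_harmonic0.
exact: sqrt_continuous.
Qed.

End GaussInt.

Section LatticeSum.
Context {R : realType}.
Notation mu := (@lebesgue_measure R).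
Variables (x : R) (F : nat -> nat -> R) (N : nat -> nat) (G : R -> R) (C c : R) (M : nat).
Hypothesis x01 : 0 < x < 1.
Hypothesis c0 : 0 < c.
Hypothesis C0 : 0 <= C.
Hypothesis Fdom : forall n k, (M < n)%N -> (k < N n)%N ->
  `|F n k| <= C * expR (- (c * (k%:R - n%:R * x) ^+ 2 / n%:R)).
Hypothesis nN : forall n, (n <= N n)%N.
Hypothesis mG : measurable_fun setT G.
Hypothesis FG : forall v (k : nat -> nat),
  ((k n)%:R - n%:R * x) / Num.sqrt n%:R @[n --> \oo] --> v ->
  F n (k n) @[n --> \oo] --> G v.

Let cell n k : set R := `[(k%:R - n%:R * x) / Num.sqrt n%:R,
  (k.+1%:R - n%:R * x) / Num.sqrt n%:R[%classic.

(** The points [(k - n x) / sqrt n] are spaced by [1 / sqrt n], so the integral of this step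
    function is the normalised lattice sum. *)
Let stepf n v := \sum_(k < N n) F n k * \1_(cell n k) v.

Let cellP n k v : (0 < n)%N ->
  (v \in cell n k) = (k%:R <= n%:R * x + v * Num.sqrt n%:R < k.+1%:R).
Proof.
move=> n0; have r0 : 0 < Num.sqrt (n%:R : R) by rewrite sqrtr_gt0 ltr0n.
rewrite /cell; apply/idP/idP.
  rewrite inE /= in_itv/= ler_pdivrMr// ltr_pdivlMr// => /andP[? ?].
  by apply/andP; split; lra.
move=> /andP[? ?]; rewrite inE /= in_itv/= ler_pdivrMr// ltr_pdivlMr//.
by apply/andP; split; lra.
Qed.

Let stepf_in n k v : (0 < n)%N -> (k < N n)%N -> v \in cell n k -> stepf n v = F n k.
Proof.
move=> n0 kN vk; rewrite /stepf (bigD1 (Ordinal kN))//= indicE vk mulr1.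
rewrite big1 ?addr0// => j jk; rewrite indicE.
case: (boolP (v \in cell n j)) => [vj|_]; last by rewrite mulr0.
exfalso; move/eqP: jk; apply; apply/val_inj => /=.
move: vk vj; rewrite !cellP// => /andP[a1 a2] /andP[b1 b2].
have h1 : (j < k.+1)%N by rewrite -(ltr_nat R) (le_lt_trans b1 a2).
have h2 : (k < j.+1)%N by rewrite -(ltr_nat R) (le_lt_trans a1 b2).
by apply/eqP; rewrite eqn_leq; apply/andP.
Qed.

Let stepf_out n v : (forall k, (k < N n)%N -> v \notin cell n k) -> stepf n v = 0.
Proof.
by move=> H; rewrite /stepf big1// => k _; rewrite indicE (negbTE (H k _))// mulr0.
Qed.

(** On its cell, [v sqrt n] exceeds [k - n x] by at most 1, so $(k-nx)^2/n \ge v^2/2 - 1$; this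
    explains the factor [exp c] and the halved rate. *)
Let stepf_dom n v : (M < n)%N -> `|stepf n v| <= (C * expR c) * expR (- (c / 2 * v ^+ 2)).
Proof.
move=> Mn; have n0 : (0 < n)%N by exact: leq_ltn_trans Mn.
have [[k /andP[kN vk]]|H] := pselect (exists k, (k < N n)%N && (v \in cell n k)); last first.
  rewrite stepf_out ?normr0 ?mulr_ge0 ?expR_ge0// => k kN; apply/negP => vk.
  by apply: H; exists k; rewrite kN.
rewrite (stepf_in _ _ _ n0 kN vk) (le_trans (Fdom _ _ Mn kN))//.
rewrite -[leRHS]mulrA ler_wpM2l// -expRD ler_expR.
move: vk; rewrite cellP// -[k.+1%:R]natr1 => /andP[h1 h2].
set r := Num.sqrt n%:R in h1 h2.
have n1R : 1 <= n%:R :> R by rewrite ler1n.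
have n0R : 0 < n%:R :> R by rewrite ltr0n.
have nE : n%:R = r ^+ 2 by rewrite sqr_sqrtr// ler0n.
pose a := k%:R - n%:R * x.
have ab0 : 0 <= v * r - a <= 1 by rewrite /a; apply/andP; split; lra.
have ab : (v * r - a) ^+ 2 <= 1 by case/andP: ab0 => ? ?; rewrite exprn_ile1.
have h : v ^+ 2 / 2 - 1 <= a ^+ 2 / n%:R.
  rewrite ler_pdivlMr// mulrBl mul1r.
  have -> : v ^+ 2 / 2 * n%:R = (v * r) ^+ 2 / 2 by rewrite nE; ring.
  have := sqr_ge0 (2 * a - v * r); move: ab n1R; move: (v * r) => b; nra.
rewrite -/a; have : c * (v ^+ 2 / 2 - 1) <= c * (a ^+ 2 / n%:R) by rewrite ler_wpM2l// ltW.
rewrite -(mulrA c (a ^+ 2)); set e := a ^+ 2 / n%:R; set w := v ^+ 2; lra.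
Qed.

(** The cell containing [v] has as index the integer part of [n x + v sqrt n], which lies in the
    range of the sum for large [n] because [0 < x < 1]. *)
Let stepf_cvg v : stepf n v @[n --> \oo] --> G v.
Proof.
pose w n := n%:R * x + v * Num.sqrt n%:R.
pose k n := Num.truncn (w n).
case/andP: (x01) => x0 x1.
have inv0 := @sqrt_nat_inv_cvg0 R.
have w0 : \forall n \near \oo, 0 <= w n < n%:R.
  have e1 : 0 < Num.min (x / (`|v| + 1)) ((1 - x) / (`|v| + 1)).
    by rewrite lt_min !divr_gt0// subr_gt0.
  near=> n.
  have n0 : (0 < n)%N by near: n; exists 1%N.
  have r0 : 0 < Num.sqrt (n%:R : R) by rewrite sqrtr_gt0 ltr0n.
  have : (Num.sqrt (n%:R : R))^-1 < Num.min (x / (`|v| + 1)) ((1 - x) / (`|v| + 1)).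
    by near: n; apply: cvgr_lt inv0 _ _.
  have v1 : 0 < `|v| + 1 by rewrite ltr_pwDr.
  rewrite lt_min => /andP[].
  rewrite ltr_pdivlMr// mulrC ltr_pdivrMr// => h1.
  rewrite ltr_pdivlMr// mulrC ltr_pdivrMr// => h2.
  have nE : n%:R = Num.sqrt n%:R ^+ 2 :> R by rewrite sqr_sqrtr// ler0n.
  rewrite /w; move: nE h1 h2 r0; move: (Num.sqrt n%:R) => r nE h1 h2 r0; rewrite nE.
  have -> : r ^+ 2 * x + v * r = r * (x * r + v) by ring.
  have := ler_norm v; have := ler_norm (- v); rewrite normrN => ? ?.
  apply/andP; split; first by rewrite mulr_ge0 ?ltW//; lra.
  by rewrite expr2 ltr_pM2l//; lra.
have kc : ((k n)%:R - n%:R * x) / Num.sqrt n%:R @[n --> \oo] --> v.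
  apply/cvgrPdist_le => e e0; near=> n.
  have n0 : (0 < n)%N by near: n; exists 1%N.
  have r0 : 0 < Num.sqrt (n%:R : R) by rewrite sqrtr_gt0 ltr0n.
  have /andP[w1 w2] : 0 <= w n < n%:R by near: n.
  have /andP[t1 t2] := truncn_itv w1.
  apply: (@le_trans _ _ (Num.sqrt (n%:R : R))^-1); last by near: n; apply: cvgr_le inv0 _ _.
  have -> : v - ((k n)%:R - n%:R * x) / Num.sqrt n%:R = (w n - (k n)%:R) / Num.sqrt n%:R.
    by rewrite /w; field; rewrite gt_eqF.
  rewrite normrM normfV (gtr0_norm r0) ler_pdivrMr// mulVf ?gt_eqF//.
  move: t2; rewrite -[_.+1%:R]natr1 -/(k n) => t2.
  by rewrite ler_norml; apply/andP; split; rewrite /k; lra.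
apply: cvg_trans (FG _ _ kc); apply: near_eq_cvg; near=> n.
have n0 : (0 < n)%N by near: n; exists 1%N.
have /andP[w1 w2] : 0 <= w n < n%:R by near: n.
have t := truncn_itv w1.
apply/esym/stepf_in => //; last by rewrite cellP.
apply: leq_trans (nN n); rewrite -(ltr_nat R); apply: le_lt_trans w2.
by case/andP: t.
Unshelve. all: by end_near. Qed.

Let mcell n k : measurable (cell n k). Proof. exact: measurable_itv. Qed.

Let stepf_int n : (0 < n)%N ->
  Rintegral mu setT (stepf n) = (Num.sqrt n%:R)^-1 * \sum_(k < N n) F n k.
Proof.
move=> n0; have r0 : 0 < Num.sqrt (n%:R : R) by rewrite sqrtr_gt0 ltr0n.
rewrite /Rintegral /stepf.
under eq_integral do rewrite -sumEFin.
rewrite integral_sum//=; last first.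
  move=> k; under eq_fun do rewrite EFinM.
  apply: integrableZl => //; exact: integrable_indic_itv.
rewrite (eq_bigr (fun k : 'I_(N n) => (F n k / Num.sqrt n%:R)%:E)); last first.
  move=> k _; under eq_integral do rewrite EFinM.
  rewrite integralZl//; last exact: integrable_indic_itv.
  rewrite integral_indic//; last exact: mcell.
  transitivity ((F n k)%:E * mu (cell n k))%E.
    by congr (_ * mu _)%E; exact: setIT.
  rewrite /cell lebesgue_measure_itv/= lte_fin.
  rewrite ltr_pM2r ?invr_gt0// ltrD2r ltr_nat ltnSn.
  by rewrite -EFinD -EFinM -[_.+1%:R]natr1; congr EFin; field; rewrite gt_eqF.
by rewrite sumEFin /= mulr_sumr; apply: eq_bigr => k _; rewrite mulrC.
Qed.

Let mstepf n : measurable_fun [set: R] (stepf n).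
Proof.
by apply: measurable_sum => k; exact: measurable_funM.
Qed.

(** Dominated convergence for [stepf]. The hypothesis [FG] concerns all index sequences with
    convergent rescaled position because, for fixed [v], the lattice point below [v] moves with [n].
    The sequence is shifted by [M.+1] as the domination starts there. *)
Lemma lattice_sum_cvg :
  (Num.sqrt n%:R)^-1 * \sum_(k < N n) F n k @[n --> \oo] --> Rintegral mu setT G.
Proof.
have H := @dominated_convergence _ _ _ mu setT measurableT
  (fun n => EFin \o stepf (n + M.+1)) (EFin \o G)
  (EFin \o (fun v => (C * expR c) * expR (- (c / 2 * v ^+ 2)))).
have [iG _ lim] : [/\ mu.-integrable setT (EFin \o G),
  [sequence \int[mu]_v `| (EFin \o stepf (n + M.+1)) v - (EFin \o G) v |]_n @ \oo --> 0%E &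
  [sequence \int[mu]_v (EFin \o stepf (n + M.+1)) v]_n @ \oo --> \int[mu]_v (EFin \o G) v]%E.
  apply: H.
  - by move=> n; apply/measurable_EFinP; exact: mstepf.
  - exact/measurable_EFinP.
  - apply: aeW => v _; apply: cvg_EFin; first exact: nearW.
    by rewrite (cvg_shiftn M.+1 (stepf^~ v)).
  - by apply: integrable_gauss; rewrite divr_gt0.
  - by apply: aeW => v n _ /=; rewrite lee_fin stepf_dom// ltn_addl.
rewrite -(cvg_shiftn M.+1).
rewrite -[X in _ --> X](fineK (integrable_fin_num measurableT iG)) in lim.
move/fine_cvg : lim; apply: cvg_trans; apply: near_eq_cvg; apply: nearW => n.
by rewrite /= -stepf_int// addnS.
Qed.

End LatticeSum.

Section SeqLimits.
Context {R : realType}.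
Implicit Types (u v : nat -> R) (a b : R).

Lemma eqn_cvg {u v a} : (\forall n \near \oo, u n = v n) ->
  u n @[n --> \oo] --> a -> v n @[n --> \oo] --> a.
Proof. by move=> uv; apply: cvg_trans; exact: near_eq_cvg. Qed.

Lemma cvgnD {u v a b} : u n @[n --> \oo] --> a -> v n @[n --> \oo] --> b ->
  u n + v n @[n --> \oo] --> a + b.
Proof. by move=> ua vb; exact: cvgD. Qed.

Lemma cvgnB {u v a b} : u n @[n --> \oo] --> a -> v n @[n --> \oo] --> b ->
  u n - v n @[n --> \oo] --> a - b.
Proof. by move=> ua vb; exact: cvgB. Qed.

Lemma cvgnM {u v a b} : u n @[n --> \oo] --> a -> v n @[n --> \oo] --> b ->
  u n * v n @[n --> \oo] --> a * b.
Proof. by move=> ua vb; exact: cvgM. Qed.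

Lemma cvgnZ {u a} c : u n @[n --> \oo] --> a -> c * u n @[n --> \oo] --> c * a.
Proof. by move=> ua; apply: cvgM => //; exact: cvg_cst. Qed.

Lemma cvgnV {u a} : a != 0 -> u n @[n --> \oo] --> a ->
  (u n)^-1 @[n --> \oo] --> a^-1.
Proof. by move=> a0 ua; exact: cvgV. Qed.

Lemma cvgnX {u a} i : u n @[n --> \oo] --> a -> u n ^+ i @[n --> \oo] --> a ^+ i.
Proof.
by move=> ua; apply: (@cvg_comp _ _ _ u (fun x => x ^+ i) _ (nbhs a)) => //;
  exact: exprn_continuous.
Qed.

Lemma cvgn_comp {u a} {f : R -> R} : {for a, continuous f} -> u n @[n --> \oo] --> a ->
  f (u n) @[n --> \oo] --> f a.
Proof. by move=> fa ua; exact: (@cvg_comp _ _ _ u f _ (nbhs a)). Qed.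

Lemma seq_bounded_mul0 u v (B : R) : (forall n, `|u n| <= B) ->
  v n @[n --> \oo] --> (0 : R) -> u n * v n @[n --> \oo] --> (0 : R).
Proof.
move=> uB v0; apply/cvgrPdist_le => e e0.
have B0 : 0 <= B by exact: le_trans (normr_ge0 _) (uB 0%N).
have B1 : 0 < B + 1 by rewrite ltr_wpDl.
have e1 : 0 < e / (B + 1) by rewrite divr_gt0.
move/cvgrPdist_le : v0 => /(_ _ e1); apply: filterS => n.
rewrite !sub0r !normrN normrM => vn.
rewrite (le_trans (ler_pM _ _ (uB n) vn))// mulrA ler_pdivrMr//.
by rewrite mulrC ler_wpM2l ?lerDl// ltW.
Qed.

End SeqLimits.

(** * Local limit theorem for the weights and for the corrected kernel *)

Section LocalLimitCvg.
Context {R : realType}.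
Variable x : R.
Hypothesis x01 : 0 < x < 1.
Local Notation q := (1 - x).
Local Notation s := (x * (1 - x)).
Let x0 : 0 < x. Proof. by case/andP: x01. Qed.
Let q0 : 0 < q. Proof. by rewrite subr_gt0; case/andP: x01. Qed.
Let s0 : 0 < s. Proof. exact: mulr_gt0. Qed.

Lemma cvg_nat_near (n_ : nat -> nat) (M : nat) : n_ j @[j --> \oo] --> \oo ->
  \forall j \near \oo, (M <= n_ j)%N.
Proof. by move=> H; apply: (H [set n | (M <= n)%N]); exists M. Qed.

Lemma sqrt_nat_inv_comp0 (n_ : nat -> nat) : n_ j @[j --> \oo] --> \oo ->
  (Num.sqrt ((n_ j)%:R : R))^-1 @[j --> \oo] --> (0 : R).
Proof. by move=> H; exact: (cvg_comp _ _ H (@sqrt_nat_inv_cvg0 R)). Qed.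

(** Density of the centred Gaussian law with variance [x (1 - x)]. *)
Definition gdens (v : R) := (Num.sqrt (2 * pi * s))^-1 * expR (- (v ^+ 2 / (2 * s))).

(** The order is an arbitrary sequence [n_], since both [m - 1] and [m/2 - 1] are needed below. *)
Lemma mode_ratio_cvg (n_ k_ : nat -> nat) (v : R) :
  n_ j @[j --> \oo] --> \oo ->
  ((k_ j)%:R - (n_ j)%:R * x) / Num.sqrt (n_ j)%:R @[j --> \oo] --> v ->
  bernstein (k_ j) (n_ j) x / bernstein (mode x (n_ j)) (n_ j) x @[j --> \oo]
    --> expR (- (v ^+ 2 / (2 * s))).
Proof.
move=> noo kv.
set u := fun j => ((k_ j)%:R - (n_ j)%:R * x) / Num.sqrt (n_ j)%:R in kv.
have A0 : 0 <= `|v| + 1 by rewrite addr_ge0.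
have [C [C0 HC]] := mode_ratio_approx x x01 (`|v| + 1) A0.
have inv0 := sqrt_nat_inv_comp0 _ noo.
have ec : expR (- (u j ^+ 2 / (2 * s))) @[j --> \oo] --> expR (- (v ^+ 2 / (2 * s))).
  apply: (@cvg_comp _ _ _ (fun j => - (u j ^+ 2 / (2 * s))) expR _ (nbhs (- (v ^+ 2 / (2 * s))))); last exact: continuous_expR.
  apply: cvgN; apply: cvgM; last exact: cvg_cst.
  by rewrite expr2; under eq_fun do rewrite expr2; exact: cvgM.
have Cc : C / Num.sqrt (n_ j)%:R @[j --> \oo] --> (0 : R).
  by rewrite -[X in _ --> X](mulr0 C); apply: cvgM => //; exact: cvg_cst.
have dif : bernstein (k_ j) (n_ j) x / bernstein (mode x (n_ j)) (n_ j) x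
   - expR (- (u j ^+ 2 / (2 * s))) @[j --> \oo] --> (0 : R).
  apply/cvgrPdist_le => e e0; near=> j; rewrite sub0r normrN.
  have n0 : (0 < n_ j)%N by near: j; exact: cvg_nat_near.
  have r0 : 0 < Num.sqrt ((n_ j)%:R : R) by rewrite sqrtr_gt0 ltr0n.
  have nE : (n_ j)%:R = Num.sqrt (n_ j)%:R ^+ 2 :> R by rewrite sqr_sqrtr// ler0n.
  have h1 : 4 * ((`|v| + 1 + 2) * Num.sqrt (n_ j)%:R) <= (n_ j)%:R * s.
    have : (Num.sqrt ((n_ j)%:R : R))^-1 <= s / (4 * (`|v| + 1 + 2)).
      by near: j; apply: cvgr_le inv0 _ _; rewrite divr_gt0// mulr_gt0// ltr_wpDl.
    rewrite ler_pdivlMr; last by rewrite mulr_gt0// ltr_wpDl.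
    rewrite mulrC (ler_pdivrMr _ _ r0) => h.
    rewrite (_ : (n_ j)%:R * s = (s * Num.sqrt (n_ j)%:R) * Num.sqrt (n_ j)%:R).
      by rewrite mulrA ler_wpM2r// ltW.
    by rewrite [in LHS]nE; ring.
  have h2 : `|(k_ j)%:R - (n_ j)%:R * x| <= (`|v| + 1) * Num.sqrt (n_ j)%:R.
    have : `|u j| <= `|v| + 1.
      by near: j; apply: (cvgr_le (`|v|)); [exact: cvg_norm|rewrite ltrDl].
    by rewrite /u normrM normfV (gtr0_norm r0) ler_pdivrMr.
  have [_ h3] := HC _ _ n0 h1 h2.
  rewrite (_ : u j ^+ 2 / (2 * s) = ((k_ j)%:R - (n_ j)%:R * x) ^+ 2 / (2 * ((n_ j)%:R * s))); last first.
    by rewrite /u expr_div_n sqr_sqrtr ?ler0n//; field; rewrite !lt0r_neq0// ltr0n.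
  apply: (le_trans h3); near: j; exact: cvgr_le Cc _ _.
have H := cvgnD dif ec; rewrite add0r in H.
apply: (eqn_cvg _ H); by apply: nearW => j; rewrite /= subrK.
Unshelve. all: by end_near. Qed.

(** The weights sum to 1. Divided by the peak they form a lattice sum whose limit is the Gaussian
    integral [sqrt (2 pi s)], so [sqrt n] times the peak tends to its inverse. *)
Lemma mode_peak_cvg :
  Num.sqrt n%:R * bernstein (mode x n) n x @[n --> \oo]
    --> (Num.sqrt (2 * pi * s))^-1.
Proof.
have c2 : 0 < (2 * s)^-1 by rewrite invr_gt0 mulr_gt0.
have H : (Num.sqrt n%:R)^-1 * \sum_(k < n.+1) (bernstein k n x / bernstein (mode x n) n x)
    @[n --> \oo] --> Num.sqrt (2 * pi * s).
  have -> : Num.sqrt (2 * pi * s) =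
     Rintegral (@lebesgue_measure R) setT (fun v => 1 * expR (- ((2 * s)^-1 * v ^+ 2))).
    by rewrite gauss_integral_scaled// mul1r invrK; congr Num.sqrt; ring.
  apply: (@lattice_sum_cvg R x (fun n k => bernstein k n x / bernstein (mode x n) n x)
    succn _ (expR 2) (1 / 4) 0%N) => //.
  - move=> n k n0 _.
    have b0 := bernstein_gt0 x x01 (mode x n) n (mode_le x x01 n).
    rewrite normrM normfV (gtr0_norm b0) ger0_norm; last exact: bernstein_ge0.
    rewrite ler_pdivrMr// mulrAC; exact: bernstein_le_mode.
  - have /integrableP[/measurable_EFinP] := @integrable_gauss R _ 1 c2. exact.
  - move=> v k kv; rewrite mul1r [(2 * s)^-1 * _]mulrC.
    exact: (mode_ratio_cvg id k v (@cvg_id _ _) kv).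
have pc : 0 < Num.sqrt (2 * pi * s) :> R by rewrite sqrtr_gt0 !mulr_gt0// pi_gt0.
apply: (eqn_cvg _ (cvgnV (lt0r_neq0 pc) H)); apply: nearW => n /=.
rewrite -mulr_suml (_ : \sum_(k < n.+1) bernstein k n x = 1); last first.
  rewrite -(bin_moment0 x n); apply: eq_bigr => k _.
  by rewrite expr0 mulr1.
by rewrite mul1r -invfM invrK.
Qed.

Lemma bernstein_llt (n_ k_ : nat -> nat) (v : R) :
  n_ j @[j --> \oo] --> \oo ->
  ((k_ j)%:R - (n_ j)%:R * x) / Num.sqrt (n_ j)%:R @[j --> \oo] --> v ->
  Num.sqrt (n_ j)%:R * bernstein (k_ j) (n_ j) x @[j --> \oo] --> gdens v.
Proof.
move=> noo kv.
have P := cvg_comp _ _ noo mode_peak_cvg.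
apply: (eqn_cvg _ (cvgnM P (mode_ratio_cvg _ _ _ noo kv))); apply: nearW => j.
have b0 := bernstein_gt0 x x01 (mode x (n_ j)) (n_ j) (mode_le x x01 _).
by rewrite /=; field; exact: lt0r_neq0.
Qed.

Lemma bernstein_gauss_bound : exists C : R, 0 < C /\ forall n k, (0 < n)%N ->
  Num.sqrt n%:R * bernstein k n x <= C * expR (- (1 / 4 * (k%:R - n%:R * x) ^+ 2 / n%:R)).
Proof.
have [M [_ HM]] := cvg_seq_bounded (cvgP _ mode_peak_cvg).
have bd n : Num.sqrt n%:R * bernstein (mode x n) n x <= `|M| + 1.
  have := HM (`|M| + 1) _ n I; rewrite /= ltr_pwDr//; last exact: ler_norm.
  by move=> /(_ isT); apply: le_trans; exact: ler_norm.
exists ((`|M| + 1) * expR 2); split; first by rewrite mulr_gt0 ?expR_gt0// ltr_wpDl.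
move=> n k n0.
have h := bernstein_le_mode x x01 n k n0.
have r0 : 0 <= Num.sqrt (n%:R : R) by rewrite sqrtr_ge0.
apply: (le_trans (ler_wpM2l r0 h)).
move: (expR (- _)) (expR_ge0 (- (1 / 4 * (k%:R - n%:R * x) ^+ 2 / n%:R))) => E E0.
rewrite (_ : _ * (expR 2 * _ * E) =
  (Num.sqrt n%:R * bernstein (mode x n) n x) * (expR 2 * E)); last by ring.
rewrite -[leRHS]mulrA; apply: ler_wpM2r; last exact: bd.
by rewrite mulr_ge0 ?expR_ge0.
Qed.

Local Notation sq m := (Num.sqrt (m%:R : R)).

Lemma pred_infty : (fun m : nat => m.-1) @ \oo --> \oo.
Proof. by move=> A [M _ MA]; exists M.+1 => // -[//|m] /= Mm; exact: MA. Qed.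

Lemma half_pred_infty : (fun m : nat => m./2.-1) @ \oo --> \oo.
Proof.
move=> A [M _ MA]; exists (M.+1).*2 => // m /= Mm; apply: MA => /=.
have : (M.+1 <= m./2)%N by rewrite -(doubleK M.+1) half_leq.
by case: (m./2).
Qed.

(** The limits run over all [m], odd ones included; the rounding in [m./2] is carried as an explicit
    parity term. *)
Lemma halfE m : (m./2)%:R = (m%:R - (odd m)%:R) / 2 :> R.
Proof.
have h : m%:R = (odd m)%:R + 2 * (m./2)%:R :> R.
  by rewrite -{1}(odd_double_half m) natrD -mul2n natrM.
lra.
Qed.

Lemma half_predE m : (0 < m./2.-1)%N -> (m./2.-1)%:R = (m%:R - (odd m)%:R) / 2 - 1 :> R.
Proof.
move=> h; rewrite -halfE -[in RHS](prednK (n := m./2)); last by case: (m./2) h.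
by rewrite -[_.+1%:R]natr1 addrK.
Qed.

Lemma odd_bound m : (0 : R) <= (odd m)%:R <= (1 : R).
Proof. by case: (odd m); rewrite /= ?lexx ?ler01. Qed.

Lemma half_ratio_cvg : (m./2)%:R / m%:R @[m --> \oo] --> (1 / 2 : R).
Proof.
have inv := @cvg_harmonic0 R.
apply/cvgrPdist_le => e e0; near=> m.
have m0 : (0 < m)%N by near: m; exists 1%N.
have m0R : 0 < m%:R :> R by rewrite ltr0n.
rewrite halfE (_ : _ - _ = (odd m)%:R / 2 * (m%:R)^-1); last by field; rewrite gt_eqF.
apply: (@le_trans _ _ (m%:R)^-1); last by near: m; apply: cvgr_le inv _ _.
have /andP[b1 b2] := odd_bound m.
rewrite ger0_norm; last by rewrite mulr_ge0 ?invr_ge0// divr_ge0.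
by rewrite -[leRHS]mul1r; apply: ler_wpM2r; [rewrite invr_ge0|lra].
Unshelve. all: by end_near. Qed.

Lemma half_pred_ratio_cvg : (m./2.-1)%:R / m%:R @[m --> \oo] --> (1 / 2 : R).
Proof.
have H := cvgnB half_ratio_cvg cvg_harmonic0; rewrite subr0 in H.
apply: (eqn_cvg _ H); exists 2%N => // m /= m2.
have : (0 < m./2)%N by case: m m2 => [//|[//|m]] _.
case: (m./2) => // h _.
by rewrite -[h.+1%:R]natr1 mulrDl mul1r addrK.
Qed.

Lemma pred_ratio_cvg : (m.-1)%:R / m%:R @[m --> \oo] --> (1 : R).
Proof.
have H : 1 - (m%:R)^-1 @[m --> \oo] --> (1 - 0 : R) by apply: cvgnB => //; [exact: cvg_cst|exact: cvg_harmonic0].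
rewrite subr0 in H; apply: (eqn_cvg _ H); exists 1%N => // -[//|m] _ /=.
by rewrite -[m.+1%:R]natr1; field; rewrite natr1 pnatr_eq0.
Qed.

Lemma sqrt_ratio_cvg (n_ : nat -> nat) (t : R) : 0 < t ->
  (n_ m)%:R / m%:R @[m --> \oo] --> t ->
  sq m / sq (n_ m) @[m --> \oo] --> Num.sqrt t^-1.
Proof.
move=> t0 H.
have := cvgn_comp (f := Num.sqrt) (@sqrt_continuous _ _) (cvgnV (lt0r_neq0 t0) H).
apply: eqn_cvg; apply: nearW => m.
by rewrite invf_div sqrtrM// sqrtrV.
Qed.

(* [corrected_kernel m x] takes the value [kernel_value m k] on the k-th cell of
   the partition of ]0, 1] into m intervals *)
Definition kernel_value (m k : nat) : R :=
  2 * (m%:R * bernstein k m.-1 x) - (m./2)%:R * bernstein k./2 m./2.-1 x.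

(** On the coarse grid the cell has index [k./2] and the rescaled position is [v / sqrt 2]. The
    prefactor is half of [sqrt m / sqrt (m/2)], that is [1 / sqrt 2] in the limit. *)
Lemma scaled_kernel_value_cvg (k_ : nat -> nat) v :
  ((k_ m)%:R - m%:R * x) / sq m @[m --> \oo] --> v ->
  kernel_value m (k_ m) / sq m @[m --> \oo] -->
    2 * gdens v - gdens (v / Num.sqrt 2) / Num.sqrt 2.
Proof.
move=> kv.
have s2 : 0 < Num.sqrt 2 :> R by rewrite sqrtr_gt0.
have q1 : sq m / sq m.-1 @[m --> \oo] --> (1 : R).
  by have := sqrt_ratio_cvg predn _ ltr01 pred_ratio_cvg; rewrite invr1 sqrtr1.
have q2 : sq m / sq (m./2.-1) @[m --> \oo] --> Num.sqrt (2 : R).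
  have := sqrt_ratio_cvg (fun m => m./2.-1) _ _ half_pred_ratio_cvg.
  by rewrite div1r invrK; apply.
have i1 := sqrt_nat_inv_comp0 _ pred_infty.
have i2 := sqrt_nat_inv_comp0 _ half_pred_infty.
pose pos m := [/\ 0 < sq m, 0 < sq m.-1, 0 < sq (m./2.-1) & (0 < m./2.-1)%N].
have nz : \forall m \near \oo, pos m.
  exists 4%N => // -[//|[//|[//|[//|m]]]] _ /=.
  by rewrite /pos !sqrtr_gt0 !ltr0n.
have a1 : ((k_ m)%:R - (m.-1)%:R * x) / sq m.-1 @[m --> \oo] --> v.
  have H := cvgnD (cvgnM kv q1) (cvgnZ x i1).
  rewrite mulr1 mulr0 addr0 in H; apply: (eqn_cvg _ H).
  near=> m; have [m0 m1 m2 m3] : pos m by near: m.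
  have mE : m%:R = m.-1%:R + 1 :> R.
    by rewrite natr1 prednK//; move: m0; rewrite sqrtr_gt0 ltr0n.
  move: (sq m) (sq m.-1) m0 m1 => A B A0 B0.
  by rewrite mE; field; rewrite !lt0r_neq0.
(* Bounded rounding error due to the parities of [m] and [k m] and to the order [m/2 - 1]. *)
pose c m : R := x + x * (odd m)%:R / 2 - (odd (k_ m))%:R / 2.
have cb m : `|c m| <= 3.
  have /andP[b1 b2] := odd_bound m; have /andP[b3 b4] := odd_bound (k_ m).
  case/andP: (x01) => x0' x1'.
  have : 0 <= x * (odd m)%:R <= 1.
    by rewrite mulr_ge0 ?(ltW x0')//= -[leRHS]mulr1 ler_pM// ltW.
  by move=> /andP[b5 b6]; rewrite /c ler_norml; apply/andP; split; lra.
have a2 : ((k_ m)./2%:R - (m./2.-1)%:R * x) / sq (m./2.-1) @[m --> \oo] --> v / Num.sqrt 2.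
  have H := cvgnD (cvgnZ (1 / 2) (cvgnM kv q2)) (seq_bounded_mul0 _ _ _ cb i2).
  rewrite addr0 in H.
  have -> : v / Num.sqrt 2 = 1 / 2 * (v * Num.sqrt 2).
    have e2 : Num.sqrt 2 * Num.sqrt 2 = 2 :> R by rewrite -expr2 sqr_sqrtr.
    by apply: (mulIf (lt0r_neq0 s2)); rewrite divfK ?lt0r_neq0// -!mulrA e2; field.
  apply: (eqn_cvg _ H).
  near=> m; have [m0 m1 m2 m3] : pos m by near: m.
  have hE := half_predE m m3.
  rewrite halfE /c; move: (sq m) (sq (m./2.-1)) m0 m2 => A B A0 B0.
  by rewrite hE; field; rewrite !lt0r_neq0.
have L1 := bernstein_llt _ _ _ pred_infty a1.
have L2 := bernstein_llt _ _ _ half_pred_infty a2.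
have H := cvgnB (cvgnZ 2 (cvgnM L1 q1)) (cvgnM (cvgnM L2 q2) half_ratio_cvg).
have e : 2 * gdens v - gdens (v / Num.sqrt 2) / Num.sqrt 2 =
   2 * (gdens v * 1) - gdens (v / Num.sqrt 2) * Num.sqrt 2 * (1 / 2).
  have e2 : Num.sqrt 2 * Num.sqrt 2 = 2 :> R by rewrite -expr2 sqr_sqrtr.
  rewrite mulr1; congr (_ - _); rewrite -mulrA; congr (_ * _).
  by apply: (mulIf (lt0r_neq0 s2)); rewrite mulVf ?lt0r_neq0// mulrAC e2; field.
rewrite e; apply: (eqn_cvg _ H).
near=> m; have [m0 m1 m2 m3] : pos m by near: m.
have mE : m%:R = sq m ^+ 2 by rewrite sqr_sqrtr// ler0n.
rewrite /kernel_value.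
move: (bernstein _ _ _) (bernstein _ _ _) => b1 b2.
move: mE; move: (sq m) (sq m.-1) (sq (m./2.-1)) m0 m1 m2 => A B D A0 B0 D0 mE.
by rewrite mE; field; rewrite !lt0r_neq0.
Unshelve. all: by end_near. Qed.

(** With $D = (k-mx)^2/m$, the coarse grid only guarantees the exponent [D / 8 - 4], which times 1/4
    gives the rate 1/32 and the factor [exp 1]. The 8 adds [2 * 2] from the fine grid and 4 from the
    coarse one; [4 <= m] makes [m./2.-1] positive. *)
Lemma scaled_kernel_value_bound : exists C : R, 0 <= C /\ forall m k, (4 <= m)%N ->
  `|kernel_value m k / sq m| <= C * expR (- (1 / 32 * (k%:R - m%:R * x) ^+ 2 / m%:R)).
Proof.
have [C [C0 HC]] := bernstein_gauss_bound.
exists (8 * C * expR 1); split; first by rewrite !mulr_ge0 ?expR_ge0// ltW.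
case/andP: (x01) => x0' x1'.
move=> m k m4.
have mp0 : (0 < m.-1)%N by case: m m4 => [//|[//|m]].
have h0 : (0 < m./2.-1)%N by case: m m4 {mp0} => [//|[//|[//|[//|m]]]].
have r0 : 0 < sq m by rewrite sqrtr_gt0 ltr0n (leq_trans _ m4).
have r1 : 0 < sq m.-1 by rewrite sqrtr_gt0 ltr0n.
have r2 : 0 < sq (m./2.-1) by rewrite sqrtr_gt0 ltr0n.
have mE : m%:R = sq m ^+ 2 by rewrite sqr_sqrtr// ler0n.
have m1E : m%:R = m.-1%:R + 1 :> R by rewrite natr1 prednK// (leq_trans _ m4).
have hE := half_predE m h0.
have /andP[b1 b2] := odd_bound m; have /andP[b3 b4] := odd_bound k.
have mR : 4 <= m%:R :> R by rewrite (ler_nat _ 4).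
have pR : 1 <= m.-1%:R :> R by rewrite ler1n.
have hR : 1 <= (m./2.-1)%:R :> R by rewrite ler1n.
pose d := k%:R - m%:R * x.
pose D := d ^+ 2 / m%:R.
have D0 : 0 <= D by rewrite /D divr_ge0 ?sqr_ge0.
have E1 : expR (- (1 / 4 * (k%:R - m.-1%:R * x) ^+ 2 / m.-1%:R)) <= expR 1 * expR (- (1 / 32 * D)).
  rewrite -expRD ler_expR.
  have -> : k%:R - m.-1%:R * x = d + x by rewrite /d m1E; ring.
  have h : D / 2 - 1 <= (d + x) ^+ 2 / m.-1%:R.
    apply: (@le_trans _ _ ((d + x) ^+ 2 / m%:R)).
      rewrite ler_pdivlMr; last by lra.
      have -> : (D / 2 - 1) * m%:R = d ^+ 2 / 2 - m%:R.
        by rewrite /D; field; rewrite lt0r_neq0//; lra.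
      have := sqr_ge0 (d + 2 * x); have : x ^+ 2 <= 1 by rewrite exprn_ile1// ltW.
      rewrite !sqrrD; lra.
    by apply: ler_wpM2l; [exact: sqr_ge0|rewrite lef_pV2 ?posrE; lra].
  move: h; rewrite -(mulrA (1 / 4)); set e := (_ ^+ 2 / _); lra.
have E2 : expR (- (1 / 4 * (k./2%:R - (m./2.-1)%:R * x) ^+ 2 / (m./2.-1)%:R)) <= expR 1 * expR (- (1 / 32 * D)).
  rewrite -expRD ler_expR.
  pose c := x + x * (odd m)%:R / 2 - (odd k)%:R / 2.
  have xo : 0 <= x * (odd m)%:R <= 1.
    by rewrite mulr_ge0 ?(ltW x0')//= -[leRHS]mulr1 ler_pM// ltW.
  have cb : c ^+ 2 <= 2 ^+ 2.
    rewrite -(real_normK (num_real c)) lerXn2r// ?nnegrE// ler_norml.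
    by case/andP: xo => ? ?; rewrite /c; apply/andP; split; lra.
  have -> : k./2%:R - (m./2.-1)%:R * x = d / 2 + c by rewrite /d halfE hE /c; field.
  have h : D / 8 - 4 <= (d / 2 + c) ^+ 2 / (m./2.-1)%:R.
    rewrite ler_pdivlMr; last by lra.
    have Dh : D * (m./2.-1)%:R <= d ^+ 2.
      rewrite /D -mulrA ler_piMr ?sqr_ge0// mulrC ler_pdivrMr; last by lra.
      by rewrite mul1r hE; lra.
    rewrite (_ : (D / 8 - 4) * _ = (D * (m./2.-1)%:R) / 8 - 4 * (m./2.-1)%:R); last by ring.
    have := sqr_ge0 (d / 2 + 2 * c); move: cb Dh hR; clearbody c D d.
    set h := (m./2.-1)%:R; set P := D * h; clearbody P h.
    by rewrite !expr2; lra.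
  move: h; rewrite -(mulrA (1 / 4)); set e := (_ ^+ 2 / _); lra.
have q1 : sq m / sq m.-1 <= 2.
  rewrite ler_pdivrMr//.
  have -> : 2 = Num.sqrt (2 ^+ 2) :> R by rewrite sqrtr_sqr ger0_norm.
  rewrite -sqrtrM ?sqr_ge0// ler_wsqrtr//; lra.
have q2 : sq m / sq (m./2.-1) <= 4.
  rewrite ler_pdivrMr//.
  have -> : 4 = Num.sqrt (4 ^+ 2) :> R by rewrite sqrtr_sqr ger0_norm.
  rewrite -sqrtrM ?sqr_ge0// ler_wsqrtr//; lra.
have q3 : (m./2)%:R / m%:R <= 1 :> R.
  rewrite ler_pdivrMr; last by lra.
  by rewrite halfE; lra.
have B1 := le_trans (HC _ k mp0) (ler_wpM2l (ltW C0) E1).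
have B2 := le_trans (HC _ k./2 h0) (ler_wpM2l (ltW C0) E2).
have b10 := bernstein_ge0 x x01 k m.-1.
have b20 := bernstein_ge0 x x01 k./2 m./2.-1.
have -> : kernel_value m k / sq m =
  2 * ((sq m / sq m.-1) * (sq m.-1 * bernstein k m.-1 x)) -
  ((m./2)%:R / m%:R) * ((sq m / sq (m./2.-1)) * (sq (m./2.-1) * bernstein k./2 m./2.-1 x)).
  rewrite /kernel_value.
  move: (bernstein _ _ _) (bernstein _ _ _) => b1' b2'.
  move: mE; move: (sq m) (sq m.-1) (sq (m./2.-1)) r0 r1 r2 => A B E A0 B0 E0 mE'.
  by rewrite mE'; field; rewrite !lt0r_neq0.
set X := (C * _) in B1 B2.
have X0 : 0 <= X by rewrite /X !mulr_ge0 ?expR_ge0// ltW.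
have p1 : 0 <= sq m / sq m.-1 by apply: divr_ge0; exact: ltW.
have p2 : 0 <= sq m / sq (m./2.-1) by apply: divr_ge0; exact: ltW.
have p3 : 0 <= sq m.-1 * bernstein k m.-1 x by apply: mulr_ge0 => //; exact: ltW.
have p4 : 0 <= sq (m./2.-1) * bernstein k./2 m./2.-1 x.
  by apply: mulr_ge0 => //; exact: ltW.
have t1 := ler_pM p1 p3 q1 B1; have t2 := ler_pM p2 p4 q2 B2.
have t10 := mulr_ge0 p1 p3; have t20 := mulr_ge0 p2 p4.
move: t1 t2 t10 t20; set T1 := _ * (sq m.-1 * _); set T2 := _ * (_ * bernstein k./2 _ _) => t1 t2 t10 t20.
have t3 : ((m./2)%:R / m%:R) * T2 <= 1 * (4 * X) by apply: ler_pM => //; rewrite divr_ge0.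
have t30 : 0 <= ((m./2)%:R / m%:R) * T2 by rewrite mulr_ge0// divr_ge0.
rewrite (_ : 8 * C * expR 1 * _ = 8 * X); last by rewrite /X /D /d (mulrA (1 / 32) (_ ^+ 2)); ring.
by move: t3 t30; set T3 := _ * T2 => t3 t30; rewrite ler_norml; apply/andP; split; lra.
Qed.

End LocalLimitCvg.

(** * Second moment of the kernel and the constant of the variance *)

Section SecondMoment.
Context {R : realType}.
Variable x : R.
Hypothesis x01 : 0 < x < 1.
Local Notation s := (x * (1 - x)).
Local Notation sq m := (Num.sqrt (m%:R : R)).
Notation mu := (@lebesgue_measure R).

Lemma gauss_sum_integral (c1 c2 c3 C1 C2 C3 : R) : 0 < c1 -> 0 < c2 -> 0 < c3 ->
  let G := fun v : R => C1 * expR (- (c1 * v ^+ 2)) + C2 * expR (- (c2 * v ^+ 2))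
    + C3 * expR (- (c3 * v ^+ 2)) in
  measurable_fun [set: R] G /\
  Rintegral mu setT G =
    C1 * Num.sqrt (pi / c1) + C2 * Num.sqrt (pi / c2) + C3 * Num.sqrt (pi / c3).
Proof.
move=> c10 c20 c30 G.
have i1 := @integrable_gauss R c1 C1 c10.
have i2 := @integrable_gauss R c2 C2 c20.
have i3 := @integrable_gauss R c3 C3 c30.
split.
  apply: measurable_funD; first apply: measurable_funD.
  - by have /integrableP[/measurable_EFinP] := i1.
  - by have /integrableP[/measurable_EFinP] := i2.
  - by have /integrableP[/measurable_EFinP] := i3.
rewrite RintegralD//; last first.
  by have := integrableD measurableT i1 i2; apply: eq_integrable.
by rewrite RintegralD// !gauss_integral_scaled.
Qed.

Let G (fx v : R) := fx * (2 * gdens x v - gdens x (v / Num.sqrt 2) / Num.sqrt 2) ^+ 2.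

Lemma limit_second_moment (fx : R) : measurable_fun [set: R] (G fx) /\
  Rintegral mu setT (G fx) = C3 * fx * psi x.
Proof.
case/andP: (x01) => x0 x1.
have q0 : 0 < 1 - x by rewrite subr_gt0.
have s0 : 0 < s by exact: mulr_gt0.
have p0 : 0 < pi :> R by exact: pi_gt0.
pose K : R := (2 * pi * s)^-1.
have s20 : 0 < Num.sqrt 2 :> R by rewrite sqrtr_gt0.
have s30 : 0 < Num.sqrt 3 :> R by rewrite sqrtr_gt0.
have e2 : Num.sqrt 2 ^+ 2 = 2 :> R by rewrite sqr_sqrtr.
have e3 : Num.sqrt 3 ^+ 2 = 3 :> R by rewrite sqr_sqrtr.
have c1 : 0 < 1 / s by rewrite divr_gt0.
have c2 : 0 < 3 / (4 * s) by rewrite divr_gt0// mulr_gt0.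
have c3 : 0 < 1 / (2 * s) by rewrite divr_gt0// mulr_gt0.
(* Expansion of the square. The integrals with rates [1 / s], [3 / (4 s)] and [1 / (2 s)] produce
   respectively the terms [4], [- 4 sqrt (2 / 3)] and [1 / sqrt 2] of [C3]. *)
have GE : G fx = (fun v : R => (4 * fx * K) * expR (- (1 / s * v ^+ 2))
    + (- (4 / Num.sqrt 2) * fx * K) * expR (- (3 / (4 * s) * v ^+ 2))
    + (fx * K / 2) * expR (- (1 / (2 * s) * v ^+ 2))).
  apply/funext => v; rewrite /G /gdens.
  have KE : K = (Num.sqrt (2 * pi * s))^-1 ^+ 2.
    by rewrite exprVn sqr_sqrtr// ltW// !mulr_gt0.
  have ea : expR (- (1 / s * v ^+ 2)) = expR (- (v ^+ 2 / (2 * s))) ^+ 2.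
    rewrite -expRM_natl; congr expR; field; by rewrite !lt0r_neq0.
  have eb : expR (- (3 / (4 * s) * v ^+ 2)) =
      expR (- (v ^+ 2 / (2 * s))) * expR (- ((v / Num.sqrt 2) ^+ 2 / (2 * s))).
    rewrite -expRD expr_div_n e2; congr expR; field; by rewrite !lt0r_neq0.
  have ec : expR (- (1 / (2 * s) * v ^+ 2)) = expR (- ((v / Num.sqrt 2) ^+ 2 / (2 * s))) ^+ 2.
    rewrite -expRM_natl expr_div_n e2; congr expR; field; by rewrite !lt0r_neq0.
  rewrite ea eb ec KE.
  have i2 : (1 / 2 : R) = (Num.sqrt 2)^-1 ^+ 2 by rewrite exprVn e2 div1r.
  move: (expR _) (expR _) (Num.sqrt (2 * pi * s))^-1 => A B W.
  have -> : fx * W ^+ 2 / 2 = fx * W ^+ 2 * (1 / 2) by rewrite mul1r.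
  by rewrite i2; field; rewrite lt0r_neq0.
have [mG IG] := @gauss_sum_integral _ _ _ (4 * fx * K) (- (4 / Num.sqrt 2) * fx * K) (fx * K / 2) c1 c2 c3.
rewrite GE; split; first exact: mG.
rewrite IG.
pose w := Num.sqrt (pi * s).
have w0 : 0 < w by rewrite sqrtr_gt0 mulr_gt0.
have w2 : w ^+ 2 = pi * s by rewrite sqr_sqrtr// ltW// mulr_gt0.
have -> : pi / (1 / s) = pi * s by field; rewrite !lt0r_neq0.
have -> : pi / (3 / (4 * s)) = (2 / Num.sqrt 3) ^+ 2 * (pi * s).
  by rewrite expr_div_n e3; field; rewrite !lt0r_neq0.
have -> : pi / (1 / (2 * s)) = 2 * (pi * s) by field; rewrite !lt0r_neq0.
have -> : Num.sqrt ((2 / Num.sqrt 3) ^+ 2 * (pi * s)) = 2 / Num.sqrt 3 * w.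
  by rewrite sqrtrM ?sqr_ge0// sqrtr_sqr gtr0_norm// divr_gt0.
have -> : Num.sqrt (2 * (pi * s)) = Num.sqrt 2 * w by rewrite sqrtrM.
rewrite -/w /C3 /psi.
have -> : Num.sqrt (4 * pi * x * (1 - x)) = 2 * w.
  rewrite (_ : 4 * pi * x * (1 - x) = 2 ^+ 2 * (pi * s)); last by ring.
  by rewrite sqrtrM ?sqr_ge0// sqrtr_sqr gtr0_norm.
have -> : Num.sqrt (2 / 3) = Num.sqrt 2 / Num.sqrt 3 :> R by rewrite sqrtrM// sqrtrV.
have -> : K = (2 * w ^+ 2)^-1 by rewrite w2 /K; congr (_^-1); ring.
move: (Num.sqrt 2) (Num.sqrt 3) s20 s30 e2 => A B A0 B0 A2.
have i1 : 2 / A = A by rewrite -A2 expr2 mulfK// lt0r_neq0.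
have i2 : A / 2 = A^-1 by rewrite -A2 expr2 invfM mulrA divff ?lt0r_neq0// mul1r.
transitivity (fx * (2 * w)^-1 * (4 - 4 * (2 / A) / B + A / 2)).
  by field; rewrite !lt0r_neq0.
by rewrite i1 i2; field; rewrite !lt0r_neq0.
Qed.

(** Here [p m k] is a cell probability. Once [m] is paired with it and [1 / sqrt m] with each kernel
    factor, the remaining [1 / sqrt m] is the spacing of the lattice; the rate 1/16 is 1/32 doubled
    by squaring. *)
Lemma second_moment_cvg (p : nat -> nat -> R) (B fx : R) :
  (forall m k, (k < m)%N -> `|m%:R * p m k| <= B) ->
  (forall (v : R) (k : nat -> nat), ((k m)%:R - m%:R * x) / sq m @[m --> \oo] --> v ->
     m%:R * p m (k m) @[m --> \oo] --> fx) ->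
  (sq m)^-1 * \sum_(k < m) p m k * kernel_value x m k ^+ 2 @[m --> \oo]
    --> C3 * fx * psi x.
Proof.
move=> pB pfx.
have B0 : 0 <= B by exact: le_trans (normr_ge0 _) (pB 1%N 0%N isT).
have [C [C0 HC]] := scaled_kernel_value_bound x x01.
have [mG <-] := limit_second_moment fx.
have H := @lattice_sum_cvg R x
  (fun m k => (m%:R * p m k) * (kernel_value x m k / sq m) ^+ 2) id (G fx)
  (B * C ^+ 2) (1 / 16) 3 x01.
have {}H := H _ _ _ _ mG.
have : (sq n)^-1 * \sum_(k < n) n%:R * p n k * (kernel_value x n k / sq n) ^+ 2
    @[n --> \oo] --> Rintegral mu setT (G fx).
  apply: H => //.
  - by rewrite mulr_ge0// sqr_ge0.
  - move=> m k m4 km; have m0 : (0 < m)%N by exact: leq_ltn_trans m4.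
    rewrite normrM normrX.
    have h := HC m k m4.
    have h2 := pB m k km.
    rewrite -[leRHS]mulrA; apply: ler_pM => //.
    rewrite (_ : C ^+ 2 * _ = (C * expR (- (1 / 32 * (k%:R - m%:R * x) ^+ 2 / m%:R))) ^+ 2).
      by rewrite lerXn2r// nnegrE// mulr_ge0// expR_ge0.
    rewrite exprMn -expRM_natl; congr (_ * expR _); field; by rewrite pnatr_eq0 -lt0n.
  - move=> v k kv; apply: cvgnM; first exact: pfx kv.
    exact/cvgnX/scaled_kernel_value_cvg.
apply: eqn_cvg; exists 1%N => // m /= m0; congr (_ * _).
apply: eq_bigr => k _; rewrite expr_div_n sqr_sqrtr ?ler0n//.
by field; rewrite lt0r_neq0// ltr0n.
Qed.

Lemma kernel_value_bound : exists C : R, 0 <= C /\ forall m k, (4 <= m)%N ->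
  `|kernel_value x m k| <= C * sq m.
Proof.
have [C [C0 HC]] := scaled_kernel_value_bound x x01.
exists C; split => // m k m4.
have r0 : 0 < sq m by rewrite sqrtr_gt0 ltr0n (leq_trans _ m4).
have := HC m k m4; rewrite normrM normfV (gtr0_norm r0) ler_pdivrMr// => /le_trans; apply.
apply: ler_wpM2r; first exact: ltW.
rewrite -[leRHS]mulr1; apply: ler_wpM2l => //; rewrite expR_le1 oppr_le0.
by rewrite divr_ge0// mulr_ge0// sqr_ge0.
Qed.

End SecondMoment.

(** * Taylor expansion and bias *)

Section Taylor.
Context {R : realType}.
Implicit Types (f F : R -> R).

(* Order-raising step: the mean value theorem turns [F' = O(|y - x|^n)] and
   [F x = 0] into [F = O(|y - x|^(n+1))]. *)
Lemma mvt_power_bound (F F' : R -> R) (x e eta : R) (n : nat) : 0 <= eta ->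
  (forall y, `|y - x| < e -> is_derive y 1 F (F' y)) -> F x = 0 ->
  (forall y, `|y - x| < e -> `|F' y| <= eta * `|y - x| ^+ n) ->
  forall y, `|y - x| < e -> `|F y| <= eta * `|y - x| ^+ n.+1.
Proof.
move=> eta0 dF F0 bF' y ye.
have cF z : `|z - x| < e -> {for z, continuous F}.
  move=> ze; apply/differentiable_continuous/derivable1_diffP.
  by have := dF z ze => -[].
have main c : `|c - x| <= `|y - x| -> F y - F x = F' c * (y - x) ->
    `|F y| <= eta * `|y - x| ^+ n.+1.
  move=> cx; rewrite F0 subr0 => ->; rewrite normrM exprSr mulrA ler_wpM2r//.
  rewrite (le_trans (bF' c (le_lt_trans cx ye)))// ler_wpM2l//.
  by rewrite lerXn2r// ?nnegrE.
have [xy|yx|xy] := ltgtP x y; last by rewrite -xy F0 normr0 subrr normr0 expr0n mulr0.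
  have inn z : z \in `[x, y] -> `|z - x| <= `|y - x|.
    by rewrite in_itv/= => /andP[z1 z2]; rewrite !ger0_norm ?subr_ge0 ?lerB// ltW.
  have [c cxy eq] := @MVT_segment R F F' x y (ltW xy)
    (fun z zxy => dF z (le_lt_trans (inn z (subset_itv_oo_cc zxy)) ye))
    (derivable_within_continuous (fun z zxy => @ex_derive _ _ _ _ _ _ _
      (dF z (le_lt_trans (inn z zxy) ye)))).
  exact: (main c (inn c cxy) eq).
have inn z : z \in `[y, x] -> `|z - x| <= `|y - x|.
  rewrite in_itv/= => /andP[z1 z2].
  by rewrite !ler0_norm ?subr_le0 ?lerN2 ?lerB// ltW.
have [c cxy eq] := @MVT_segment R F F' y x (ltW yx)
    (fun z zxy => dF z (le_lt_trans (inn z (subset_itv_oo_cc zxy)) ye))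
    (derivable_within_continuous (fun z zxy => @ex_derive _ _ _ _ _ _ _
      (dF z (le_lt_trans (inn z zxy) ye)))).
apply: (main c (inn c cxy)); rewrite -[LHS]opprB eq; ring.
Qed.

(** Near an interior point the restriction to [[a, b]] is void, so the relative derivative is the
    ordinary one. *)
Lemma derivative_on_is_derive (a b : R) f f' (y : R) : derivative_on `[a, b] f f' ->
  a < y < b -> is_derive y 1 f (f' y).
Proof.
move=> df /andP[ay yb].
have yab : `[a, b]%classic y by rewrite /= in_itv/= !ltW.
have H : h^-1 *: (f (h *: (1 : R) + y) - f y) @[h --> (0 : R)^'] --> f' y.
  apply/cvgrPdist_le => e e0.
  move: (df y yab) => /cvgrPdist_le/(_ _ e0); rewrite !near_withinE.
  move=> /nbhs_ballP[d /= d0 Hd]; apply/nbhs_ballP.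
  exists (Num.min d (Num.min (y - a) (b - y))) => /=.
    by rewrite !lt_min d0 !subr_gt0 ay yb.
  move=> h; rewrite /ball /= sub0r normrN !lt_min => /andP[hd /andP[ha hb]] h0.
  have e1 : h *: (1 : R) = h by rewrite -[LHS]/(h * 1) mulr1.
  have := Hd (h + y); rewrite /ball /= opprD addrCA subrr addr0 normrN => /(_ hd).
  rewrite e1 addrK -[h^-1 *: _]/(h^-1 * _) mulrC; apply; split.
    move: ha hb; rewrite !ltr_norml => /andP[? ?] /andP[? ?].
    by rewrite /= in_itv/=; apply/andP; split; lra.
  by move=> /= hy; move/eqP: h0; apply; lra.
apply: DeriveDef; first by apply/cvg_ex; exists (f' y).
exact: cvg_lim H.
Qed.

Lemma derivative_on_within_continuous (a b : R) f f' :
  derivative_on `[a, b] f f' -> {within `[a, b], continuous f}.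
Proof.
move=> df; apply/subspace_continuousP => y yab.
apply/cvgrPdist_le => e e0.
move: (df y yab) => /cvgrPdist_le/(_ _ ltr01); rewrite !near_withinE.
move=> /nbhs_ballP[d /= d0 Hd]; apply/nbhs_ballP.
pose M := `|f' y| + 1.
have M0 : 0 < M by rewrite ltr_pwDr.
exists (Num.min d (e / M)) => /=; first by rewrite lt_min d0 divr_gt0.
move=> z; rewrite /ball /= lt_min => /andP[zd ze] zab.
have [->|zy] := eqVneq z y; first by rewrite subrr normr0 ltW.
have := Hd z zd; have zy' : (`[a, b]%classic `\ y) z by split => //; exact/eqP.
move=> /(_ zy') h.
have zy0 : 0 < `|z - y| by rewrite normr_gt0 subr_eq0.
have : `|(f z - f y) / (z - y)| <= M.
  rewrite /M -lerBlDl; apply: le_trans h; rewrite [leRHS]distrC.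
  exact: lerB_dist.
rewrite normrM normfV ler_pdivrMr// [in `|f y - _|]distrC => /le_trans; apply.
move: ze; rewrite distrC ltr_pdivlMr// => ze.
by rewrite mulrC ltW.
Qed.

Lemma is_derive_pow_shift (x c y : R) (n : nat) :
  is_derive y 1 (fun z : R => c * (z - x) ^+ n.+1) (c * (n.+1%:R * (y - x) ^+ n)).
Proof.
have d1 : is_derive y 1 (fun z : R => z - x) 1.
  by rewrite -[X in is_derive _ _ _ X]subr0; apply: is_deriveB.
have d2 : is_derive y 1 (fun z : R => (z - x) ^+ n.+1) (n.+1%:R * (y - x) ^+ n).
  have := @is_deriveX _ _ _ n.+1 y 1 _ d1.
  by rewrite /= -[_ *: (1 : R)]/(_ * 1) mulr1 exprfctE.
exact: is_deriveZ.
Qed.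

Lemma is_derive_eqr {F : R -> R} {t a b : R} : is_derive t 1 F a -> a = b ->
  is_derive t 1 F b.
Proof. by move=> H <-. Qed.

(** Differentiability of [g 3] at [x] bounds its first-order remainder by [eta |y - x|];
    [mvt_power_bound] lifts this through the remainders of [g 2], [g 1] and [g 0]. *)
Lemma taylor4_peano f (g : nat -> R -> R) (x eta : R) :
  (forall i, (i < 4)%N -> derivative_on `[0, 1] (g i) (g i.+1)) ->
  0 < x < 1 -> 0 < eta ->
  exists2 d, 0 < d & forall y, `|y - x| < d ->
    `|g 0%N y - (g 0%N x + g 1%N x * (y - x) + g 2%N x / 2 * (y - x) ^+ 2
       + g 3%N x / 6 * (y - x) ^+ 3 + g 4%N x / 24 * (y - x) ^+ 4)|
    <= eta * `|y - x| ^+ 4.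
Proof.
move=> dg /andP[x0 x1] eta0.
have x01' : `[0, 1]%classic x by rewrite /= in_itv/= !ltW.
have := dg 3%N isT x x01' => /cvgrPdist_le/(_ _ eta0); rewrite !near_withinE.
move=> /nbhs_ballP[d0 /= d00 Hd].
pose d := Num.min d0 (Num.min x (1 - x)).
have dpos : 0 < d by rewrite !lt_min d00 x0 subr_gt0.
have dg' i y : (i < 4)%N -> `|y - x| < d -> is_derive y 1 (g i) (g i.+1 y).
  move=> i4; rewrite !lt_min => /andP[_ /andP[y1 y2]].
  apply: (derivative_on_is_derive 0 1 _ _ _ (dg i i4)).
  by move: y1 y2; rewrite !ltr_norml => /andP[? ?] /andP[? ?]; apply/andP; split; lra.
exists d => //.
pose F3 y := g 3%N y - g 3%N x - g 4%N x * (y - x).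
pose F2 y := g 2%N y - g 2%N x - g 3%N x * (y - x) - g 4%N x / 2 * (y - x) ^+ 2.
pose F1 y := g 1%N y - g 1%N x - g 2%N x * (y - x) - g 3%N x / 2 * (y - x) ^+ 2
  - g 4%N x / 6 * (y - x) ^+ 3.
pose F0 y := g 0%N y - g 0%N x - g 1%N x * (y - x) - g 2%N x / 2 * (y - x) ^+ 2
  - g 3%N x / 6 * (y - x) ^+ 3 - g 4%N x / 24 * (y - x) ^+ 4.
have b3 y : `|y - x| < d -> `|F3 y| <= eta * `|y - x| ^+ 1.
  rewrite !lt_min expr1 => /andP[y0 /andP[y1 y2]].
  have [->|yx] := eqVneq y x; first by rewrite /F3 !subrr mulr0 subr0 !normr0 mulr0.
  have := Hd y; rewrite /ball /= distrC => /(_ y0) h.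
  have yx0 : 0 < `|y - x| by rewrite normr_gt0 subr_eq0.
  have {}h : `|g 4%N x - (g 3%N y - g 3%N x) / (y - x)| <= eta.
    apply: h; split; last exact/eqP.
    move: y1 y2; rewrite !ltr_norml => /andP[? ?] /andP[? ?].
    by rewrite /= in_itv/=; apply/andP; split; lra.
  have := ler_wpM2r (ltW yx0) h; rewrite -normrM mulrBl divfK ?subr_eq0// => h'.
  by rewrite /F3 distrC; move: h'; rewrite -normrN opprB.
have P1 (n : nat) (c y : R) : is_derive y 1 (fun z : R => c * (z - x) ^+ n.+1) (c * (n.+1%:R * (y - x) ^+ n)) by exact: is_derive_pow_shift.
have dF2 y : `|y - x| < d -> is_derive y 1 F2 (F3 y).
  move=> yd; have h := dg' 2%N y isT yd.
  have h1 := P1 0%N (g 3%N x) y; have h2 := P1 1%N (g 4%N x / 2) y.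
  apply: (is_derive_eqr (is_deriveB (is_deriveB (is_deriveB h (is_derive_cst (g 2%N x) y 1)) h1) h2)).
  by rewrite /F3 expr0 expr1; field.
have dF1 y : `|y - x| < d -> is_derive y 1 F1 (F2 y).
  move=> yd; have h := dg' 1%N y isT yd.
  have h1 := P1 0%N (g 2%N x) y; have h2 := P1 1%N (g 3%N x / 2) y.
  have h3 := P1 2%N (g 4%N x / 6) y.
  apply: (is_derive_eqr (is_deriveB (is_deriveB (is_deriveB (is_deriveB h (is_derive_cst (g 1%N x) y 1)) h1) h2) h3)).
  by rewrite /F2 expr0 expr1; field.
have dF0 y : `|y - x| < d -> is_derive y 1 F0 (F1 y).
  move=> yd; have h := dg' 0%N y isT yd.
  have h1 := P1 0%N (g 1%N x) y; have h2 := P1 1%N (g 2%N x / 2) y.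
  have h3 := P1 2%N (g 3%N x / 6) y; have h4 := P1 3%N (g 4%N x / 24) y.
  apply: (is_derive_eqr (is_deriveB (is_deriveB (is_deriveB (is_deriveB (is_deriveB h (is_derive_cst (g 0%N x) y 1)) h1) h2) h3) h4)).
  by rewrite /F1 expr0 expr1; field.
have z2 : F2 x = 0 by rewrite /F2; ring.
have z1 : F1 x = 0 by rewrite /F1; ring.
have z0 : F0 x = 0 by rewrite /F0; ring.
have b2 := mvt_power_bound F2 F3 x d eta 1 (ltW eta0) dF2 z2 b3.
have b1 := mvt_power_bound F1 F2 x d eta 2 (ltW eta0) dF1 z1 b2.
move=> y yd; rewrite (_ : _ - (_ + _) = F0 y); last by rewrite /F0; ring.
exact: (mvt_power_bound F0 F1 x d eta 3 (ltW eta0) dF0 z0 b1).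
Qed.

Lemma derivative_on_bounded (a b : R) f f' : a <= b -> derivative_on `[a, b] f f' ->
  exists2 B : R, 0 <= B & forall y, a <= y <= b -> `|f y| <= B.
Proof.
move=> ab /derivative_on_within_continuous cf.
have [c1 _ M1] := @EVT_max R f a b ab cf.
have [c2 _ M2] := @EVT_min R f a b ab cf.
exists (`|f c1| + `|f c2|); first by rewrite addr_ge0.
move=> y yab; have yab' : y \in `[a, b] by rewrite in_itv.
have := M1 y yab'; have := M2 y yab'.
have := ler_norm (f c1); have := ler_norm (- f c2); rewrite normrN.
have := normr_ge0 (f c1); have := normr_ge0 (f c2).
by move=> *; rewrite ler_norml; apply/andP; split; lra.
Qed.

(* On the whole of [0, 1] the fourth-order remainder is absorbed by a sixth
   power away from [x]. *)
Lemma taylor4_global f (g : nat -> R -> R) (x eta : R) : g 0%N = f ->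
  (forall i, (i < 4)%N -> derivative_on `[0, 1] (g i) (g i.+1)) ->
  0 < x < 1 -> 0 < eta ->
  exists2 K, 0 <= K & forall y, 0 <= y <= 1 ->
    `|f y - (g 0%N x + g 1%N x * (y - x) + g 2%N x / 2 * (y - x) ^+ 2
       + g 3%N x / 6 * (y - x) ^+ 3 + g 4%N x / 24 * (y - x) ^+ 4)|
    <= eta * (y - x) ^+ 4 + K * (y - x) ^+ 6.
Proof.
move=> g0 dg x01 eta0.
have [d d0 Hd] := taylor4_peano f g x eta dg x01 eta0.
have [B1 B10 HB1] := derivative_on_bounded 0 1 _ _ ler01 (dg 0%N isT).
pose B := B1 + (`|g 0%N x| + `|g 1%N x| + `|g 2%N x / 2|
  + `|g 3%N x / 6| + `|g 4%N x / 24|).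
have B0 : 0 <= B by rewrite !addr_ge0.
exists (B / d ^+ 6); first by rewrite divr_ge0// exprn_ge0// ltW.
move=> y y01.
have even4 : (y - x) ^+ 4 = `|y - x| ^+ 4 by rewrite -normrX ger0_norm// exprn_even_ge0.
have even6 : (y - x) ^+ 6 = `|y - x| ^+ 6 by rewrite -normrX ger0_norm// exprn_even_ge0.
have r6 : 0 <= B / d ^+ 6 * (y - x) ^+ 6.
  by rewrite even6 mulr_ge0 ?exprn_ge0// divr_ge0// exprn_ge0// ltW.
have [yd|dy] := ltP `|y - x| d.
  rewrite -g0; apply: (le_trans (Hd y yd)).
  by rewrite [X in _ <= _ * X + _]even4 lerDl.
have r4 : 0 <= eta * (y - x) ^+ 4.
  by rewrite even4 mulr_ge0 ?exprn_ge0// ltW.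
apply: (@le_trans _ _ (B / d ^+ 6 * (y - x) ^+ 6)); last by rewrite lerDr.
apply: (@le_trans _ _ B); last first.
  rewrite even6 mulrAC -mulrA ler_peMr// ler_pdivlMr ?exprn_gt0// mul1r.
  by rewrite lerXn2r// ?nnegrE// ltW.
have fy : `|f y| <= B1 by rewrite -g0; exact: HB1.
have yx1 : `|y - x| <= 1.
  case/andP: y01 => ? ?; case/andP: x01 => ? ?.
  by rewrite ler_norml; apply/andP; split; lra.
have yxn n : `|y - x| ^+ n <= 1 by rewrite exprn_ile1.
rewrite (le_trans (ler_normB _ _))// lerD//.
have term c n : `|c * (y - x) ^+ n| <= `|c|.
  by rewrite normrM normrX -[leRHS]mulr1 ler_wpM2l.
do 4!rewrite (le_trans (ler_normD _ _))// lerD//.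
by have := term (g 1%N x) 1%N; rewrite expr1.
Qed.

End Taylor.

(** Links the chain of functions in [Ck_on] with the iterated derivatives in [Delta2]; a derivative
    at an interior point depends only on nearby values. *)
Lemma derive1n_chain (R : realType) (f : R -> R) (g : nat -> R -> R) (k : nat) :
  g 0%N = f ->
  (forall i, (i < k)%N -> derivative_on `[0, 1] (g i) (g i.+1)) ->
  forall i, (i <= k)%N -> forall y, 0 < y < 1 -> (f^`(i))%classic y = g i y.
Proof.
move=> g0 dg; elim=> [_ y _|i IH ik y y01]; first by rewrite g0.
rewrite derive1nS derive1E.
have -> : 'D_1 (f^`(i))%classic y = 'D_1 (g i) y.
  apply: near_eq_derive.
  have : \forall z \near y, z \in `]0, 1[ by apply: near_in_itvoo; rewrite in_itv.
  by apply: filterS => z; rewrite in_itv/= => z01; apply: IH => //; exact: ltnW.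
by have [_ ->] := derivative_on_is_derive 0 1 _ _ _ (dg i ik) y01.
Qed.

(** * Averages over grid cells and moments of the smoothing law *)

Section CellAverage.
Context {R : realType}.
Notation mu := (@lebesgue_measure R).
Implicit Types (h : R -> R) (m k : nat).

Definition grid_cell m k : set R := `]k%:R / m%:R, k.+1%:R / m%:R]%classic.

Definition cell_avg h m k : R := m%:R * Rintegral mu (grid_cell m k) h.

Lemma grid_cell_measurable m k : measurable (grid_cell m k).
Proof. exact: measurable_itv. Qed.

Lemma grid_cell_lt m k : (0 < m)%N -> k%:R / m%:R < k.+1%:R / m%:R :> R.
Proof. by move=> m0; rewrite ltr_pM2r ?invr_gt0 ?ltr0n// ltr_nat. Qed.

Lemma grid_cell_measure m k : (0 < m)%N -> mu (grid_cell m k) = (m%:R^-1)%:E.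
Proof.
move=> m0; rewrite lebesgue_measure_itv/= lte_fin grid_cell_lt//.
by rewrite -EFinB -mulrBl -[k.+1%:R]natr1 addrAC subrr add0r mul1r.
Qed.

Lemma grid_cell_sub01 m k y : (k < m)%N -> grid_cell m k y -> 0 <= y <= 1.
Proof.
move=> km; rewrite /grid_cell /= in_itv/= => /andP[y1 y2].
have m0 : 0 < m%:R :> R by rewrite ltr0n (leq_ltn_trans _ km).
apply/andP; split; first by rewrite ltW// (le_lt_trans _ y1)// divr_ge0.
by rewrite (le_trans y2)// ler_pdivrMr// mul1r ler_nat.
Qed.

Lemma grid_cell_integrable h m k (B : R) : (0 < m)%N -> measurable_fun [set: R] h ->
  (forall y, grid_cell m k y -> `|h y| <= B) ->
  mu.-integrable (grid_cell m k) (EFin \o h).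
Proof.
move=> m0 mh hB; apply: measurable_bounded_integrable.
- exact: grid_cell_measurable.
- by rewrite /= grid_cell_measure// ltry.
- exact: measurable_funS mh.
- exists B; split; first exact: num_real.
  by move=> B' BB' y yc; rewrite /= (le_trans (hB y yc))// ltW.
Qed.

Lemma cell_avgD h1 h2 m k : mu.-integrable (grid_cell m k) (EFin \o h1) ->
  mu.-integrable (grid_cell m k) (EFin \o h2) ->
  cell_avg (fun y => h1 y + h2 y) m k = cell_avg h1 m k + cell_avg h2 m k.
Proof.
by move=> i1 i2; rewrite /cell_avg RintegralD ?mulrDr//; exact: grid_cell_measurable.
Qed.

Lemma cell_avgZ c h m k : mu.-integrable (grid_cell m k) (EFin \o h) ->
  cell_avg (fun y => c * h y) m k = c * cell_avg h m k.
Proof.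
move=> i1; rewrite /cell_avg (@RintegralZl _ _ _ mu _ h c)//.
  exact: mulrCA.
exact: grid_cell_measurable.
Qed.

Lemma cell_avg_le h1 h2 m k : (0 < m)%N ->
  mu.-integrable (grid_cell m k) (EFin \o h1) ->
  mu.-integrable (grid_cell m k) (EFin \o h2) ->
  (forall y, grid_cell m k y -> h1 y <= h2 y) ->
  cell_avg h1 m k <= cell_avg h2 m k.
Proof.
move=> m0 i1 i2 h12; rewrite /cell_avg ler_wpM2l//.
by apply: le_Rintegral => //; exact: grid_cell_measurable.
Qed.

Lemma cell_avg_cst c m k : (0 < m)%N -> cell_avg (fun=> c) m k = c.
Proof.
move=> m0; rewrite /cell_avg Rintegral_cst; last exact: grid_cell_measurable.
have := grid_cell_measure m k m0; rewrite /= => -> /=.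
by rewrite mulrCA divff ?mulr1// pnatr_eq0 -lt0n.
Qed.

Lemma cell_avg_near h m k (c e : R) : (0 < m)%N -> measurable_fun [set: R] h ->
  (forall y, grid_cell m k y -> `|h y - c| <= e) -> `|cell_avg h m k - c| <= e.
Proof.
move=> m0 mh hc.
have ih : mu.-integrable (grid_cell m k) (EFin \o h).
  apply: (grid_cell_integrable _ _ _ (`|c| + e)) => // y yc.
  rewrite -[h y](subrK c) addrC (le_trans (ler_normD _ _))// lerD2l; exact: hc.
have ic c' : mu.-integrable (grid_cell m k) (EFin \o (fun=> c' : R)).
  by apply: (grid_cell_integrable _ _ _ `|c'|).
have l1 : c - e <= cell_avg h m k.
  rewrite -[leLHS](cell_avg_cst _ m k)//; apply: cell_avg_le => // y yc.
  by have := hc y yc; rewrite ler_norml => /andP[? ?]; lra.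
have l2 : cell_avg h m k <= c + e.
  rewrite -[leRHS](cell_avg_cst _ m k)//; apply: cell_avg_le => // y yc.
  by have := hc y yc; rewrite ler_norml => /andP[? ?]; lra.
by rewrite ler_norml; apply/andP; split; lra.
Qed.

Lemma pow_integrable (x : R) i m k : (0 < m)%N ->
  mu.-integrable (grid_cell m k) (EFin \o (fun y => (y - x) ^+ i)).
Proof.
move=> m0; pose B := `|k.+1%:R / m%:R| + `|k%:R / m%:R| + `|x|.
apply: (grid_cell_integrable _ _ _ (B ^+ i)) => //.
  by apply: measurable_funX; exact: measurable_funB.
move=> y; rewrite /grid_cell /= in_itv/= => /andP[y1 y2].
rewrite normrX lerXn2r// ?nnegrE// ?addr_ge0// (le_trans (ler_normB _ _))// lerD2r.
have := ler_norm (k.+1%:R / m%:R : R); have := ler_norm (- (k%:R / m%:R) : R).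
rewrite normrN; have := normr_ge0 (k.+1%:R / m%:R : R); have := normr_ge0 (k%:R / m%:R : R).
by move=> *; rewrite ler_norml; apply/andP; split; lra.
Qed.

Lemma cell_avg_pow (x : R) i m k : (0 < m)%N ->
  cell_avg (fun y => (y - x) ^+ i) m k =
  ((k%:R + 1 - m%:R * x) ^+ i.+1 - (k%:R - m%:R * x) ^+ i.+1) / (i.+1%:R * m%:R ^+ i).
Proof.
move=> m0; rewrite /cell_avg /grid_cell.
have m0R : 0 < m%:R :> R by rewrite ltr0n.
have ab := grid_cell_lt m k m0.
pose F y : R := i.+1%:R^-1 * (y - x) ^+ i.+1.
have i0 : i.+1%:R != 0 :> R by rewrite pnatr_eq0.
have dF (y : R) : is_derive y 1 F ((y - x) ^+ i).
  apply: (is_derive_eqr (is_derive_pow_shift x i.+1%:R^-1 y i)).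
  by rewrite mulrA mulVf ?mul1r.
have cF : continuous F.
  by move=> y; apply/differentiable_continuous/derivable1_diffP; have [] := dF y.
have cp : continuous (fun y : R => (y - x) ^+ i).
  move=> y; apply: (@continuous_comp _ _ _ (fun y => y - x) (fun z => z ^+ i)).
    by apply: cvgB; [exact: cvg_id|exact: cvg_cst].
  exact: exprn_continuous.
have := @continuous_FTC2 R (fun y => (y - x) ^+ i) F _ _ ab.
have h1 : {within `[k%:R / m%:R, k.+1%:R / m%:R], continuous (fun y : R => (y - x) ^+ i)}.
  exact: continuous_subspaceT.
have h2 : derivable_oo_LRcontinuous F (k%:R / m%:R) (k.+1%:R / m%:R).
  split; first by move=> y _; have [] := dF y.
  - by apply: cvg_at_right_filter; exact: cF.
  - by apply: cvg_at_left_filter; exact: cF.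
have h3 : {in `]k%:R / m%:R, k.+1%:R / m%:R[, (F^`())%classic =1 (fun y => (y - x) ^+ i)}.
  by move=> y _; rewrite derive1E; have [_ ->] := dF y.
move=> /(_ h1 h2 h3) E.
rewrite Rintegral_itv_obnd_cbnd; last exact: pow_integrable.
rewrite /Rintegral E /= /F -[k.+1%:R]natr1.
have -> : (k%:R + 1) / m%:R - x = (k%:R + 1 - m%:R * x) / m%:R.
  by field; rewrite gt_eqF.
have -> : k%:R / m%:R - x = (k%:R - m%:R * x) / m%:R.
  by field; rewrite gt_eqF.
rewrite !expr_div_n (exprS m%:R).
move: (_ ^+ i.+1) (_ ^+ i.+1) (expf_neq0 i (lt0r_neq0 m0R)) => A B; move: (m%:R ^+ i) => C C0.
by field; rewrite C0 nat1r i0 gt_eqF.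
Qed.

Lemma cell_avg_poly (x : R) (c : nat -> R) n m k : (0 < m)%N ->
  mu.-integrable (grid_cell m k) (EFin \o (fun y => \sum_(i < n) c i * (y - x) ^+ i)) /\
  cell_avg (fun y => \sum_(i < n) c i * (y - x) ^+ i) m k =
  \sum_(i < n) c i * cell_avg (fun y => (y - x) ^+ i) m k.
Proof.
move=> m0; elim: n => [|n [IH1 IH2]].
  have -> : (fun y : R => \sum_(i < 0) c i * (y - x) ^+ i) = (fun=> 0).
    by apply/funext => y; rewrite big_ord0.
  rewrite big_ord0 cell_avg_cst//; split => //.
  by apply: (grid_cell_integrable _ _ _ 0) => // y _; rewrite normr0.
have iZ : mu.-integrable (grid_cell m k) (EFin \o (fun y => c n * (y - x) ^+ n)).
  have : mu.-integrable (grid_cell m k) (fun y => ((c n)%:E * ((y - x) ^+ n)%:E)%E).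
    by apply: integrableZl; [exact: grid_cell_measurable|exact: pow_integrable].
  by apply: eq_integrable; [exact: grid_cell_measurable|].
have -> : (fun y : R => \sum_(i < n.+1) c i * (y - x) ^+ i) =
    (fun y => \sum_(i < n) c i * (y - x) ^+ i + c n * (y - x) ^+ n).
  by apply/funext => y; rewrite big_ord_recr.
split.
  by apply: (integrableD _ IH1 iZ); exact: grid_cell_measurable.
rewrite cell_avgD// IH2 big_ord_recr/=; congr (_ + _).
by rewrite cell_avgZ//; exact: pow_integrable.
Qed.

End CellAverage.

Section Bias.
Context {R : realType}.
Notation mu := (@lebesgue_measure R).
Variable x : R.
Hypothesis x01 : 0 < x < 1.
Local Notation q := (1 - x).
Local Notation s := (x * (1 - x)).

(** Expectation of [h(Y)] for [Y] uniform in a cell whose index is binomial with parameters [m - 1]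
    and [x]. For [h] the density, it is also the expectation of $T_{n,m}(x)$. *)
Definition bern_mean m (h : R -> R) : R := \sum_(k < m) cell_avg h m k * bernstein k m.-1 x.

Lemma bern_meanS n (h : R -> R) : bern_mean n.+1 h = bin_mean x n (cell_avg h n.+1).
Proof. by apply: eq_bigr => k _; rewrite mulrC. Qed.

Lemma bern_mean_pow n i : bern_mean n.+1 (fun y => (y - x) ^+ i) =
  (i.+1%:R * n.+1%:R ^+ i)^-1 *
  bin_mean x n (fun k => (k%:R - n%:R * x + q) ^+ i.+1 - (k%:R - n%:R * x - x) ^+ i.+1).
Proof.
rewrite bern_meanS -bin_meanZ; apply: eq_bin_mean => k.
rewrite cell_avg_pow// mulrC -[n.+1%:R]natr1; congr (_ * (_ ^+ _ - _ ^+ _)); ring.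
Qed.

Lemma bern_mean_pow1 m : (0 < m)%N -> bern_mean m (fun y => (y - x) ^+ 1) =
  (1 - 2 * x) / 2 / m%:R.
Proof.
case: m => // n _; have n0 : n%:R + 1 != 0 :> R by rewrite natr1 pnatr_eq0.
rewrite bern_mean_pow -[n.+1%:R]natr1.
have -> : bin_mean x n (fun k => (k%:R - n%:R * x + q) ^+ 2 - (k%:R - n%:R * x - x) ^+ 2)
  = 2 * bin_moment x 1 n + (1 - 2 * x) * bin_moment x 0 n.
  by rewrite -!bin_meanZ -!bin_meanD; apply: eq_bin_mean => k; ring.
rewrite bin_moment0 bin_moment1 expr1.
by move: (n%:R) n0 => r n0; field; rewrite n0.
Qed.

Lemma bern_mean_pow2 m : (0 < m)%N -> bern_mean m (fun y => (y - x) ^+ 2) =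
  ((m%:R - 1) * s + (1 - 3 * s) / 3) / m%:R ^+ 2.
Proof.
case: m => // n _; have n0 : n%:R + 1 != 0 :> R by rewrite natr1 pnatr_eq0.
rewrite bern_mean_pow -[n.+1%:R]natr1.
have -> : bin_mean x n (fun k => (k%:R - n%:R * x + q) ^+ 3 - (k%:R - n%:R * x - x) ^+ 3)
  = 3 * bin_moment x 2 n + 3 * (1 - 2 * x) * bin_moment x 1 n
    + (1 - 3 * s) * bin_moment x 0 n.
  by rewrite -!bin_meanZ -!bin_meanD; apply: eq_bin_mean => k; ring.
rewrite bin_moment0 bin_moment1 bin_moment2.
by move: (n%:R) n0 => r n0; field; rewrite n0.
Qed.

Let c3 := (q ^+ 4 - x ^+ 4) / 4.
Let c4 := (q ^+ 5 + x ^+ 5) / 5.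

Lemma bern_mean_pow3 m : (0 < m)%N -> bern_mean m (fun y => (y - x) ^+ 3) =
  ((m%:R - 1) * (5 / 2 * s * (1 - 2 * x)) + c3) / m%:R ^+ 3.
Proof.
case: m => // n _; have n0 : n%:R + 1 != 0 :> R by rewrite natr1 pnatr_eq0.
rewrite bern_mean_pow -[n.+1%:R]natr1.
have -> : bin_mean x n (fun k => (k%:R - n%:R * x + q) ^+ 4 - (k%:R - n%:R * x - x) ^+ 4)
  = 4 * bin_moment x 3 n + 6 * (1 - 2 * x) * bin_moment x 2 n
    + 4 * (1 - 3 * s) * bin_moment x 1 n + (q ^+ 4 - x ^+ 4) * bin_moment x 0 n.
  by rewrite -!bin_meanZ -!bin_meanD; apply: eq_bin_mean => k; ring.
rewrite bin_moment0 bin_moment1 bin_moment2 bin_moment3 /c3.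
by move: (n%:R) n0 => r n0; field; rewrite n0.
Qed.

Let A4 := s * (1 - 6 * s) + 2 * (1 - 2 * x) ^+ 2 * s + 2 * (1 - 3 * s) * s.

Lemma bern_mean_pow4 m : (0 < m)%N -> bern_mean m (fun y => (y - x) ^+ 4) =
  (3 * ((m%:R - 1) * s) ^+ 2 + (m%:R - 1) * A4 + c4) / m%:R ^+ 4.
Proof.
case: m => // n _; have n0 : n%:R + 1 != 0 :> R by rewrite natr1 pnatr_eq0.
rewrite bern_mean_pow -[n.+1%:R]natr1.
have -> : bin_mean x n (fun k => (k%:R - n%:R * x + q) ^+ 5 - (k%:R - n%:R * x - x) ^+ 5)
  = 5 * bin_moment x 4 n + 10 * (1 - 2 * x) * bin_moment x 3 n
    + 10 * (1 - 3 * s) * bin_moment x 2 n + 5 * (q ^+ 4 - x ^+ 4) * bin_moment x 1 n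
    + (q ^+ 5 + x ^+ 5) * bin_moment x 0 n.
  by rewrite -!bin_meanZ -!bin_meanD; apply: eq_bin_mean => k; ring.
rewrite bin_moment0 bin_moment1 bin_moment2 bin_moment3 bin_moment4 /c4 /A4.
by move: (n%:R) n0 => r n0; field; rewrite n0.
Qed.

Lemma add1_pow6_le (a : R) : 0 <= a -> (a + 1) ^+ 6 <= 64 * (a ^+ 6 + 1).
Proof.
move=> a0; have p6 : 0 <= a ^+ 6 by exact: exprn_ge0.
have e : 2 ^+ 6 = 64 :> R by ring.
have [a1|/ltW a1] := leP a 1.
  apply: (@le_trans _ _ (2 ^+ 6)); first by apply: lerXn2r; rewrite ?nnegrE; lra.
  by rewrite e; lra.
apply: (@le_trans _ _ ((2 * a) ^+ 6)); first by apply: lerXn2r; rewrite ?nnegrE; lra.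
by rewrite exprMn e; lra.
Qed.

Lemma bern_mean_le m (h1 h2 : R -> R) : (0 < m)%N ->
  (forall k, (k < m)%N -> cell_avg h1 m k <= cell_avg h2 m k) ->
  bern_mean m h1 <= bern_mean m h2.
Proof.
move=> m0 h; apply: ler_sum => k _; rewrite ler_wpM2r//; first exact: bernstein_ge0.
exact: h.
Qed.

(** 3264 is [64 * 50 + 64]: after scaling by [n + 1], the distance to [x] of a point of cell [k] is
    at most [|k - n x| + 1], and the sixth central moment of the binomial law is at most
    [50 n^3]. *)
Lemma bern_mean_pow6_le n : bern_mean n.+1 (fun y => (y - x) ^+ 6) <= 3264 / n.+1%:R ^+ 3.
Proof.
have m0R : 0 < n.+1%:R :> R by rewrite ltr0n.
case/andP: (x01) => x0 x1.
have i0 : 0 <= (n.+1%:R ^+ 6)^-1 :> R by rewrite invr_ge0 exprn_ge0.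
have cb (k : nat) : cell_avg (fun y => (y - x) ^+ 6) n.+1 k <=
    (n.+1%:R ^+ 6)^-1 * (64 * (k%:R - n%:R * x) ^+ 6 + 64).
  rewrite -[leRHS](cell_avg_cst _ n.+1 k)//; apply: cell_avg_le => //.
  - exact: pow_integrable.
  - by apply: (grid_cell_integrable _ _ _ `|(n.+1%:R ^+ 6)^-1 * (64 * (k%:R - n%:R * x) ^+ 6 + 64)|).
  - move=> y; rewrite /grid_cell /= in_itv/= ltr_pdivrMr// ler_pdivlMr// => /andP[y1 y2].
    rewrite ler_pdivlMl ?exprn_gt0// -exprMn.
    have e6 (t : R) : t ^+ 6 = `|t| ^+ 6 by rewrite -normrX ger0_norm// exprn_even_ge0.
    rewrite e6 (e6 (k%:R - _)) -[X in _ <= _ + X]mulr1 -mulrDr.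
    apply: le_trans (add1_pow6_le _ (normr_ge0 _)).
    rewrite lerXn2r// ?nnegrE ?addr_ge0//.
    have -> : n.+1%:R * (y - x) = (k%:R - n%:R * x) + (y * n.+1%:R - k%:R - x).
      by rewrite -[n.+1%:R]natr1; ring.
    rewrite (le_trans (ler_normD _ _))// lerD2l ler_norml.
    by move: y1 y2; rewrite -[k.+1%:R]natr1 => ? ?; apply/andP; split; lra.
have h1 : bern_mean n.+1 (fun y => (y - x) ^+ 6) <=
    bin_mean x n (fun k => (n.+1%:R ^+ 6)^-1 * (64 * (k%:R - n%:R * x) ^+ 6 + 64)).
  rewrite bern_meanS; apply: ler_sum => k _; rewrite ler_wpM2l//; first exact: bernstein_ge0.
apply: (le_trans h1); rewrite bin_meanZ bin_meanD bin_meanZ -/(bin_moment x 6 n).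
have -> : bin_mean x n (fun=> 64) = 64 * bin_moment x 0 n.
  by rewrite -bin_meanZ; apply: eq_bin_mean => k; rewrite expr0 mulr1.
rewrite bin_moment0.
have m6 := bin_moment6_le x n; have {}m6 : bin_moment x 6 n <= 50 * n%:R ^+ 3.
  by apply: m6; rewrite !ltW.
have n3 : n%:R ^+ 3 <= n.+1%:R ^+ 3 :> R by rewrite lerXn2r// ?nnegrE// ler_nat.
have o3 : 1 <= n.+1%:R ^+ 3 :> R by rewrite exprn_ege1// ler1n.
have -> : 3264 / n.+1%:R ^+ 3 = (n.+1%:R ^+ 6)^-1 * (3264 * n.+1%:R ^+ 3) :> R.
  by move: m0R; move: (n.+1%:R) => m m0R; field; rewrite gt_eqF.
rewrite ler_wpM2l//; lra.
Qed.

Lemma quad_cvg (a b c : R) (u : nat -> R) : u n @[n --> \oo] --> (0 : R) ->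
  a + b * u n + c * u n ^+ 2 @[n --> \oo] --> a.
Proof.
move=> u0.
have : a + b * u n + c * u n ^+ 2 @[n --> \oo] --> a + b * 0 + c * 0 ^+ 2.
  have h3 : (fun=> a) n @[n --> \oo] --> a by exact: cvg_cst.
  exact: (cvgnD (cvgnD h3 (cvgnZ b u0)) (cvgnZ c (cvgnX 2 u0))).
by rewrite expr0n !mulr0 !addr0.
Qed.

(* m^2 (2 E[(Y_m - x)^i] - E[(Y_(m/2) - x)^i]) for m = 2h *)
Let ext_pow i h : R := (2 * h)%:R ^+ 2 *
  (2 * bern_mean (2 * h) (fun y => (y - x) ^+ i) - bern_mean h (fun y => (y - x) ^+ i)).

(** The first moment is exactly proportional to [1 / m], and the extrapolation cancels it. *)
Let ext_pow1 h : (0 < h)%N -> ext_pow 1 h = 0.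
Proof.
move=> h0; rewrite /ext_pow !bern_mean_pow1 ?muln_gt0// natrM.
by field; rewrite pnatr_eq0 -lt0n.
Qed.

(** The leading term [s / m] cancels; the [m^-2] term survives with the factor [2 - 4 = - 2]. *)
Let ext_pow2 h : (0 < h)%N -> ext_pow 2 h = 4 * s - 2 / 3.
Proof.
move=> h0; rewrite /ext_pow !bern_mean_pow2 ?muln_gt0// natrM.
by field; rewrite pnatr_eq0 -lt0n.
Qed.

Let ext_pow3_cvg : ext_pow 3 h @[h --> \oo] --> - (5 * s * (1 - 2 * x)).
Proof.
pose E := 5 / 2 * s * (1 - 2 * x).
have -> : - (5 * s * (1 - 2 * x)) = - (2 * E) by rewrite /E; field.
apply: (eqn_cvg _ (@quad_cvg (- (2 * E)) (3 * (E - c3)) 0 _ cvg_harmonic0)).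
exists 1%N => // h /= h0; rewrite /ext_pow !bern_mean_pow3 ?muln_gt0// natrM -/E.
by move: E c3 => E C; field; rewrite pnatr_eq0 -lt0n.
Qed.

Let ext_pow4_cvg : ext_pow 4 h @[h --> \oo] --> - (6 * s ^+ 2).
Proof.
apply: (eqn_cvg _ (@quad_cvg (- (6 * s ^+ 2)) (3 * (6 * s ^+ 2 - A4))
  (- (7 / 2) * (3 * s ^+ 2 - A4 + c4)) _ cvg_harmonic0)).
exists 1%N => // h /= h0; rewrite /ext_pow !bern_mean_pow4 ?muln_gt0// natrM.
by move: A4 c4 => A C; field; rewrite pnatr_eq0 -lt0n.
Qed.

(** The Taylor remainders on the two grids are bounded separately, so they add instead of
    cancelling. *)
Let rem_scale (eta K : R) h : R := (2 * h)%:R ^+ 2 *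
  (2 * (eta * bern_mean (2 * h) (fun y => (y - x) ^+ 4)
        + K * bern_mean (2 * h) (fun y => (y - x) ^+ 6))
   + (eta * bern_mean h (fun y => (y - x) ^+ 4)
        + K * bern_mean h (fun y => (y - x) ^+ 6))).

(** The fourth moments contribute [6 s^2 + 12 s^2] in the limit, while the sixth ones vanish like
    [1 / h] whatever [K] is. Hence a constant [C] that depends neither on [eta] nor on [K]. *)
Let rem_scale_small : exists2 C : R, 0 < C & forall eta K, 0 < eta -> 0 <= K ->
  \forall h \near \oo, rem_scale eta K h <= C * eta.
Proof.
exists (2 + 18 * s ^+ 2); first by rewrite ltr_pwDl// mulr_ge0// sqr_ge0.
move=> eta K eta0 K0.
have H4 : (2 * h)%:R ^+ 2 * (2 * bern_mean (2 * h) (fun y => (y - x) ^+ 4)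
    + bern_mean h (fun y => (y - x) ^+ 4)) @[h --> \oo] --> 18 * s ^+ 2.
  apply: (eqn_cvg _ (@quad_cvg (18 * s ^+ 2) (5 * (A4 - 6 * s ^+ 2))
    (9 / 2 * (3 * s ^+ 2 - A4 + c4)) _ cvg_harmonic0)).
  exists 1%N => // h /= h0; rewrite !bern_mean_pow4 ?muln_gt0// natrM.
  by move: A4 c4 => A C; field; rewrite pnatr_eq0 -lt0n.
have H6 : K * (16320 * (h%:R)^-1) @[h --> \oo] --> K * (16320 * 0).
  exact/cvgnZ/cvgnZ/cvg_harmonic0.
rewrite mulr0 mulr0 in H6.
near=> h.
have h0 : (0 < h)%N by near: h; exists 1%N.
have h0R : 0 < h%:R :> R by rewrite ltr0n.
have b4 : (2 * h)%:R ^+ 2 * (2 * bern_mean (2 * h) (fun y => (y - x) ^+ 4)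
    + bern_mean h (fun y => (y - x) ^+ 4)) <= 18 * s ^+ 2 + 1.
  by near: h; apply: cvgr_le H4 _ _; rewrite ltrDl.
have b6 : K * (16320 * (h%:R)^-1) <= eta by near: h; apply: cvgr_le H6 _ _.
have p6 m : (0 < m)%N -> bern_mean m (fun y => (y - x) ^+ 6) <= 3264 / m%:R ^+ 3.
  by case: m => // n _; exact: bern_mean_pow6_le.
have s6 : (2 * h)%:R ^+ 2 * (2 * bern_mean (2 * h) (fun y => (y - x) ^+ 6)
    + bern_mean h (fun y => (y - x) ^+ 6)) <= 16320 * (h%:R)^-1.
  have := p6 h h0; have := p6 (2 * h)%N; rewrite muln_gt0/= => /(_ h0) q1 q2.
  apply: (@le_trans _ _ ((2 * h)%:R ^+ 2 * (2 * (3264 / (2 * h)%:R ^+ 3) + 3264 / h%:R ^+ 3))).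
    by rewrite ler_wpM2l ?sqr_ge0// lerD// ler_wpM2l.
  by rewrite natrM eqW//; field; rewrite gt_eqF.
have := ler_wpM2l (ltW eta0) b4; have := ler_wpM2l K0 s6.
rewrite /rem_scale; move: b6.
set a1 := bern_mean _ _; set a2 := bern_mean _ _; set a3 := bern_mean _ _; set a4 := bern_mean _ _.
move=> b6 t6 t4.
rewrite (_ : _ * _ = eta * ((2 * h)%:R ^+ 2 * (2 * a3 + a4)) + K * ((2 * h)%:R ^+ 2 * (2 * a1 + a2))); last by ring.
apply: (le_trans (lerD t4 t6)); apply: (le_trans (lerD (lexx _) b6)).
by apply: eqW; ring.
Unshelve. all: by end_near. Qed.

Variables (f : R -> R) (g : nat -> R -> R).
Hypothesis mf : measurable_fun [set: R] f.
Hypothesis g0 : g 0%N = f.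
Hypothesis dg : forall i, (i < 4)%N -> derivative_on `[0, 1] (g i) (g i.+1).

Let taylor_mean m : R := g 0%N x + g 1%N x * bern_mean m (fun y => (y - x) ^+ 1)
  + g 2%N x / 2 * bern_mean m (fun y => (y - x) ^+ 2)
  + g 3%N x / 6 * bern_mean m (fun y => (y - x) ^+ 3)
  + g 4%N x / 24 * bern_mean m (fun y => (y - x) ^+ 4).

Lemma bern_mean_poly (c : nat -> R) n m : (0 < m)%N ->
  bern_mean m (fun y => \sum_(i < n) c i * (y - x) ^+ i) =
  \sum_(i < n) c i * bern_mean m (fun y => (y - x) ^+ i).
Proof.
move=> m0; rewrite /bern_mean.
under eq_bigr do rewrite (cell_avg_poly _ _ _ _ _ m0).2 mulr_suml.
rewrite exchange_big/=; apply: eq_bigr => i _; rewrite mulr_sumr.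
by apply: eq_bigr => k _; exact: esym (mulrA _ _ _).
Qed.

Lemma bern_mean_pow0 m : (0 < m)%N -> bern_mean m (fun y => (y - x) ^+ 0) = 1.
Proof.
case: m => // n _; rewrite bern_mean_pow -bin_meanZ.
transitivity (bin_moment x 0 n); last exact: bin_moment0.
by apply: eq_bin_mean => k; rewrite !expr1 !expr0 !mulr1 invr1; ring.
Qed.

Let bern_mean_taylor eta K m : (0 < m)%N -> 0 < eta -> 0 <= K ->
  (forall y, 0 <= y <= 1 ->
    `|f y - (g 0%N x + g 1%N x * (y - x) + g 2%N x / 2 * (y - x) ^+ 2
       + g 3%N x / 6 * (y - x) ^+ 3 + g 4%N x / 24 * (y - x) ^+ 4)|
    <= eta * (y - x) ^+ 4 + K * (y - x) ^+ 6) ->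
  `|bern_mean m f - taylor_mean m| <=
    eta * bern_mean m (fun y => (y - x) ^+ 4) + K * bern_mean m (fun y => (y - x) ^+ 6).
Proof.
move=> m0 eta0 K0 H.
have p0 := bern_mean_pow0 m m0.
(* The pointwise bound places [f] between two polynomials of degree six in [y - x], with these
   coefficients; their means are combinations of the moments. *)
pose cu i := nth 0 [:: g 0%N x; g 1%N x; g 2%N x / 2; g 3%N x / 6; g 4%N x / 24 + eta; 0; K] i.
pose cl i := nth 0 [:: g 0%N x; g 1%N x; g 2%N x / 2; g 3%N x / 6; g 4%N x / 24 - eta; 0; - K] i.
have [B HB] : exists B, forall k y, (k < m)%N -> grid_cell m k y -> `|f y| <= B.
  pose S : R := `|g 0%N x| + `|g 1%N x| + `|g 2%N x / 2| + `|g 3%N x / 6| + `|g 4%N x / 24|.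
  exists (eta + K + S) => k y km yc.
  have y01 := grid_cell_sub01 _ _ _ km yc.
  have yx1 : `|y - x| <= 1.
    case/andP: y01 => ? ?; case/andP: x01 => ? ?.
    by rewrite ler_norml; apply/andP; split; lra.
  have term c n : `|c * (y - x) ^+ n| <= `|c|.
    by rewrite normrM normrX -[leRHS]mulr1 ler_wpM2l// exprn_ile1.
  have hy := H y y01.
  have := ler_norm (eta * (y - x) ^+ 4); have := ler_norm (K * (y - x) ^+ 6).
  have := term eta 4%N; have := term K 6%N; rewrite (gtr0_norm eta0) (ger0_norm K0).
  move=> t1 t2 t3 t4; move: hy; set T := (_ + _ * (y - x) ^+ 4) => hy.
  have hT : `|T| <= S.
    rewrite /T /S.
    do 4!rewrite (le_trans (ler_normD _ _))// lerD//.
    by have := term (g 1%N x) 1%N; rewrite expr1.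
  rewrite -[f y](subrK T) (le_trans (ler_normD _ _))// lerD//; lra.
have fi k : (k < m)%N -> mu.-integrable (grid_cell m k) (EFin \o f).
  by move=> km; apply: (grid_cell_integrable _ _ _ B) => // y; exact: HB.
have up : bern_mean m f <= \sum_(i < 7) cu i * bern_mean m (fun y => (y - x) ^+ i).
  rewrite -bern_mean_poly//; apply: bern_mean_le => // k km.
  apply: cell_avg_le => //; [exact: fi|exact: (cell_avg_poly _ _ _ _ _ m0).1|].
  move=> y yc; have := H y (grid_cell_sub01 _ _ _ km yc).
  rewrite ler_norml => /andP[_]; rewrite !big_ord_recr big_ord0 /= /cu /=.
  rewrite expr0 expr1; lra.
have lo : \sum_(i < 7) cl i * bern_mean m (fun y => (y - x) ^+ i) <= bern_mean m f.
  rewrite -bern_mean_poly//; apply: bern_mean_le => // k km.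
  apply: cell_avg_le => //; [exact: (cell_avg_poly _ _ _ _ _ m0).1|exact: fi|].
  move=> y yc; have := H y (grid_cell_sub01 _ _ _ km yc).
  rewrite ler_norml => /andP[+ _]; rewrite !big_ord_recr big_ord0 /= /cl /=.
  rewrite expr0 expr1; lra.
move: up lo; rewrite !big_ord_recr !big_ord0 /= /cu /cl /= p0 /taylor_mean.
move: (bern_mean m (fun y => (y - x) ^+ 1)) (bern_mean m (fun y => (y - x) ^+ 2))
  (bern_mean m (fun y => (y - x) ^+ 3)) (bern_mean m (fun y => (y - x) ^+ 4))
  (bern_mean m (fun y => (y - x) ^+ 6)) => b1 b2 b3 b4 b6.
by move=> u l; rewrite ler_norml; apply/andP; split; lra.
Qed.

(** The Taylor polynomial carries the limit. For the remainder, [eta] is [e / C] with [C] from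
    [rem_scale_small]; that [K] depends on [e] is harmless as the sixth moments vanish. *)
Lemma bias_cvg : (2 * h)%:R ^+ 2 * (2 * bern_mean (2 * h) f - bern_mean h f - f x)
  @[h --> \oo] --> - (2 * Delta2 f x).
Proof.
have main : (2 * h)%:R ^+ 2 * (2 * taylor_mean (2 * h) - taylor_mean h - f x)
    @[h --> \oo] --> - (2 * Delta2 f x).
  have dE i : (i <= 4)%N -> (f^`(i))%classic x = g i x.
    by move=> i4; apply: (derive1n_chain R f g 4).
  have L := cvgnD (cvgnZ (g 3%N x / 6) ext_pow3_cvg) (cvgnZ (g 4%N x / 24) ext_pow4_cvg).
  have L2 : g 2%N x / 2 * (4 * s - 2 / 3) + (g 3%N x / 6 * ext_pow 3 h + g 4%N x / 24 * ext_pow 4 h)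
      @[h --> \oo] --> - (2 * Delta2 f x).
    have -> : - (2 * Delta2 f x) = g 2%N x / 2 * (4 * s - 2 / 3) +
        (g 3%N x / 6 * - (5 * s * (1 - 2 * x)) + g 4%N x / 24 * - (6 * s ^+ 2)).
      by rewrite /Delta2 !dE//; field.
    have h3 : (fun=> g 2%N x / 2 * (4 * s - 2 / 3)) n @[n --> \oo] --> g 2%N x / 2 * (4 * s - 2 / 3) by exact: cvg_cst.
    exact: (cvgnD h3 L).
  apply: (eqn_cvg _ L2); exists 1%N => // h /= h0.
  rewrite -(ext_pow2 h h0) -[LHS]add0r -[X in X + _](mulr0 (g 1%N x)) -(ext_pow1 h h0).
  rewrite /ext_pow /taylor_mean g0; ring.
have rem0 : (2 * h)%:R ^+ 2 * (2 * (bern_mean (2 * h) f - taylor_mean (2 * h))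
    - (bern_mean h f - taylor_mean h)) @[h --> \oo] --> (0 : R).
  have [C C0 HC] := rem_scale_small.
  apply/cvgrPdist_le => e e0.
  have eta0 : 0 < e / C by rewrite divr_gt0.
  have [K K0 HK] := taylor4_global f g x (e / C) g0 dg x01 eta0.
  near=> h.
  have h0 : (0 < h)%N by near: h; exists 1%N.
  have r : rem_scale (e / C) K h <= C * (e / C) by near: h; exact: HC.
  rewrite mulrCA divff ?mulr1 ?lt0r_neq0// in r.
  rewrite sub0r normrN; apply: (le_trans _ r).
  have b1 := bern_mean_taylor _ _ _ h0 eta0 K0 HK.
  have b2 := bern_mean_taylor (e / C) K (2 * h)%N _ eta0 K0 HK.
  rewrite muln_gt0/= in b2; have {}b2 := b2 h0.
  rewrite normrM ger0_norm ?sqr_ge0// /rem_scale ler_wpM2l ?sqr_ge0//.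
  rewrite (le_trans (ler_normB _ _))// lerD// normrM ger0_norm// ler_wpM2l//.
have H := cvgnD main rem0; rewrite addr0 in H; apply: (eqn_cvg _ H).
by apply: nearW => h /=; ring.
Unshelve. all: by end_near. Qed.

End Bias.

(** * The corrected kernel and the density on the fine grid *)

Section KernelCells.
Context {R : realType}.
Notation mu := (@lebesgue_measure R).
Variable x : R.
Hypothesis x01 : 0 < x < 1.

Lemma sum_double (V : nmodType) (F : nat -> V) h :
  \sum_(k < 2 * h) F k = \sum_(j < h) (F (2 * j)%N + F (2 * j).+1).
Proof.
elim: h => [|h IH]; first by rewrite !big_ord0.
by rewrite mulnS !addSn add0n !big_ord_recr/= IH addrA.
Qed.

Lemma grid_cell_double h j : (0 < h)%N ->
  grid_cell h j = grid_cell (2 * h) (2 * j) `|` grid_cell (2 * h) (2 * j).+1 :> set R.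
Proof.
move=> h0; have h0R : 0 < h%:R :> R by rewrite ltr0n.
have e1 : (2 * j)%:R / (2 * h)%:R = j%:R / h%:R :> R.
  by rewrite !natrM; field; rewrite gt_eqF.
have e2 : (2 * j).+2%:R / (2 * h)%:R = j.+1%:R / h%:R :> R.
  rewrite -[(2 * j).+2%:R]natr1 -[(2 * j).+1%:R]natr1 -[j.+1%:R]natr1 !natrM.
  by field; rewrite gt_eqF.
have l1 := @grid_cell_lt R (2 * h) (2 * j); have l2 := @grid_cell_lt R (2 * h) (2 * j).+1.
rewrite muln_gt0/= in l1 l2; have {}l1 := l1 h0; have {}l2 := l2 h0.
rewrite /grid_cell -e1 -e2; apply/seteqP; split=> y /=; rewrite !in_itv/=.
  move=> /andP[y1 y2].
  by have [yy|yy] := leP y ((2 * j).+1%:R / (2 * h)%:R); [left|right]; apply/andP.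
by move=> [|] /andP[y1 y2]; apply/andP; split=> //;
  [rewrite (le_trans y2)// ltW|rewrite (lt_trans l1)].
Qed.

Lemma grid_cell_disj m k k' : (0 < m)%N -> (k < k')%N ->
  grid_cell m k `&` grid_cell m k' = set0 :> set R.
Proof.
move=> m0 kk'; rewrite /grid_cell; apply/seteqP; split => // y [] /=; rewrite !in_itv/= => /andP[_ y1] /andP[y2 _].
have : k'%:R / m%:R < k.+1%:R / m%:R :> R by exact: lt_le_trans y2 y1.
by rewrite ltr_pM2r ?invr_gt0 ?ltr0n// ltr_nat ltnS leqNgt kk'.
Qed.

Lemma indic_cell_double h j (y : R) : (0 < h)%N ->
  \1_(grid_cell h j) y = \1_(grid_cell (2 * h) (2 * j)) y
     + \1_(grid_cell (2 * h) (2 * j).+1) y :> R.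
Proof.
move=> h0; rewrite grid_cell_double// !indicE in_setU.
have := grid_cell_disj (2 * h) (2 * j) (2 * j).+1; rewrite muln_gt0/= => /(_ h0 (ltnSn _)) d.
case: (boolP (y \in grid_cell (2 * h) (2 * j))) => c1;
  case: (boolP (y \in grid_cell (2 * h) (2 * j).+1)) => c2; rewrite /= ?addr0 ?add0r//.
by exfalso; move: c1 c2; rewrite !inE => c1 c2; rewrite -[False]/(set0 y) -d.
Qed.

(** Each cell of mesh [1 / h] is the disjoint union of the cells [2 j] and [2 j + 1] of mesh
    [1 / (2 h)], and both indices halve to [j]. *)
Lemma corrected_kernelE h y : (0 < h)%N ->
  corrected_kernel (2 * h) x y =
  \sum_(k < 2 * h) kernel_value x (2 * h) k * \1_(grid_cell (2 * h) k) y.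
Proof.
move=> h0; rewrite /corrected_kernel /bernstein_kernel /kernel_value.
have -> : (2 * h)./2 = h by rewrite mul2n doubleK.
under [RHS]eq_bigr do rewrite mulrBl.
rewrite sumrB; congr (_ - _).
  rewrite mulrA mulr_sumr; apply: eq_bigr => k _.
  by rewrite -[\1_ _ y]/(\1_(grid_cell (2 * h) k) y); ring.
rewrite (sum_double _ (fun k => h%:R * bernstein k./2 h.-1 x * \1_(grid_cell (2 * h) k) y)).
rewrite mulr_sumr; apply: eq_bigr => j _.
rewrite -[\1_ _ y]/(\1_(grid_cell h j) y) indic_cell_double//.
have -> : (2 * j)./2 = j by rewrite mul2n doubleK.
have -> : (2 * j).+1./2 = j by rewrite mul2n -[_.+1]/(true + _)%N half_bit_double.
ring.
Qed.

Variables (f : R -> R) (g : nat -> R -> R).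
Hypothesis mf : measurable_fun [set: R] f.
Hypothesis g0 : g 0%N = f.
Hypothesis dg : forall i, (i < 4)%N -> derivative_on `[0, 1] (g i) (g i.+1).

Lemma density_bounded : exists2 B : R, 0 <= B & forall y, 0 <= y <= 1 -> `|f y| <= B.
Proof.
by have := derivative_on_bounded 0 1 _ _ ler01 (dg 0%N isT); rewrite g0.
Qed.

Lemma density_cell_integrable m k : (k < m)%N -> mu.-integrable (grid_cell m k) (EFin \o f).
Proof.
move=> km; have [B _ HB] := density_bounded.
apply: (grid_cell_integrable _ _ _ B) => //; first exact: leq_ltn_trans km.
by move=> y /(grid_cell_sub01 _ _ _ km); exact: HB.
Qed.

Lemma density_cell_avg_bounded : exists B : R, forall m k, (k < m)%N -> `|cell_avg f m k| <= B.
Proof.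
have [B B0 HB] := density_bounded; exists B => m k km.
rewrite -[X in `|X|]subr0; apply: cell_avg_near => //; first exact: leq_ltn_trans km.
by move=> y yc; rewrite subr0 HB//; exact: grid_cell_sub01 yc.
Qed.

(** The cell lies at a distance of order [1 / sqrt m] from [x], where [f] is continuous. *)
Lemma density_cell_avg_cvg (v : R) (k : nat -> nat) :
  ((k m)%:R - m%:R * x) / Num.sqrt m%:R @[m --> \oo] --> v ->
  cell_avg f m (k m) @[m --> \oo] --> f x.
Proof.
move=> kv.
have cf : {for x, continuous f}.
  rewrite -g0; apply/differentiable_continuous/derivable1_diffP.
  by have [] := derivative_on_is_derive 0 1 _ _ _ (dg 0%N isT) x01.
apply/cvgrPdist_le => e e0.
move: cf => /cvgrPdist_le/(_ _ e0)/nbhs_ballP[d /= d0 Hd].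
have i0 := @sqrt_nat_inv_cvg0 R.
have H : ((k m)%:R - m%:R * x) / Num.sqrt m%:R * (Num.sqrt m%:R)^-1 @[m --> \oo] --> v * 0.
  exact: (cvgnM kv i0).
rewrite mulr0 in H.
have h1 := @cvg_harmonic0 R.
near=> m.
have m0 : (0 < m)%N by near: m; exists 1%N.
have m0R : 0 < m%:R :> R by rewrite ltr0n.
have b1 : `|((k m)%:R - m%:R * x) / m%:R| < d / 2.
  have -> : ((k m)%:R - m%:R * x) / m%:R =
      ((k m)%:R - m%:R * x) / Num.sqrt m%:R * (Num.sqrt m%:R)^-1.
    by rewrite -mulrA -invfM -expr2 sqr_sqrtr.
  near: m; have d2 : 0 < d / 2 by rewrite divr_gt0.
  by move/cvgrPdist_lt : H => /(_ _ d2); apply: filterS => m; rewrite sub0r normrN.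
have b2 : (m%:R)^-1 < d / 2 :> R by near: m; apply: cvgr_lt h1 _ _; rewrite divr_gt0.
rewrite distrC; apply: cell_avg_near => // y.
rewrite /grid_cell /= in_itv/= => /andP[y1 y2].
rewrite distrC; apply: Hd; rewrite /ball /= distrC.
have e1 : (k m).+1%:R / m%:R = (k m)%:R / m%:R + (m%:R)^-1 :> R.
  by rewrite -[_.+1%:R]natr1 mulrDl mul1r.
have e2 : ((k m)%:R - m%:R * x) / m%:R = (k m)%:R / m%:R - x.
  by field; rewrite gt_eqF.
move: b1; rewrite e2 !ltr_norml => /andP[? ?]; rewrite e1 in y2.
have : 0 < (m%:R)^-1 :> R by rewrite invr_gt0.
by move=> ?; apply/andP; split; lra.
Unshelve. all: by end_near. Qed.

Definition cell_prob m k : R := Rintegral mu (grid_cell m k) f.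

(** Expectation of $Z_n(x)$ when the order [m] is even. *)
Definition kernel_mean m : R := \sum_(k < m) cell_prob m k * kernel_value x m k.

Definition kernel_second_moment m : R := \sum_(k < m) cell_prob m k * kernel_value x m k ^+ 2.

Lemma kernel_meanE h : (0 < h)%N ->
  kernel_mean (2 * h) = 2 * bern_mean x (2 * h) f - bern_mean x h f.
Proof.
move=> h0; rewrite /kernel_mean /kernel_value /bern_mean /cell_avg.
have -> : (2 * h)./2 = h by rewrite mul2n doubleK.
under eq_bigr do rewrite mulrBr.
rewrite sumrB mulr_sumr; congr (_ - _).
  by apply: eq_bigr => k _; rewrite /cell_prob; ring.
rewrite (sum_double _ (fun k => cell_prob (2 * h) k * (h%:R * bernstein k./2 h.-1 x))).
apply: eq_bigr => j _.
have -> : (2 * j)./2 = j by rewrite mul2n doubleK.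
have -> : (2 * j).+1./2 = j by rewrite mul2n -[_.+1]/(true + _)%N half_bit_double.
have -> : Rintegral mu (grid_cell h j) f =
    cell_prob (2 * h) (2 * j) + cell_prob (2 * h) (2 * j).+1.
  rewrite grid_cell_double// /cell_prob Rintegral_setU//.
  - exact: grid_cell_measurable.
  - exact: grid_cell_measurable.
  - by rewrite -grid_cell_double//; exact: density_cell_integrable.
  - apply/disj_setPS; rewrite grid_cell_disj//; last by rewrite muln_gt0.
ring.
Qed.

Lemma kernel_bias_cvg : (2 * h)%:R ^+ 2 * (kernel_mean (2 * h) - f x) @[h --> \oo]
  --> - (2 * Delta2 f x).
Proof.
apply: (eqn_cvg _ (bias_cvg x x01 f g mf g0 dg)); exists 1%N => // h /= h0.
by rewrite kernel_meanE.
Qed.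

Lemma kernel_second_moment_cvg :
  (Num.sqrt m%:R)^-1 * kernel_second_moment m @[m --> \oo] --> C3 * f x * psi x.
Proof.
have [B HB] := density_cell_avg_bounded.
apply: (second_moment_cvg x x01 cell_prob B (f x)) => [m k km|v k kv].
  exact: HB.
exact: density_cell_avg_cvg kv.
Qed.

End KernelCells.

(** * The law of the estimator as an iterated finite sum *)

Section Pieces.
Context {R : realType}.
Implicit Types (m k : nat).

(* the cells of the partition of ]0, 1] into m intervals, then, for k >= m,
   everything else *)
Definition piece m k : set R :=
  if (k < m)%N then grid_cell m k else ~` \big[setU/set0]_(j < m) grid_cell m j.

Lemma piece_measurable m k : measurable (piece m k).
Proof.
rewrite /piece; case: ifP => _; first exact: grid_cell_measurable.
by apply: measurableC; apply: bigsetU_measurable => j _; exact: grid_cell_measurable.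
Qed.

Lemma piece_disj m k k' : (0 < m)%N -> (k < k')%N -> (k' <= m)%N ->
  piece m k `&` piece m k' = set0.
Proof.
move=> m0 kk' k'm; have km : (k < m)%N by exact: leq_trans k'm.
rewrite /piece km; case: ifP => [_|k'm']; first exact: grid_cell_disj.
apply/seteqP; split => // y [yk]; apply.
by rewrite -bigcup_mkord; exists k.
Qed.

Lemma piece_cover m y : exists2 k, (k <= m)%N & piece m k y.
Proof.
have [h|h] := pselect ((\big[setU/set0]_(j < m) grid_cell m j) y).
  move: (h); rewrite -bigcup_mkord => -[k /= km ky]; exists k; first exact: ltnW.
  by rewrite /piece km.
by exists m; rewrite // /piece ltnn.
Qed.

Lemma measure_pieces d (T : measurableType d) (P : probability T R) m (D : set T)
    (Y : {RV P >-> R}) : (0 < m)%N -> measurable D ->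
  P D = (\sum_(k < m.+1) P (D `&` Y @^-1` piece m k))%E.
Proof.
move=> m0 mD.
have mF k : measurable (D `&` Y @^-1` piece m k).
  by apply: measurableI => //; apply: (measurable_funPTI Y); exact: piece_measurable.
rewrite -(@measure_semi_additive_ord_I _ _ _ P (fun k => D `&` Y @^-1` piece m k)) //=.
- congr (P _); rewrite -(bigcup_mkord _ (fun k => D `&` Y @^-1` piece m k)); apply/seteqP; split => w.
    by move=> Dw; have [k km ky] := piece_cover m (Y w); exists k.
  by move=> [k _ [Dw _]].
- move=> i j /= im jm [w [[_ wi] [_ wj]]].
  have [ij|ji|//] := ltngtP i j.
    have := piece_disj m i j m0 ij jm; rewrite -subset0 => /(_ (Y w)); by case.
  have := piece_disj m j i m0 ji im; rewrite -subset0 => /(_ (Y w)); by case.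
- by apply: bigsetU_measurable => k _; exact: mF.
Qed.

End Pieces.

Section MarkovOperator.
Context {R : realType}.
Variables (x : R) (f : R -> R) (gam : nat -> R) (N : nat -> nat).

(** The last piece receives the remaining mass, so the weights sum to 1 by construction; the kernel
    takes the value 0 there. *)
Definition piece_prob m k : R :=
  if (k < m)%N then cell_prob f m k else 1 - \sum_(j < m) cell_prob f m j.

Definition piece_value m k : R := if (k < m)%N then kernel_value x m k else 0.

(* [est_law n G] is the expectation of [G (f_n(x))]; the observations entering
   [f_n(x)] only through the grid cells that they hit, it is a finite sum. *)
Fixpoint est_law n (G : R -> R) : R :=
  if n is n'.+1 then
    est_law n' (fun t => \sum_(k < (N n).+1) piece_prob (N n) k *
      G ((1 - gam n) * t + gam n * piece_value (N n) k))
  else G 0.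

Lemma eq_est_law n G1 G2 : (forall t, G1 t = G2 t) -> est_law n G1 = est_law n G2.
Proof. by move=> /funext ->. Qed.

Lemma est_lawD n G1 G2 :
  est_law n (fun t => G1 t + G2 t) = est_law n G1 + est_law n G2.
Proof.
elim: n G1 G2 => //= n IH G1 G2; rewrite -IH; apply: eq_est_law => t.
by rewrite -big_split; apply: eq_bigr => k _; rewrite mulrDr.
Qed.

Lemma est_lawZ n c G : est_law n (fun t => c * G t) = c * est_law n G.
Proof.
elim: n G => //= n IH G; rewrite -IH; apply: eq_est_law => t.
by rewrite mulr_sumr; apply: eq_bigr => k _; rewrite mulrCA.
Qed.

Lemma est_law_sum n K (p : nat -> R) (G : nat -> R -> R) :
  est_law n (fun t => \sum_(k < K) p k * G k t) = \sum_(k < K) p k * est_law n (G k).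
Proof.
elim: K => [|K IH].
  rewrite big_ord0 -[RHS](mul0r (est_law n (fun=> 0))) -est_lawZ.
  by apply: eq_est_law => t; rewrite big_ord0 mulr0.
rewrite big_ord_recr/= -IH -est_lawZ -est_lawD; apply: eq_est_law => t.
by rewrite big_ord_recr.
Qed.

Lemma sum_piece_prob m (F : nat -> R) : \sum_(k < m.+1) piece_prob m k * F k =
  \sum_(k < m) cell_prob f m k * F k + (1 - \sum_(j < m) cell_prob f m j) * F m.
Proof.
rewrite big_ord_recr/= /piece_prob ltnn; congr (_ + _).
by apply: eq_bigr => k _; rewrite ltn_ord.
Qed.

Lemma sum_piece_prob1 m : \sum_(k < m.+1) piece_prob m k = 1.
Proof.
rewrite -[RHS](subrK (\sum_(j < m) cell_prob f m j)) addrC.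
under eq_bigr do rewrite -[piece_prob _ _]mulr1.
rewrite (sum_piece_prob m (fun=> 1)) mulr1; congr (_ + _).
by apply: eq_bigr => k _; rewrite mulr1.
Qed.

Section Identification.
Context d (T : measurableType d) (P : probability T R).
Variable X : nat -> {RV P >-> R}.
Hypothesis indX : mutually_independent [set n | (0 < n)%N] X.
Hypothesis densX : forall n, (0 < n)%N -> has_density (X n) f.
Hypothesis evenN : forall n, (0 < n)%N -> (0 < N n)%N /\ ~~ odd (N n).
Hypothesis fint : forall m k, (k < m)%N ->
  (@lebesgue_measure R).-integrable (grid_cell m k) (EFin \o f).

Local Notation est := (recursive_estimator gam N X x).

Lemma prob_piece n m k : (0 < n)%N -> (0 < m)%N -> (k <= m)%N ->
  P (X n @^-1` piece m k) = (piece_prob m k)%:E.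
Proof.
move=> n0 m0 km.
have [_ _ dX] := densX n n0.
have cp j : (j < m)%N -> P (X n @^-1` grid_cell m j) = (cell_prob f m j)%:E.
  move=> jm; have := dX _ (grid_cell_measurable m j); rewrite /distribution/= /pushforward => ->.
  by rewrite /cell_prob /Rintegral fineK//; apply: integrable_fin_num; [exact: grid_cell_measurable|exact: fint].
rewrite /piece_prob; case: ifP => km'; first by rewrite /piece km' cp.
have := measure_pieces _ _ P m setT (X n) m0 measurableT.
rewrite probability_setT big_ord_recr/=.
under eq_bigr => j _ do rewrite setTI /piece ltn_ord cp//.
rewrite sumEFin setTI.
have -> : k = m by apply/eqP; rewrite eqn_leq km leqNgt km'.
have [r ->] : exists r : R, P (X n @^-1` piece m m) = r%:E.
  exists (fine (P (X n @^-1` piece m m))); rewrite fineK//.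
  by apply: fin_num_measure; apply: (measurable_funPTI (X n)); exact: piece_measurable.
by rewrite -EFinD => -[->]; rewrite addrAC subrr add0r.
Qed.

Lemma est_step n k w : (0 < N n.+1)%N -> ~~ odd (N n.+1) -> (k <= N n.+1)%N ->
  piece (N n.+1) k (X n.+1 w) ->
  est n.+1 w = (1 - gam n.+1) * est n w + gam n.+1 * piece_value (N n.+1) k.
Proof.
move=> N0 Nev kN wk /=; congr (_ + _ * _).
set m := N n.+1 in N0 Nev kN wk *.
have mE : m = (2 * m./2)%N by rewrite mul2n even_halfK.
have h0 : (0 < m./2)%N by move: N0; rewrite {1}mE muln_gt0.
rewrite {1}mE corrected_kernelE// -mE /piece_value.
case: ifP => [km|km].
  rewrite (bigD1 (Ordinal km))//= big1 ?addr0.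
    by rewrite indicE mem_set ?mulr1//; move: wk; rewrite /piece km.
  move=> j jk; rewrite indicE memNset ?mulr0// => wj.
  move: wk; rewrite /piece km => wk.
  have [ij|ji|e] := ltngtP k j.
  - by have := @grid_cell_disj R m k j N0 ij; rewrite -subset0 => /(_ (X n.+1 w)); case.
  - by have := @grid_cell_disj R m j k N0 ji; rewrite -subset0 => /(_ (X n.+1 w)); case.
  - by move/eqP: jk; apply; apply/val_inj.
rewrite big1// => j _; rewrite indicE memNset ?mulr0// => wj.
by move: wk; rewrite /piece km; apply; rewrite -bigcup_mkord; exists j => /=.
Qed.

Lemma est_preimage_measurable n C : measurable C -> measurable (est n @^-1` C).
Proof.
move=> mC; rewrite -[X in measurable X]setTI.
exact: (measurable_recursive_estimator gam N X x n measurableT mC).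
Qed.

Lemma preimages_measurable (J : seq nat) (A : nat -> set R) :
  (forall i, measurable (A i)) -> measurable (\bigcap_(i in [set` J]) X i @^-1` A i).
Proof.
move=> mA; apply: fin_bigcap_measurable; first exact: finite_seq.
by move=> i _; exact: (measurable_funPTI (X i)).
Qed.

(** Splitting by the cell of [X n.+1] turns an event on step [n.+1] into an event on step [n] joined
    with one on [X n.+1]. The induction therefore carries events on later observations, and
    independence is invoked only for the [X i], never for the estimator. *)
Lemma est_law_joint n C (J : seq nat) (A : nat -> set R) :
  measurable C -> uniq J -> (forall i, i \in J -> (n < i)%N) ->
  (forall i, measurable (A i)) ->
  P (est n @^-1` C `&` \bigcap_(i in [set` J]) X i @^-1` A i) =
  ((est_law n \1_C)%:E * P (\bigcap_(i in [set` J]) X i @^-1` A i))%E.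
Proof.
elim: n C J A => [|n IH] C J A mC uJ Jn mA.
  rewrite /= indicE; have [C0|C0] := boolP (0 \in C).
    rewrite mul1e; congr (P _); rewrite -[RHS]setTI; congr (_ `&` _).
    by apply/seteqP; split => // w _ /=; rewrite inE in C0.
  rewrite mul0e (_ : _ @^-1` C = set0) ?set0I ?measure0//.
  by apply/seteqP; split => // w /= Cw; move: C0; rewrite notin_setE.
have [N0 Nev] := evenN n.+1 isT; set m := N n.+1 in N0 Nev.
set E := \bigcap_(i in _) _.
have mE : measurable E by exact: preimages_measurable.
rewrite (measure_pieces _ _ P m _ (X n.+1) N0); last first.
  by apply: measurableI => //; exact: est_preimage_measurable.
pose Ck k := [set t | C ((1 - gam n.+1) * t + gam n.+1 * piece_value m k)].
have mCk k : measurable (Ck k).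
  have mh : measurable_fun [set: R] (fun t => (1 - gam n.+1) * t + gam n.+1 * piece_value m k).
    by apply: measurable_funD => //; exact: measurable_funM.
  by have := mh measurableT _ mC; rewrite setTI.
(* [A] is indexed by all integers; its entry at [n.+1], an index outside [J], is overwritten by the
   cell. *)
pose A' k i := if i == n.+1 then piece m k else A i.
have mA' k i : measurable (A' k i) by rewrite /A'; case: ifP => // _; exact: piece_measurable.
have nJ : n.+1 \notin J by apply/negP => /Jn; rewrite ltnn.
have EA' k : \bigcap_(i in [set` n.+1 :: J]) X i @^-1` A' k i = X n.+1 @^-1` piece m k `&` E.
  apply/seteqP; split => w.
    move=> H; split; first by have := H n.+1; rewrite /A' eqxx; apply; rewrite /= mem_head.
    move=> i iJ; have := H i; rewrite /A'; case: eqP => [iE|_]; last first.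
      by apply; rewrite /= in_cons (_ : i \in J) ?orbT.
    by move: iJ nJ => /=; rewrite iE => ->.
  move=> [wk wE] i /=; rewrite in_cons /A' => /orP[/eqP ->|iJ]; first by rewrite eqxx.
  by case: eqP => [->//|_]; exact: wE.
have PA' k : (k <= m)%N ->
    P (X n.+1 @^-1` piece m k `&` E) = ((piece_prob m k)%:E * P E)%E.
  move=> km; rewrite -EA' indX//=.
  - rewrite big_cons /A' eqxx prob_piece//; congr (_ * _)%E.
    rewrite indX//; last by move=> i /= /Jn; exact: leq_trans.
    by apply: eq_big_seq => i iJ; case: eqP => // iE; move: nJ; rewrite -iE iJ.
  - by rewrite nJ.
  - by move=> i /=; rewrite in_cons => /orP[/eqP ->//|/Jn]; exact: leq_trans.
have term (k : 'I_m.+1) : P (est n.+1 @^-1` C `&` E `&` X n.+1 @^-1` piece m k) =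
    ((piece_prob m k * est_law n \1_(Ck k))%:E * P E)%E.
  have km : (k <= m)%N by rewrite -ltnS.
  have -> : est n.+1 @^-1` C `&` E `&` X n.+1 @^-1` piece m k =
      est n @^-1` Ck k `&` \bigcap_(i in [set` n.+1 :: J]) X i @^-1` A' k i.
    rewrite EA'; apply/seteqP; split => w.
      by move=> [[Cw Ew] kw]; split => //; rewrite /Ck /= -(est_step n k w).
    move=> [Cw [kw Ew]]; split; [split; [|exact: Ew]|exact: kw].
    by change (C (est n.+1 w)); rewrite (est_step n k w).
  rewrite (IH (Ck k) (n.+1 :: J) (A' k))//=; last 2 first.
    by rewrite nJ.
    by move=> i; rewrite in_cons => /orP[/eqP ->//|/Jn]; exact: ltnW.
  by rewrite EA' PA'// muleA -EFinM (mulrC (est_law _ _)).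
rewrite (eq_bigr _ (fun k _ => term k)).
have [r ->] : exists r : R, P E = r%:E.
  by exists (fine (P E)); rewrite fineK//; exact: fin_num_measure.
under eq_bigr do rewrite -EFinM.
rewrite sumEFin -EFinM -mulr_suml /=; congr (_ * _)%:E.
rewrite -/m -(est_law_sum n m.+1 (piece_prob m) (fun k => \1_(Ck k))).
by apply: eq_est_law => t; apply: eq_bigr => k _; congr (_ * _).
Qed.

Lemma prob_est n C : measurable C -> P (est n @^-1` C) = (est_law n \1_C)%:E.
Proof.
move=> mC; have := est_law_joint n C [::] (fun=> setT) mC isT.
rewrite (_ : \bigcap_(i in _) _ = setT); last first.
  by apply/seteqP; split => // w _ i.
by rewrite setIT probability_setT mule1; apply.
Qed.

Lemma piece_prob_ge0 m k : (0 < m)%N -> (k <= m)%N -> 0 <= piece_prob m k.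
Proof. by move=> m0 km; rewrite -lee_fin -(prob_piece 1). Qed.

End Identification.
End MarkovOperator.

(** * Lindeberg replacement for the Gaussian distribution function *)

Section NormalCdf.
Context {R : realType}.
Notation mu := (@lebesgue_measure R).
Implicit Types (m sg t : R).

Definition normal_cdf m sg t : R := Rintegral mu `]-oo, t] (normal_pdf m sg).

Lemma normal_cdfE m sg t : normal_prob m sg `]-oo, t]%classic = (normal_cdf m sg t)%:E.
Proof.
rewrite /normal_cdf /Rintegral fineK//.
exact: (fin_num_measure (normal_prob m sg : probability (measurableTypeR R) R)).
Qed.

Lemma normal_cdf_bounds m sg t : 0 <= normal_cdf m sg t <= 1.
Proof.
rewrite -!lee_fin -normal_cdfE measure_ge0/=.
exact: (@probability_le1 _ _ _ (normal_prob m sg : probability (measurableTypeR R) R)).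
Qed.

Lemma normal_cdf_is_derive m sg t : sg != 0 ->
  is_derive t 1 (normal_cdf m sg) (normal_pdf m sg t).
Proof.
move=> sg0.
have [] := @continuous_FTC1 R (normal_pdf m sg) -oo%O t (t + 1).
- by rewrite ltrDl.
- by apply: (integrableS measurableT) => //; exact: integrable_normal_pdf.
- by rewrite ltNyr.
- exact: continuous_normal_pdf.
move=> d1; rewrite derive1E => d2; exact: DeriveDef d1 d2.
Qed.

Lemma normal_cdf_ndecr m sg s t : s <= t -> normal_cdf m sg s <= normal_cdf m sg t.
Proof.
move=> st; rewrite -lee_fin -!normal_cdfE.
by apply: (@le_measure _ _ _ (normal_prob m sg : probability (measurableTypeR R) R));
  rewrite ?inE//; exact: subitvPr.
Qed.

(** Under [normal_prob m sg] the identity is a random variable with distribution function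
    [normal_cdf m sg], which gives the limits at both infinities. *)
Let idR : measurableTypeR R -> R := idfun.

HB.instance Definition _ :=
  @isMeasurableFun.Build _ _ _ _ idR (@measurable_id _ _ setT).

Lemma normal_cdf_cvgNy m sg : normal_cdf m sg t @[t --> -oo] --> (0 : R).
Proof.
have H := @cvg_cdfNy0 _ (measurableTypeR R) R (normal_prob m sg) (idR : {RV (normal_prob m sg : probability _ R) >-> R}).
have E : cdf (idR : {RV (normal_prob m sg : probability _ R) >-> R}) = EFin \o normal_cdf m sg.
  by apply/funext => t; rewrite /= -normal_cdfE.
by rewrite E in H; move/fine_cvg : H.
Qed.

Lemma normal_cdf_cvgy m sg : normal_cdf m sg t @[t --> +oo] --> (1 : R).
Proof.
have H := @cvg_cdfy1 _ (measurableTypeR R) R (normal_prob m sg) (idR : {RV (normal_prob m sg : probability _ R) >-> R}).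
have E : cdf (idR : {RV (normal_prob m sg : probability _ R) >-> R}) = EFin \o normal_cdf m sg.
  by apply/funext => t; rewrite /= -normal_cdfE.
by rewrite E in H; move/fine_cvg : H.
Qed.

Definition Phi : R -> R := normal_cdf 0 1.
Definition phi (t : R) : R := (Num.sqrt (2 * pi))^-1 * expR (- (t ^+ 2 / 2)).

Lemma Phi_is_derive t : is_derive t 1 Phi (phi t).
Proof.
apply: (is_derive_eqr (normal_cdf_is_derive 0 1 t (oner_neq0 R))).
rewrite normal_pdfE ?oner_neq0// /normal_peak /normal_fun /phi.
rewrite expr1n mul1r subr0; congr ((Num.sqrt _)^-1 * expR _); first by rewrite mulr_natl.
by rewrite mulNr.
Qed.

(** Both sides have the same derivative, so their difference is constant, and it tends to 0 at minus
    infinity. *)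
Lemma normal_cdf_std m sg t : 0 < sg -> normal_cdf m sg t = Phi ((t - m) / sg).
Proof.
move=> sg0.
have sgn : sg != 0 by rewrite gt_eqF.
pose D t := normal_cdf m sg t - Phi ((t - m) / sg).
have dD (u : R) : is_derive u 1 D 0.
  have d1 : is_derive u 1 (fun t => (t - m) / sg) sg^-1.
    have d0 : is_derive u 1 (fun t : R => sg^-1 * (t - m) ^+ 1) (sg^-1 * (1%:R * (u - m) ^+ 0)).
      exact: is_derive_pow_shift.
    have -> : (fun t => (t - m) / sg) = (fun t : R => sg^-1 * (t - m) ^+ 1).
      by apply/funext => z; rewrite expr1 mulrC.
    by apply: (@is_derive_eq _ _ _ _ _ _ _ _ d0); rewrite expr0 !mulr1.
  have d2 := Phi_is_derive ((u - m) / sg).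
  have d3 := @is_derive1_comp R Phi (fun t => (t - m) / sg) u _ _ d2 d1.
  have d4 := normal_cdf_is_derive m sg u sgn.
  apply: (is_derive_eqr (is_deriveB d4 d3)).
  rewrite normal_pdfE// /normal_peak /normal_fun /phi.
  rewrite -mulr_natr sqrtrM; last by rewrite mulr_ge0 ?sqr_ge0// pi_ge0.
  rewrite sqrtrM ?sqr_ge0// sqrtr_sqr gtr0_norm// sqrtrM//.
  rewrite (_ : - (u - m) ^+ 2 / (sg ^+ 2 *+ 2) = - (((u - m) / sg) ^+ 2 / 2)).
    have p0 : Num.sqrt pi != 0 :> R by rewrite gt_eqF// sqrtr_gt0 pi_gt0.
    have p2 : Num.sqrt 2%:R != 0 :> R by rewrite gt_eqF// sqrtr_gt0.
    by field; rewrite sgn p0 p2.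
  by rewrite -mulr_natr; field.
have cD s : D s = D t by apply: is_derive_0_is_cst => u; exact: dD.
have L : D s @[s --> -oo] --> (0 - 0 : R).
  apply: cvgB; first exact: normal_cdf_cvgNy.
  apply: (@cvg_comp _ _ _ (fun s => (s - m) / sg) Phi _ -oo); last exact: normal_cdf_cvgNy.
  apply/cvgrNyPle => A; exists (A * sg + m); split; first exact: num_real.
  by move=> s /ltW; rewrite ler_pdivrMr// lerBlDr.
have L' : (fun _ : R => D t) @ -oo --> (0 : R).
  by rewrite subr0 in L; rewrite -(funext cD : D = fun=> D t).
have c : (fun _ : R => D t) @ -oo --> D t by exact: cvg_cst.
have : D t = 0 by exact: (cvg_unique _ c L').
by move/eqP; rewrite subr_eq0 => /eqP.
Qed.

End NormalCdf.

(** * Expansions of the Gaussian test functions in space and in variance *)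

Section GaussianTestFunction.
Context {R : realType}.
Implicit Types (t r y v tau : R).

Lemma phi_ge0 t : 0 <= phi t.
Proof. by rewrite /phi mulr_ge0 ?expR_ge0// invr_ge0. Qed.

Lemma phi_is_derive t : is_derive t 1 (@phi R) (- (t * phi t)).
Proof.
have d2 : is_derive t 1 (fun z : R => - (1 / 2) * (z - 0) ^+ 2) (- (1 / 2) * (2%:R * (t - 0) ^+ 1)).
  exact: is_derive_pow_shift.
have d3 := @is_derive1_comp R expR _ t _ _ (is_derive_expR _) d2.
have d4 := @is_deriveZ _ _ _ _ (Num.sqrt (2 * pi))^-1 t 1 _ d3.
have E : @phi R = (Num.sqrt (2 * pi))^-1 \*: (expR \o (fun z : R => - (1 / 2) * (z - 0) ^+ 2)).
  by apply/funext => z; rewrite /phi /= subr0; congr (_ * expR _); field.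
rewrite E; apply: (is_derive_eqr d4).
rewrite /= -[_ *: _]/(_ * _) -[_ *: _]/(_ * _) !subr0 expr1; field.
by rewrite gt_eqF// sqrtr_gt0 mulr_gt0// pi_gt0.
Qed.

(** $e^u \ge 1 + u^2/2$ at $u = t^2/2$ gives $1 + t^4 \le 8 e^{t^2/2}$, and the normalising constant
    is at most 1. *)
Lemma phi_decay t : (1 + t ^+ 4) * phi t <= 8.
Proof.
have h0 : 0 <= t ^+ 2 / 2 by rewrite divr_ge0// sqr_ge0.
have h1 := @expR_ge1Dxn R (t ^+ 2 / 2) 1 h0.
have h2 : 1 + t ^+ 4 <= 8 * expR (t ^+ 2 / 2).
  have : (t ^+ 2 / 2) ^+ 2 / (2`!)%:R = t ^+ 4 / 8.
    by rewrite expr_div_n -exprM (_ : 2`! = 2%N)//; field.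
  move=> e; rewrite e in h1; have : 0 <= t ^+ 4 by rewrite exprn_even_ge0.
  move=> ?; apply: (@le_trans _ _ (8 * (1 + t ^+ 4 / 8))); first by lra.
  by rewrite ler_pM2l.
have c1 : (Num.sqrt (2 * pi))^-1 <= 1 :> R.
  have p2 := pi_ge2 R.
  rewrite invf_le1; last by rewrite sqrtr_gt0; lra.
  by rewrite -[leLHS]sqrtr1 ler_wsqrtr//; lra.
have c0 : 0 <= (Num.sqrt (2 * pi))^-1 :> R by rewrite invr_ge0.
rewrite /phi expRN.
have E0 := expR_gt0 (t ^+ 2 / 2).
rewrite mulrCA -[leRHS]mul1r; apply: ler_pM => //.
  by rewrite mulr_ge0 ?invr_ge0 ?(ltW E0)// addr_ge0// exprn_even_ge0.
by rewrite ler_pdivrMr.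
Qed.

Lemma phi_pow_bound t k : (k <= 4)%N -> `|t| ^+ k * phi t <= 8.
Proof.
move=> k4; apply: le_trans (phi_decay t); rewrite ler_wpM2r ?phi_ge0//.
have t0 := normr_ge0 t.
have -> : t ^+ 4 = `|t| ^+ 4 by rewrite -normrX ger0_norm// exprn_even_ge0.
have [t1|t1] := leP `|t| 1.
  by rewrite (le_trans (exprn_ile1 k t0 t1))// lerDl exprn_ge0.
rewrite (@le_trans _ _ (`|t| ^+ 4))//; last by rewrite lerDr.
by rewrite ler_weXn2l// ltW.
Qed.

Section Space.
Variables (rho r : R).
Hypothesis rho0 : 0 < rho.

Let z y := (r - y) * rho.

Let dz y : is_derive y 1 z (- rho).
Proof.
have d0 : is_derive y 1 (fun t : R => (- rho) * (t - r) ^+ 1) ((- rho) * (1%:R * (y - r) ^+ 0)).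
  exact: is_derive_pow_shift.
have -> : z = (fun t : R => (- rho) * (t - r) ^+ 1).
  by apply/funext => t; rewrite /z expr1; ring.
by apply: (is_derive_eqr d0); rewrite expr0 !mulr1.
Qed.

Let F y := Phi (z y).
Let F1 y := - rho * phi (z y).
Let F2 y := - rho ^+ 2 * (z y * phi (z y)).
Let F3 y := rho ^+ 3 * ((1 - z y ^+ 2) * phi (z y)).

Let dphi y : is_derive y 1 (fun y => phi (z y)) (rho * (z y * phi (z y))).
Proof.
apply: (is_derive_eqr (@is_derive1_comp R (@phi R) z y _ _ (phi_is_derive _) (dz y))); ring.
Qed.

Let dF y : is_derive y 1 F (F1 y).
Proof.
apply: (is_derive_eqr (@is_derive1_comp R (@Phi R) z y _ _ (Phi_is_derive _) (dz y))).
by rewrite /F1; ring.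
Qed.

Let dF1 y : is_derive y 1 F1 (F2 y).
Proof.
apply: (is_derive_eqr (@is_deriveZ _ _ _ _ (- rho) y 1 _ (dphi y))).
by rewrite -[_ *: _]/(_ * _) /F2; ring.
Qed.

Let dF2 y : is_derive y 1 F2 (F3 y).
Proof.
have d1 := @is_deriveM _ _ z (fun y => phi (z y)) y 1 _ _ (dz y) (dphi y).
apply: (is_derive_eqr (@is_deriveZ _ _ _ _ (- rho ^+ 2) y 1 _ d1)).
by rewrite /= -![_ *: _]/(_ * _) /F3; ring.
Qed.

Let F3_bound y : `|F3 y| <= 16 * rho ^+ 3.
Proof.
rewrite /F3 normrM ger0_norm ?exprn_ge0 ?(ltW rho0)// mulrC ler_wpM2r ?exprn_ge0 ?(ltW rho0)//.
rewrite normrM (ger0_norm (phi_ge0 _)).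
have b0 := phi_pow_bound (z y) 0 isT; have b2 := phi_pow_bound (z y) 2 isT.
rewrite expr0 mul1r in b0.
apply: (@le_trans _ _ ((1 + `|z y| ^+ 2) * phi (z y))).
  rewrite ler_wpM2r ?phi_ge0// (le_trans (ler_normB _ _))// normr1 normrX//.
rewrite mulrDl mul1r; lra.
Qed.

(** The third derivative is at most [16 rho^3], since [phi] and [z^2 phi] are at most 8; three uses
    of [mvt_power_bound] keep that constant instead of dividing it by 6. *)
Lemma Phi_taylor_space y : `|Phi ((r - y) * rho) - Phi (r * rho)
    + rho * phi (r * rho) * y + rho ^+ 2 * (r * rho * phi (r * rho)) / 2 * y ^+ 2|
  <= 16 * rho ^+ 3 * `|y| ^+ 3.
Proof.
have e0 : 0 <= 16 * rho ^+ 3 by rewrite mulr_ge0// exprn_ge0// ltW.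
have dpow n (c u : R) : is_derive u 1 (fun t : R => c * (t - 0) ^+ n.+1) (c * (n.+1%:R * (u - 0) ^+ n)).
  exact: is_derive_pow_shift.
pose D2 u := F2 u - F2 0.
pose D1 u := F1 u - F1 0 - F2 0 * (u - 0) ^+ 1.
pose D0 u := F u - F 0 - F1 0 * (u - 0) ^+ 1 - F2 0 / 2 * (u - 0) ^+ 2.
have dD2 (u : R) : is_derive u 1 D2 (F3 u).
  by apply: (is_derive_eqr (is_deriveB (dF2 u) (is_derive_cst (F2 0) u 1))); rewrite subr0.
have dD1 (u : R) : is_derive u 1 D1 (D2 u).
  apply: (is_derive_eqr (is_deriveB (is_deriveB (dF1 u) (is_derive_cst (F1 0) u 1)) (dpow 0%N (F2 0) u))).
  by rewrite /D2 expr0; ring.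
have dD0 (u : R) : is_derive u 1 D0 (D1 u).
  apply: (is_derive_eqr (is_deriveB (is_deriveB (is_deriveB (dF u) (is_derive_cst (F 0) u 1)) (dpow 0%N (F1 0) u)) (dpow 1%N (F2 0 / 2) u))).
  by rewrite /D1 expr0 !expr1; field.
pose e := `|y| + 1.
have b3 u : `|u - 0| < e -> `|F3 u| <= 16 * rho ^+ 3 * `|u - 0| ^+ 0.
  by rewrite expr0 mulr1.
have b2 : forall u, `|u - 0| < e -> `|D2 u| <= 16 * rho ^+ 3 * `|u - 0| ^+ 1.
  by apply: (mvt_power_bound D2 F3 0 e _ 0 e0) => //; rewrite /D2 subrr.
have b1 : forall u, `|u - 0| < e -> `|D1 u| <= 16 * rho ^+ 3 * `|u - 0| ^+ 2.
  by apply: (mvt_power_bound D1 D2 0 e _ 1 e0) => //; rewrite /D1 !subrr expr1 mulr0 subr0.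
have b0 : forall u, `|u - 0| < e -> `|D0 u| <= 16 * rho ^+ 3 * `|u - 0| ^+ 3.
  by apply: (mvt_power_bound D0 D1 0 e _ 2 e0) => //; rewrite /D0 !subrr expr1 expr0n !mulr0 !subr0.
have := b0 y; rewrite subr0 /e ltrDl => /(_ ltr01).
rewrite /D0 /F /F1 /F2 /z !subr0 expr1; apply: le_trans.
by apply: eqW; congr `|_|; field.
Qed.

End Space.

Section Time.
Variable r : R.

Let q v := r * v `^ (- (1 / 2)).

Let dq v : 0 < v -> is_derive v 1 q (- (1 / 2) * (v^-1 * q v)).
Proof.
move=> v0.
have d0 := @is_derive1_powR R (- (1 / 2)) v v0.
apply: (is_derive_eqr (@is_deriveZ _ _ _ _ r v 1 _ d0)).
rewrite -[_ *: _]/(_ * _) /q powRD; last by rewrite [v == 0]gt_eqF ?implybT.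
by rewrite powR_inv1 ?ltW//; ring.
Qed.

Let K1 v := - (1 / 2) * (v `^ (- 1) * (q v * phi (q v))).
Let K2 v := v ^- 2 * ((3 / 4 * q v - 1 / 4 * q v ^+ 3) * phi (q v)).

Let dK v : 0 < v -> is_derive v 1 (fun v => Phi (q v)) (K1 v).
Proof.
move=> v0.
apply: (is_derive_eqr (@is_derive1_comp R (@Phi R) q v _ _ (Phi_is_derive _) (dq v v0))).
by rewrite /K1 powR_inv1 ?ltW//; ring.
Qed.

Let dK1 v : 0 < v -> is_derive v 1 K1 (K2 v).
Proof.
move=> v0.
have d0 := @is_derive1_powR R (- 1) v v0.
have d1 := @is_derive1_comp R (@phi R) q v _ _ (phi_is_derive _) (dq v v0).
have d2 := @is_deriveM _ _ q (fun y => phi (q y)) v 1 _ _ (dq v v0) d1.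
have d3 := @is_deriveM _ _ _ _ v 1 _ _ d0 d2.
apply: (is_derive_eqr (@is_deriveZ _ _ _ _ (- (1 / 2)) v 1 _ d3)).
rewrite /= -![_ *: _]/(_ * _) /K2.
have -> : v `^ (- 1 - 1) = v ^- 2.
  by rewrite -opprD powRN (_ : 1 + 1 = 2%:R)// powR_mulrn// ltW.
rewrite powR_inv1 ?ltW//.
rewrite -[(q * _) v]/(q v * phi (q v)).
move: (q v) (phi (q v)) => Q W; field; by rewrite gt_eqF.
Qed.

Let K2_bound v : 0 < v -> `|K2 v| <= 8 * v ^- 2.
Proof.
move=> v0; rewrite /K2 normrM ger0_norm; last by rewrite invr_ge0 exprn_ge0// ltW.
rewrite mulrC ler_wpM2r ?invr_ge0 ?exprn_ge0 ?(ltW v0)//.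
rewrite normrM (ger0_norm (phi_ge0 _)).
have b1 := phi_pow_bound (q v) 1 isT; have b3 := phi_pow_bound (q v) 3 isT.
apply: (@le_trans _ _ ((3 / 4 * `|q v| ^+ 1 + 1 / 4 * `|q v| ^+ 3) * phi (q v))).
  apply: ler_wpM2r; first exact: phi_ge0.
  by apply: (le_trans (ler_normB _ _)); rewrite !(normrM (_ / _)) normrX expr1 !(@ger0_norm _ (_ / _)).
rewrite mulrDl -!mulrA; lra.
Qed.

(** The mean value theorem is used twice in the variance variable. The linear coefficient is half
    the second derivative in space, with [tau^-1] for [rho^2]: the heat equation. *)
Lemma Phi_taylor_time tau th : 0 < tau -> 0 <= th ->
  `|Phi (r * (tau + th) `^ (- (1 / 2))) - Phi (r * tau `^ (- (1 / 2)))
    + 1 / 2 * (tau^-1 * (r * tau `^ (- (1 / 2)) * phi (r * tau `^ (- (1 / 2))))) * th|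
  <= 8 * tau ^- 2 * th ^+ 2.
Proof.
move=> tau0 th0.
have pos z : tau <= z -> 0 < z by exact: lt_le_trans.
have cont (F dF : R -> R) b : tau <= b -> (forall z : R, 0 < z -> is_derive z 1 F (dF z)) ->
    {within `[tau, b], continuous F}.
  move=> tb dF'; apply: derivable_within_continuous => z.
  rewrite in_itv/= => /andP[z1 _]; exact: (@ex_derive _ _ _ _ _ _ _ (dF' z (pos z z1))).
have mvt (F dF : R -> R) b : tau <= b -> (forall z : R, 0 < z -> is_derive z 1 F (dF z)) ->
    exists2 z, tau <= z <= b & F b - F tau = dF z * (b - tau).
  move=> tb dF'.
  have [|z zin e] := @MVT_segment R F dF tau b tb _ (cont _ _ _ tb dF').
    by move=> z; rewrite in_itv/= => /andP[z1 _]; apply: dF'; apply: pos; exact: ltW.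
  by exists z => //; rewrite in_itv/= in zin.
have tth : tau <= tau + th by rewrite lerDl.
have [c /andP[c1 c2] e1] := mvt (fun v => Phi (q v)) K1 _ tth dK.
have [c' /andP[c1' c2'] e2] := mvt K1 K2 _ c1 dK1.
rewrite -/(q (tau + th)) -/(q tau) e1.
have -> : K1 c * (tau + th - tau) + 1 / 2 * (tau^-1 * (q tau * phi (q tau))) * th = (K1 c - K1 tau) * th.
  by rewrite /K1 (powR_inv1 (ltW tau0)); ring.
rewrite e2 normrM (ger0_norm th0) expr2 mulrA; apply: ler_wpM2r => //.
rewrite normrM (@ger0_norm _ (c - tau)) ?subr_ge0//.
have c'0 := pos c' c1'.
apply: ler_pM; first exact: normr_ge0.
- by rewrite subr_ge0.
- apply: (le_trans (K2_bound c' c'0)); rewrite ler_pM2l//; have t2 : tau ^+ 2 <= c' ^+ 2 by apply: lerXn2r => //; rewrite nnegrE ltW.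
  by rewrite lef_pV2 ?posrE ?mulr_gt0 ?exprn_gt0.
- by rewrite lerBlDl.
Qed.

End Time.

(** A centred step of variance [s2] and an increase of [tau] by [s2] have the same second-order
    effect. What remains is the cubic term, controlled by [|y|^3 <= b y^2], and [s2^2]. [C] depends
    only on the lower bound [tau0], because the scheme lets [tau] grow. *)
Lemma lindeberg_step tau0 : 0 < tau0 -> exists2 C, 0 <= C &
  forall tau r b s2 (K : nat) (p y : nat -> R), tau0 <= tau -> 0 <= b ->
  (forall k, (k < K)%N -> 0 <= p k) -> \sum_(k < K) p k = 1 ->
  \sum_(k < K) p k * y k = 0 -> \sum_(k < K) p k * y k ^+ 2 = s2 ->
  (forall k, (k < K)%N -> `|y k| <= b) ->
  `|\sum_(k < K) p k * Phi ((r - y k) * tau `^ (- (1 / 2)))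
    - Phi (r * (tau + s2) `^ (- (1 / 2)))| <= C * (b * s2 + s2 ^+ 2).
Proof.
move=> tau00; pose rho0 := tau0 `^ (- (1 / 2)).
have rho00 : 0 < rho0 by exact: powR_gt0.
exists (16 * rho0 ^+ 3 + 8 * tau0 ^- 2).
  by rewrite addr_ge0// mulr_ge0// ?invr_ge0 exprn_ge0// ltW.
move=> tau r b s2 K p y tau0tau b0 p0 p1 py py2 yb.
have tau_gt0 : 0 < tau by exact: lt_le_trans tau0tau.
pose rho := tau `^ (- (1 / 2)).
have rho_gt0 : 0 < rho by exact: powR_gt0.
have s20 : 0 <= s2.
  by rewrite -py2; apply: sumr_ge0 => k _; rewrite mulr_ge0 ?sqr_ge0// p0.
have rho2 : rho ^+ 2 = tau^-1.
  rewrite /rho -powR_mulrn ?powR_ge0// -powRrM.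
  by rewrite (_ : - (1 / 2) * 2%:R = - 1 :> R) ?powR_inv1 ?ltW//; field.
have rho_le : rho <= rho0.
  rewrite /rho /rho0 !powRN lef_pV2 ?posrE ?powR_gt0//.
  by apply: ge0_ler_powR => //; rewrite nnegrE ltW.
have tau2_le : tau ^- 2 <= tau0 ^- 2.
  by rewrite -!exprVn; apply: lerXn2r; rewrite ?nnegrE ?invr_ge0 ?(ltW tau00) ?(ltW tau_gt0)// lef_pV2 ?posrE.
set S := \sum_(k < K) _.
pose M := r * rho * phi (r * rho).
have hS : `|S - Phi (r * rho) + rho ^+ 2 * M / 2 * s2| <= 16 * rho ^+ 3 * (b * s2).
  have -> : S - Phi (r * rho) + rho ^+ 2 * M / 2 * s2 =
     \sum_(k < K) p k * (Phi ((r - y k) * rho) - Phi (r * rho)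
       + rho * phi (r * rho) * y k + rho ^+ 2 * (r * rho * phi (r * rho)) / 2 * y k ^+ 2).
    under eq_bigr do rewrite !mulrDr.
    rewrite !big_split/= -/S -mulr_suml p1 mul1r; congr (_ + _).
      rewrite (eq_bigr (fun k : 'I_K => rho * phi (r * rho) * (p k * y k))); last by move=> k _; ring.
      by rewrite -mulr_sumr py mulr0 addr0.
    rewrite (eq_bigr (fun k : 'I_K => rho ^+ 2 * M / 2 * (p k * y k ^+ 2))); last by move=> k _; rewrite /M; ring.
    by rewrite -mulr_sumr py2.
  apply: (le_trans (ler_norm_sum _ _ _)).
  rewrite -py2 [b * _]mulr_sumr mulr_sumr; apply: ler_sum => k _.
  rewrite normrM (ger0_norm (p0 k (ltn_ord k))).
  have h := Phi_taylor_space rho r rho_gt0 (y k).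
  have h2 : 16 * rho ^+ 3 * `|y k| ^+ 3 <= 16 * rho ^+ 3 * (b * y k ^+ 2).
    apply: ler_wpM2l; first by rewrite mulr_ge0// exprn_ge0// ltW.
    have -> : y k ^+ 2 = `|y k| ^+ 2 by rewrite real_normK// num_real.
    by rewrite exprS; apply: ler_wpM2r; [exact: exprn_ge0|exact: yb].
  rewrite (_ : 16 * rho ^+ 3 * (b * (p k * y k ^+ 2)) = p k * (16 * rho ^+ 3 * (b * y k ^+ 2))); last by ring.
  by apply: ler_wpM2l; [exact: p0|exact: le_trans h h2].
have hT := Phi_taylor_time r tau s2 tau_gt0 s20.
rewrite -/rho -/M in hT.
have -> : S - Phi (r * (tau + s2) `^ (- (1 / 2))) =
   (S - Phi (r * rho) + rho ^+ 2 * M / 2 * s2) -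
   (Phi (r * (tau + s2) `^ (- (1 / 2))) - Phi (r * rho) + 1 / 2 * (tau^-1 * M) * s2).
  by rewrite rho2; move: S (Phi _) (Phi _) (tau^-1) M {hS hT py2} => S' u v t' M'; field.
apply: (le_trans (ler_normB _ _)).
have a1 : 16 * rho ^+ 3 * (b * s2) <= 16 * rho0 ^+ 3 * (b * s2).
  apply: ler_wpM2r; first exact: mulr_ge0.
  by rewrite ler_pM2l//; apply: lerXn2r => //; rewrite nnegrE ltW.
have a2 : 8 * tau ^- 2 * s2 ^+ 2 <= 8 * tau0 ^- 2 * s2 ^+ 2.
  by apply: ler_wpM2r; [exact: sqr_ge0|rewrite ler_pM2l].
have rho3 : 0 <= 16 * rho0 ^+ 3 by apply: mulr_ge0 => //; rewrite exprn_ge0// ltW.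
have t2 : 0 <= 8 * tau0 ^- 2 by apply: mulr_ge0 => //; rewrite invr_ge0 exprn_ge0// ltW.
have c1 : 0 <= 16 * rho0 ^+ 3 * s2 ^+ 2 by apply: mulr_ge0 => //; exact: sqr_ge0.
have c2 : 0 <= 8 * tau0 ^- 2 * (b * s2) by apply: mulr_ge0 => //; exact: mulr_ge0.
rewrite mulrDl !mulrDr; move: hS hT a1 a2 c1 c2; lra.
Qed.

End GaussianTestFunction.

(** * Mean, variance and replacement errors along the recursion *)

Section CenteredLaw.
Context {R : realType}.
Variables (x : R) (f : R -> R) (gam : nat -> R) (N : nat -> nat) (b : nat -> R).

Local Notation pr := (piece_prob f).
Local Notation pv := (piece_value x).
Local Notation km := (kernel_mean x f).
Local Notation law := (est_law x f gam N).

Lemma sum_piece_value m : \sum_(k < m.+1) pr m k * pv m k = km m.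
Proof.
rewrite sum_piece_prob /piece_value ltnn mulr0 addr0 /kernel_mean.
by apply: eq_bigr => k _; rewrite ltn_ord.
Qed.

Definition kernel_var m : R := kernel_second_moment x f m - km m ^+ 2.

Lemma sum_piece_centered m : \sum_(k < m.+1) pr m k * (pv m k - km m) = 0.
Proof.
under eq_bigr do rewrite mulrBr.
by rewrite big_split/= sumrN sum_piece_value -mulr_suml sum_piece_prob1 mul1r subrr.
Qed.

Lemma sum_piece_var m : \sum_(k < m.+1) pr m k * (pv m k - km m) ^+ 2 = kernel_var m.
Proof.
have e2 : \sum_(k < m.+1) pr m k * pv m k ^+ 2 = kernel_second_moment x f m.
  rewrite (sum_piece_prob f m (fun k => pv m k ^+ 2)) /piece_value ltnn expr0n/= mulr0 addr0.
  by apply: eq_bigr => k _; rewrite ltn_ord.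
rewrite (eq_bigr (fun k : 'I_m.+1 => pr m k * pv m k ^+ 2 + (- (2 * km m)) * (pr m k * pv m k)
   + km m ^+ 2 * pr m k)); last by move=> k _; ring.
by rewrite !big_split/= -!mulr_sumr e2 sum_piece_value sum_piece_prob1 /kernel_var; ring.
Qed.

Fixpoint est_mean n : R :=
  if n is n'.+1 then (1 - gam n) * est_mean n' + gam n * km (N n) else 0.

Fixpoint est_var n : R :=
  if n is n'.+1 then (1 - gam n) ^+ 2 * est_var n' + gam n ^+ 2 * kernel_var (N n) else 0.

(** Accumulates the errors [b s2] of [lindeberg_step], as [est_var_sq] does for [s2^2]. The absolute
    value covers the first indices, where [gam n] may exceed 1. *)
Fixpoint est_lyap n : R :=
  if n is n'.+1 then `|1 - gam n| ^+ 3 * est_lyap n' + gam n ^+ 3 * (b n * kernel_var (N n)) else 0.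

Fixpoint est_var_sq n : R :=
  if n is n'.+1 then (1 - gam n) ^+ 4 * est_var_sq n' + gam n ^+ 4 * kernel_var (N n) ^+ 2 else 0.

Definition centered_law n (H : R -> R) : R := law n (fun t => H (t - est_mean n)).

Lemma centered_law_step n H : centered_law n.+1 H = centered_law n (fun s =>
  \sum_(k < (N n.+1).+1) pr (N n.+1) k *
     H ((1 - gam n.+1) * s + gam n.+1 * (pv (N n.+1) k - km (N n.+1)))).
Proof.
rewrite /centered_law /=; apply: eq_est_law => t; apply: eq_bigr => k _.
by congr (_ * H _); ring.
Qed.

Hypothesis gam0 : forall n, (0 < n)%N -> 0 < gam n.
Hypothesis pr0 : forall n k, (0 < n)%N -> (k <= N n)%N -> 0 <= pr (N n) k.
Hypothesis b0 : forall n, (0 < n)%N -> 0 <= b n.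
Hypothesis pvb : forall n k, (0 < n)%N -> (k <= N n)%N -> `|pv (N n) k - km (N n)| <= b n.

Lemma est_law_le n G1 G2 : (forall t, G1 t <= G2 t) -> law n G1 <= law n G2.
Proof.
elim: n G1 G2 => [|n IH] G1 G2 G12 /=; first exact: G12.
by apply: IH => t; apply: ler_sum => k _; apply: ler_wpM2l; [exact: (pr0 n.+1 k isT (ltn_ord k))|exact: G12].
Qed.

Lemma est_law_cst n c : law n (fun=> c) = c.
Proof.
elim: n => //= n IH; rewrite -[RHS]IH; apply: eq_est_law => t.
by rewrite -mulr_suml sum_piece_prob1 mul1r.
Qed.

Lemma est_lawB n G1 G2 : law n (fun t => G1 t - G2 t) = law n G1 - law n G2.
Proof.
rewrite -[X in _ + X]mulN1r -est_lawZ -est_lawD; apply: eq_est_law => t.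
by rewrite mulN1r.
Qed.

Lemma est_law_dist n G1 G2 c : (forall t, `|G1 t - G2 t| <= c) -> `|law n G1 - law n G2| <= c.
Proof.
move=> h; rewrite -est_lawB ler_norml -(est_law_cst n (- c)) -[X in _ && (_ <= X)](est_law_cst n c).
by apply/andP; split; apply: est_law_le => t; have := h t; rewrite ler_norml => /andP[].
Qed.

(** The cross term of the square vanishes because the new increment is centred whatever the past. *)
Lemma centered_law_sqr n : centered_law n (fun s => s ^+ 2) = est_var n.
Proof.
suff : centered_law n id = 0 /\ centered_law n (fun s => s ^+ 2) = est_var n by case.
elim: n => [|n [IH1 IH2]].
  by rewrite /centered_law /= subrr expr0n.
set g := gam n.+1; set m := N n.+1.
split.
  rewrite centered_law_step -/g -/m; transitivity ((1 - g) * centered_law n id); last by rewrite IH1 mulr0.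
  rewrite /centered_law -est_lawZ; apply: eq_est_law => t.
  rewrite (eq_bigr (fun k : 'I_m.+1 => (1 - g) * (t - est_mean n) * pr m k
     + g * (pr m k * (pv m k - km m)))); last by move=> k _; ring.
  by rewrite big_split/= -!mulr_sumr sum_piece_centered sum_piece_prob1; ring.
rewrite centered_law_step -/g -/m /= -/g -/m -IH2 /centered_law -est_lawZ.
rewrite -(est_law_cst n (g ^+ 2 * kernel_var m)) -est_lawD; apply: eq_est_law => t.
rewrite (eq_bigr (fun k : 'I_m.+1 => (1 - g) ^+ 2 * (t - est_mean n) ^+ 2 * pr m k
     + 2 * (1 - g) * (t - est_mean n) * g * (pr m k * (pv m k - km m))
     + g ^+ 2 * (pr m k * (pv m k - km m) ^+ 2))); last by move=> k _; ring.
rewrite !big_split/= -!mulr_sumr sum_piece_centered sum_piece_prob1 sum_piece_var; ring.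
Qed.

Lemma kernel_var_ge0 n : (0 < n)%N -> 0 <= kernel_var (N n).
Proof.
move=> n0; rewrite -sum_piece_var; apply: sumr_ge0 => k _.
by rewrite mulr_ge0 ?sqr_ge0// (pr0 n k n0 (ltn_ord k)).
Qed.

Lemma est_var_ge0 n : 0 <= est_var n.
Proof.
elim: n => //= n IH; apply: addr_ge0; apply: mulr_ge0; rewrite ?sqr_ge0//.
exact: kernel_var_ge0.
Qed.

(* Lindeberg's replacement scheme: the observations are exchanged one at a time,
   from the last one down, for independent Gaussian variables, whose effect is
   to increase the variance parameter [tau]. *)
Lemma centered_law_gauss tau0 : 0 < tau0 -> exists2 C, 0 <= C &
  forall n tau w z, tau0 <= tau ->
  `|centered_law n (fun s => Phi ((z - w * s) * tau `^ (- (1 / 2))))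
    - Phi (z * (tau + w ^+ 2 * est_var n) `^ (- (1 / 2)))|
  <= C * (`|w| ^+ 3 * est_lyap n + w ^+ 4 * est_var_sq n).
Proof.
move=> /lindeberg_step[C C0 HC]; exists C => //.
elim=> [|n IH] tau w z tau0tau.
  have -> : tau + w ^+ 2 * est_var 0 = tau by rewrite /= mulr0 addr0.
  have -> : centered_law 0 (fun s => Phi ((z - w * s) * tau `^ (- (1 / 2)))) = Phi (z * tau `^ (- (1 / 2))).
    by rewrite /centered_law /= (_ : z - w * (0 - 0) = z)//; ring.
  by rewrite [X in `|X|]subrr normr0 /= !mulr0 addr0 mulr0.
rewrite centered_law_step; set g := gam n.+1; set m := N n.+1.
have g0 : 0 < g by exact: gam0.
set v := kernel_var m.
have v0 : 0 <= v by exact: kernel_var_ge0.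
(* The last increment, scaled by [w], has variance [w^2 g^2 v], and the earlier ones keep the weight
   [w (1 - g)]: hence an induction over all [tau] and [w]. *)
pose tau' := tau + w ^+ 2 * (g ^+ 2 * v).
have tau0tau' : tau0 <= tau'.
  by rewrite (le_trans tau0tau)// lerDl mulr_ge0 ?sqr_ge0// mulr_ge0 ?sqr_ge0.
have IH' := IH tau' (w * (1 - g)) z tau0tau'.
have step : `|centered_law n (fun s => \sum_(k < m.+1) pr m k *
     Phi ((z - w * ((1 - g) * s + g * (pv m k - km m))) * tau `^ (- (1 / 2))))
   - centered_law n (fun s => Phi ((z - w * (1 - g) * s) * tau' `^ (- (1 / 2))))|
   <= C * (`|w| * g * b n.+1 * (w ^+ 2 * (g ^+ 2 * v)) + (w ^+ 2 * (g ^+ 2 * v)) ^+ 2).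
  apply: est_law_dist => t; set s := t - _.
  have shift u : z - w * ((1 - g) * s + g * u) = z - w * (1 - g) * s - w * g * u by ring.
  rewrite (eq_bigr (fun k : 'I_m.+1 => pr m k *
      Phi ((z - w * (1 - g) * s - w * g * (pv m k - km m)) * tau `^ (- (1 / 2))))); last first.
    by move=> k _; rewrite shift.
  have := HC tau (z - w * (1 - g) * s) (`|w| * g * b n.+1) (w ^+ 2 * (g ^+ 2 * v)) m.+1
    (pr m) (fun k => w * g * (pv m k - km m)) tau0tau.
  apply.
  - by rewrite mulr_ge0 ?b0// mulr_ge0// ltW.
  - by move=> k km'; apply: pr0.
  - exact: sum_piece_prob1.
  - rewrite (eq_bigr (fun k : 'I_m.+1 => w * g * (pr m k * (pv m k - km m)))); last by move=> k _; ring.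
    by rewrite -mulr_sumr sum_piece_centered mulr0.
  - rewrite (eq_bigr (fun k : 'I_m.+1 => w ^+ 2 * g ^+ 2 * (pr m k * (pv m k - km m) ^+ 2))); last by move=> k _; ring.
    by rewrite -mulr_sumr sum_piece_var mulrA.
  - move=> k km'; rewrite !normrM (gtr0_norm g0); apply: ler_wpM2l.
      by rewrite mulr_ge0// ltW.
    exact: pvb.
have -> : tau + w ^+ 2 * est_var n.+1 = tau' + (w * (1 - g)) ^+ 2 * est_var n.
  by rewrite /tau' /= -/g -/m -/v; ring.
rewrite -[X in `|X|](subrKA (centered_law n (fun s => Phi ((z - w * (1 - g) * s) * tau' `^ (- (1 / 2)))))).
apply: (le_trans (ler_normD _ _)); apply: (le_trans (lerD step IH')).
rewrite -mulrDr /= -/g -/m -/v !normrM; apply: eqW; congr (C * _).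
have w3 : `|w| * w ^+ 2 = `|w| ^+ 3 by rewrite [RHS]exprS real_normK// num_real.
rewrite (_ : `|w| * g * b n.+1 * (w ^+ 2 * (g ^+ 2 * v)) = (`|w| * w ^+ 2) * (g ^+ 3 * (b n.+1 * v))); last by ring.
by rewrite w3; ring.
Qed.

End CenteredLaw.

(** * Rates of convergence *)

Section Rates.
Context {R : realType}.
Variables (alpha a : R) (gam m : nat -> R) (N : nat -> nat).
Hypothesis alpha_gt : 1 / 2 < alpha.
Hypothesis hgam : GS (- alpha) gam.
Hypothesis a_gt0 : 0 < a.
Hypothesis a_lt1 : a < 1.
Hypothesis hm : GS a m.
Hypothesis hN : even_orders m N.

(** For a finite limit, [xi] is its inverse and [M < l] reads [M xi < 1]; an infinite limit gives
    [xi = 0]. *)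
Lemma stepsize_cvg_inv (l : \bar R) (M : R) :
  (n%:R * gam n)%:E @[n --> \oo] --> l -> (M%:E < l)%E -> 0 < M ->
  exists2 xi, (n%:R * gam n)^-1 @[n --> \oo] --> xi & 0 < 1 - M * xi.
Proof.
move=> hl Ml M0; case: l hl Ml => [r| |] hl //=.
- rewrite lte_fin => Mr; have r0 : 0 < r by exact: lt_trans Mr.
  move/fine_cvg : hl => hl.
  exists r^-1; first by apply: cvgnV => //; rewrite gt_eqF.
  by rewrite subr_gt0 ltr_pdivrMr// mul1r.
- move=> _; exists 0; last by rewrite mulr0 subr0.
  have pos : \forall n \near \oo, 0 < n%:R * gam n.
    by exists 1%N => // n /= n0; rewrite mulr_gt0 ?ltr0n// hgam.1.
  by apply/(gtr0_cvgV0 pos)/cvgeryP.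
Qed.

Lemma gam_cvg0 : gam n @[n --> \oo] --> (0 : R).
Proof. by apply: GS_cvg0 hgam _; move: alpha_gt; lra. Qed.

Lemma m_gt0 n : (0 < n)%N -> 0 < m n.
Proof. exact: hm.1. Qed.

Lemma minv_cvg0 : (m n)^-1 @[n --> \oo] --> (0 : R).
Proof. exact: GS_inv_cvg0 hm a_gt0. Qed.

Lemma order_ratio_inv : m n / (N n)%:R @[n --> \oo] --> (1 : R).
Proof.
have := cvgnV (oner_neq0 R) hN.2; rewrite invr1; apply: eqn_cvg.
by exists 1%N => // n _ /=; rewrite invf_div.
Qed.

Lemma order_cvg_pinfty : N n @[n --> \oo] --> \oo.
Proof.
have H : ((N n)%:R : R)^-1 @[n --> \oo] --> (0 : R).
  have := cvgnM order_ratio_inv minv_cvg0; rewrite mulr0; apply: eqn_cvg.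
  exists 1%N => // n /= n0; rewrite mulrAC mulfV ?mul1r// gt_eqF//.
  exact: m_gt0.
apply/cvgnyPge => K.
have K0 : 0 < (K.+1%:R : R)^-1 by rewrite invr_gt0 ltr0n.
have := cvgr_lt _ H _ K0; move=> [n0 _ h]; exists (maxn 1 n0) => // n /=.
rewrite geq_max => /andP[n1 nn0]; have := h n nn0.
rewrite ltf_pV2 ?posrE ?ltr0n ?(hN.1 n n1).1// ltr_nat => /ltnW/ltnW; exact.
Qed.

Definition rate n : R := gam n `^ (- (1 / 2)) * m n `^ (- (1 / 4)).

Definition rate_index : R := (2 * alpha - a) / 4.

Lemma rate_index_gt0 : 0 < rate_index.
Proof. by rewrite /rate_index; move: alpha_gt a_lt1; lra. Qed.

Lemma GS_rate : GS rate_index rate.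
Proof.
have := GS_mul _ _ _ _ (GS_powR _ _ (- (1 / 2)) hgam) (GS_powR _ _ (- (1 / 4)) hm).
by rewrite (_ : _ + _ = rate_index)// /rate_index; field.
Qed.

Lemma rate_gt0 n : (0 < n)%N -> 0 < rate n.
Proof. exact: GS_rate.1. Qed.

(** The variance of the estimator is of order [gam sqrt m]; this identity makes [rate^2] its exact
    inverse. *)
Lemma rate_sqr n : (0 < n)%N -> rate n ^+ 2 * gam n = (Num.sqrt (m n))^-1.
Proof.
move=> n0; have g0 := hgam.1 n n0; have m0 := m_gt0 n n0.
rewrite /rate exprMn -![_ `^ _ ^+ 2]powR_mulrn ?powR_ge0// -!powRrM.
rewrite (_ : - (1 / 2) * 2%:R = - 1 :> R); last by field.
rewrite (_ : - (1 / 4) * 2%:R = - (2^-1) :> R); last by field.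
rewrite powR_inv1 ?(ltW g0)// powRN powR12_sqrt ?(ltW m0)// mulrAC mulVf ?mul1r//.
by rewrite gt_eqF.
Qed.

(** The sequence separating the two regimes is the ratio of their normalisations [rate] and
    [m^2]. *)
Lemma rate_bias n : (0 < n)%N ->
  gam n `^ (- (1 / 2)) * m n `^ (- (9 / 4)) = rate n / m n ^+ 2.
Proof.
move=> n0; have m0 := m_gt0 n n0.
rewrite /rate -mulrA; congr (_ * _).
rewrite -[m n ^+ 2]powR_mulrn ?(ltW m0)// -powRN -powRD; last by rewrite [m n == 0]gt_eqF ?implybT.
by congr (_ `^ _); field.
Qed.

Section Density.
Variables (x : R) (f : R -> R) (g : nat -> R -> R).
Hypothesis x01 : 0 < x < 1.
Hypothesis mf : measurable_fun [set: R] f.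
Hypothesis g0 : g 0%N = f.
Hypothesis dg : forall i, (i < 4)%N -> derivative_on `[0, 1] (g i) (g i.+1).

Lemma order_bias_cvg :
  m n ^+ 2 * (kernel_mean x f (N n) - f x) @[n --> \oo] --> - (2 * Delta2 f x).
Proof.
have hc : (N n)./2 @[n --> \oo] --> \oo.
  apply/cvgnyPge => K; move/cvgnyPge : order_cvg_pinfty => /(_ K.*2); apply: filterS => n h.
  by rewrite -(doubleK K) half_leq.
have H := cvg_comp _ _ hc (kernel_bias_cvg x x01 f g mf g0 dg).
have := cvgnM (cvgnX 2 order_ratio_inv) H; rewrite expr1n mul1r; apply: eqn_cvg.
exists 1%N => // n /= n0; have [N0 Nev] := hN.1 n n0.
rewrite mul2n even_halfK// mulrA -exprMn mulfVK// pnatr_eq0 -lt0n//.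
Qed.

Lemma kernel_mean_cvg : kernel_mean x f (N n) @[n --> \oo] --> f x.
Proof.
have fc : f x @[n --> \oo] --> f x by exact: cvg_cst.
have := cvgnD (cvgnM (cvgnX 2 minv_cvg0) order_bias_cvg) fc.
rewrite expr0n/= mul0r add0r; apply: eqn_cvg.
exists 1%N => // n /= n0; rewrite mulrA -exprMn mulVf ?expr1n ?mul1r ?subrK//.
by rewrite gt_eqF// m_gt0.
Qed.

Lemma order_sqrt_ratio : Num.sqrt (N n)%:R / Num.sqrt (m n) @[n --> \oo] --> (1 : R).
Proof.
have c : {for (1 : R), continuous (@Num.sqrt R)} by exact: sqrt_continuous.
have := cvgn_comp c hN.2; rewrite sqrtr1; apply: eqn_cvg.
by exists 1%N => // n /= n0; rewrite sqrtrM ?ler0n// sqrtrV// ltW// m_gt0.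
Qed.

Lemma sqrt_minv_cvg0 : (Num.sqrt (m n))^-1 @[n --> \oo] --> (0 : R).
Proof.
have c : {for (0 : R), continuous (@Num.sqrt R)} by exact: sqrt_continuous.
have := cvgn_comp c minv_cvg0; rewrite sqrtr0; apply: eqn_cvg.
by exists 1%N => // n /= n0; rewrite sqrtrV// ltW// m_gt0.
Qed.

(** The squared mean converges, hence is negligible against the second moment, which is normalised
    by [sqrt m]. *)
Lemma kernel_var_cvg :
  (Num.sqrt (m n))^-1 * kernel_var x f (N n) @[n --> \oo] --> C3 * f x * psi x.
Proof.
have H := cvg_comp _ _ order_cvg_pinfty (kernel_second_moment_cvg x x01 f g mf g0 dg).
have H2 := cvgnB (cvgnM order_sqrt_ratio H) (cvgnM sqrt_minv_cvg0 (cvgnX 2 kernel_mean_cvg)).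
rewrite mul1r mul0r subr0 in H2; apply: eqn_cvg H2.
exists 1%N => // n /= n0; rewrite /kernel_var mulrBr; congr (_ - _).
have N0 : Num.sqrt (N n)%:R != 0 :> R by rewrite gt_eqF// sqrtr_gt0 ltr0n (hN.1 n n0).1.
by rewrite mulrA -[_ / _ * _^-1]mulrAC mulfV// mul1r.
Qed.

Hypothesis pr0 : forall n k, (0 < n)%N -> (k <= N n)%N -> 0 <= piece_prob f (N n) k.

Lemma piece_value_deviation : exists b : nat -> R,
  [/\ forall n, 0 <= b n,
      forall n k, (0 < n)%N -> (k <= N n)%N ->
        `|piece_value x (N n) k - kernel_mean x f (N n)| <= b n &
      exists B : R, (Num.sqrt (m n))^-1 * b n @[n --> \oo] --> B].
Proof.
have [C [C0 HC]] := kernel_value_bound x x01.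
pose dev n k := `|piece_value x (N n) k - kernel_mean x f (N n)|.
(* The kernel bound starts at order 4. The finitely many smaller orders get the sum of all
   deviations, without effect on the limit. *)
pose b n := if (4 <= N n)%N then 2 * C * Num.sqrt (N n)%:R else \sum_(k < (N n).+1) dev n k.
exists b; split.
- by move=> n; rewrite /b; case: ifP => _; [rewrite !mulr_ge0|apply: sumr_ge0 => k _; exact: normr_ge0].
- move=> n k n0 kN; rewrite /b; case: ifP => [N4|_]; last first.
    have kN' : (k < (N n).+1)%N by [].
    by rewrite (bigD1 (Ordinal kN'))//= lerDl; apply: sumr_ge0 => j _; exact: normr_ge0.
  have bnd j : `|piece_value x (N n) j| <= C * Num.sqrt (N n)%:R.
    rewrite /piece_value; case: ifP => _; first exact: HC.
    by rewrite normr0 mulr_ge0.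
  have : `|kernel_mean x f (N n)| <= C * Num.sqrt (N n)%:R.
    rewrite -sum_piece_value (le_trans (ler_norm_sum _ _ _))//.
    rewrite -[leRHS]mul1r -[X in X * (C * _)](sum_piece_prob1 f (N n)) mulr_suml; apply: ler_sum => j _.
    have p0 := pr0 n j n0 (ltn_ord j).
    by rewrite normrM (ger0_norm p0); apply: ler_wpM2l.
  have := bnd k; have := ler_normB (piece_value x (N n) k) (kernel_mean x f (N n)); lra.
- exists (2 * C * 1).
  have := cvgnZ (2 * C) order_sqrt_ratio; apply: eqn_cvg.
  move/cvgnyPge : order_cvg_pinfty => /(_ 4); apply: filterS => n n4.
  by rewrite /b n4; ring.
Qed.

Section Limits.
Variables (xi : R) (b : nat -> R) (B : R).
Hypothesis xiE : (n%:R * gam n)^-1 @[n --> \oo] --> xi.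
Hypothesis bB : (Num.sqrt (m n))^-1 * b n @[n --> \oo] --> B.

Local Notation emean := (est_mean x f gam N).
Local Notation evar := (est_var x f gam N).
Local Notation elyap := (est_lyap x f gam N b).
Local Notation evar_sq := (est_var_sq x f gam N).
Local Notation kvar := (kernel_var x f).
Local Notation V0 := (C3 * f x * psi x).

Let rate_inv_cvg0 : (rate n)^-1 @[n --> \oo] --> (0 : R).
Proof. exact: GS_inv_cvg0 GS_rate rate_index_gt0. Qed.

Let gam0 : forall n, (0 < n)%N -> 0 < gam n.
Proof. exact: hgam.1. Qed.

Let rate_var : rate n ^+ 2 * (gam n * kvar (N n)) @[n --> \oo] --> V0.
Proof.
apply: eqn_cvg kernel_var_cvg; exists 1%N => // n /= n0.
by rewrite mulrA rate_sqr.
Qed.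

Section RateLimits.
Hypothesis kxi : 0 < 1 - rate_index * xi.

Lemma rate_mean_cvg (c : R) : rate n / m n ^+ 2 @[n --> \oo] --> c ->
  rate n * (emean n - f x) @[n --> \oo] --> - (2 * c * Delta2 f x) / (1 - rate_index * xi).
Proof.
move=> cc; apply: (sa_rate (fun n => emean n - f x) (fun n => kernel_mean x f (N n) - f x) rate gam 1 rate_index xi) => //.
- by exists 0%N => // n _ /=; rewrite expr1; ring.
- exact: GS_rate.
- exact: gam_cvg0.
- have := cvgnM cc order_bias_cvg.
  rewrite (_ : c * - (2 * Delta2 f x) = - (2 * c * Delta2 f x)); last by ring.
  apply: eqn_cvg; exists 1%N => // n /= n0; rewrite mulrA divfK// expf_neq0//.
  by rewrite gt_eqF// m_gt0.
Qed.

(** One of the two factors [gam] of the new term is the weight in [sa_rate]; the other one belongs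
    to [u]. *)
Lemma rate_var_cvg :
  rate n ^+ 2 * evar n @[n --> \oo] --> V0 / (2%:R - (rate_index + rate_index) * xi).
Proof.
apply: (sa_rate evar (fun n => gam n * kvar (N n)) (fun n => rate n ^+ 2) gam 2 (rate_index + rate_index) xi) => //.
- by exists 0%N => // n _ /=; ring.
- exact: GS_mul GS_rate GS_rate.
- exact: gam_cvg0.
- by move: kxi; lra.
Qed.

(** By [rate_sqr], [rate^3 gam^2 b kvar] is [1 / rate] times the two convergent sequences
    [b / sqrt m] and [kvar / sqrt m], and [rate] tends to infinity. The absolute value disappears
    once [gam < 1]. *)
Lemma rate_lyap_cvg0 : rate n ^+ 3 * elyap n @[n --> \oo] --> (0 : R).
Proof.
have -> : 0 = 0 / (3%:R - (rate_index + (rate_index + rate_index)) * xi) by rewrite mul0r.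
apply: (sa_rate elyap (fun n => gam n ^+ 2 * (b n * kvar (N n))) (fun n => rate n ^+ 3) gam 3 _ xi) => //.
- have := cvgr_lt _ gam_cvg0 1 ltr01; case=> n0 _ h; exists n0 => // n /= nn0.
  rewrite ger0_norm; last by rewrite subr_ge0; apply/ltW/h/leqW.
  by ring.
- exact: GS_mul GS_rate (GS_mul _ _ _ _ GS_rate GS_rate).
- exact: gam_cvg0.
- by move: kxi; lra.
- have := cvgnM rate_inv_cvg0 (cvgnM bB kernel_var_cvg); rewrite mul0r; apply: eqn_cvg.
  exists 1%N => // n /= n0; rewrite -(rate_sqr n n0).
  have r0 : rate n != 0 by rewrite gt_eqF// rate_gt0.
  by field.
Qed.

(** [rate^4 gam^3 kvar^2] is [gam] times the square of the convergent [rate^2 gam kvar]. *)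
Lemma rate_var_sq_cvg0 : rate n ^+ 4 * evar_sq n @[n --> \oo] --> (0 : R).
Proof.
pose k4 := rate_index + (rate_index + (rate_index + rate_index)).
have -> : 0 = 0 / (4%:R - k4 * xi) by rewrite mul0r.
apply: (sa_rate evar_sq (fun n => gam n ^+ 3 * kvar (N n) ^+ 2) (fun n => rate n ^+ 4) gam 4 _ xi) => //.
- by exists 0%N => // n _ /=; ring.
- exact: GS_mul GS_rate (GS_mul _ _ _ _ GS_rate (GS_mul _ _ _ _ GS_rate GS_rate)).
- exact: gam_cvg0.
- by move: kxi; rewrite /k4; lra.
- have := cvgnM gam_cvg0 (cvgnX 2 rate_var); rewrite mul0r; apply: eqn_cvg.
  by exists 1%N => // n /= n0; ring.
Qed.

End RateLimits.

Section OrderLimits.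
Hypothesis axi : 0 < 1 - 2 * a * xi.

Lemma order_mean_cvg :
  m n ^+ 2 * (emean n - f x) @[n --> \oo] --> - (2 * Delta2 f x) / (1 - (a + a) * xi).
Proof.
apply: (sa_rate (fun n => emean n - f x) (fun n => kernel_mean x f (N n) - f x) (fun n => m n ^+ 2) gam 1 (a + a) xi) => //.
- by exists 0%N => // n _ /=; rewrite expr1; ring.
- exact: GS_mul hm hm.
- exact: gam_cvg0.
- by move: axi; lra.
- exact: order_bias_cvg.
Qed.

(** [m^4 gam kvar] is [(m^2 / rate)^2] times the convergent [rate^2 gam kvar]. *)
Lemma order_var_cvg0 : (rate n / m n ^+ 2)^-1 @[n --> \oo] --> (0 : R) ->
  m n ^+ 4 * evar n @[n --> \oo] --> (0 : R).
Proof.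
move=> u0.
have -> : 0 = 0 / (2%:R - (a + (a + (a + a))) * xi) by rewrite mul0r.
apply: (sa_rate evar (fun n => gam n * kvar (N n)) (fun n => m n ^+ 4) gam 2 _ xi) => //.
- by exists 0%N => // n _ /=; ring.
- exact: GS_mul hm (GS_mul _ _ _ _ hm (GS_mul _ _ _ _ hm hm)).
- exact: gam_cvg0.
- by move: axi; lra.
- have := cvgnM (cvgnX 2 u0) rate_var; rewrite expr0n/= mul0r; apply: eqn_cvg.
  exists 1%N => // n /= n0.
  have r0 : rate n != 0 by rewrite gt_eqF// rate_gt0.
  have m0 : m n != 0 by rewrite gt_eqF// m_gt0.
  by field; rewrite r0 m0.
Qed.

End OrderLimits.
End Limits.
End Density.

(** * Comparison of the two indices in each regime *)

Section Indices.
Variable (c : R).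
Local Notation bias_rate := (fun n => gam n `^ (- (1 / 2)) * m n `^ (- (9 / 4))).

Lemma GS_bias_rate : GS (rate_index - 2 * a) bias_rate.
Proof.
have := GS_mul _ _ _ _ (GS_powR _ _ (- (1 / 2)) hgam) (GS_powR _ _ (- (9 / 4)) hm).
by rewrite (_ : _ + _ = rate_index - 2 * a)// /rate_index; field.
Qed.

(** Otherwise [bias_rate] would have a positive index and its inverse would tend to 0. *)
Lemma rate_index_le : bias_rate n @[n --> \oo] --> c -> rate_index <= 2 * a.
Proof.
move=> uc; rewrite leNgt; apply/negP => lt.
have u0 : (bias_rate n)^-1 @[n --> \oo] --> (0 : R).
  by apply: GS_inv_cvg0 GS_bias_rate _; rewrite subr_gt0.
have := cvgnM uc u0; rewrite mulr0 => u1.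
have : (1 : R) @[n --> \oo] --> (0 : R).
  apply: eqn_cvg u1; exists 1%N => // n /= n0; rewrite mulfV// gt_eqF//.
  exact: GS_bias_rate.1.
move=> H; have c1 : (1 : R) @[n --> \oo] --> (1 : R) by exact: cvg_cst.
have e : (1 : R) = 0 by exact: (cvg_unique _ c1 H).
by move/eqP : e; rewrite oner_eq0.
Qed.

(** A negative index of [bias_rate] would force the limit 0. *)
Lemma rate_index_eq : bias_rate n @[n --> \oo] --> c -> c != 0 -> rate_index = 2 * a.
Proof.
move=> uc c0; apply/eqP; rewrite eq_le rate_index_le//= leNgt; apply/negP => lt.
have u0 : bias_rate n @[n --> \oo] --> (0 : R).
  by apply: GS_cvg0 GS_bias_rate _; rewrite subr_lt0.
have e : c = 0 by exact: (cvg_unique _ uc u0).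
by move: c0; rewrite e eqxx.
Qed.

Lemma rate_index_ge : bias_rate n @[n --> \oo] --> +oo -> 2 * a <= rate_index.
Proof.
move=> uoo; rewrite leNgt; apply/negP => lt.
have u0 : bias_rate n @[n --> \oo] --> (0 : R).
  by apply: GS_cvg0 GS_bias_rate _; rewrite subr_lt0.
have [n1 _ h1] := cvgr_lt _ u0 1 ltr01.
move/cvgryPge : uoo => /(_ 1)[n2 _ h2].
have := h1 (maxn n1 n2) (leq_maxl _ _); have := h2 (maxn n1 n2) (leq_maxr _ _).
by move=> /= /le_lt_trans/[apply]; rewrite ltxx.
Qed.

End Indices.
End Rates.

(** * From smoothed test functions to indicators *)

Section Smoothing.
Context {R : realType}.
Local Opaque Phi.
Implicit Types (z : R).

(** The limit in [n] is taken first, at fixed smoothing level [j], and the one in [j] afterwards. *)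
Lemma cvg_sandwich (F : nat -> R) (L : R) (lo hi : nat -> nat -> R) (A B : nat -> R) :
  (forall j, \forall n \near \oo, lo j n <= F n <= hi j n) ->
  (forall j, lo j n @[n --> \oo] --> A j) -> (forall j, hi j n @[n --> \oo] --> B j) ->
  A j @[j --> \oo] --> L -> B j @[j --> \oo] --> L -> F n @[n --> \oo] --> L.
Proof.
move=> lohi loA hiB AL BL; apply/cvgrPdist_le => e e0.
have e2 : 0 < e / 2 by rewrite divr_gt0.
move/cvgrPdist_le : AL => /(_ _ e2)[j1 _ h1].
move/cvgrPdist_le : BL => /(_ _ e2)[j2 _ h2].
pose j := maxn j1 j2.
have a1 := h1 j (leq_maxl _ _); have b1 := h2 j (leq_maxr _ _).
have [n1 _ l1] := lohi j.
have := loA j; move/cvgrPdist_le => /(_ _ e2)[n2 _ l2].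
have := hiB j; move/cvgrPdist_le => /(_ _ e2)[n3 _ l3].
exists (maxn n1 (maxn n2 n3)) => // n /=; rewrite !geq_max => /and3P[n1n n2n n3n].
have := l1 n n1n; have := l2 n n2n; have := l3 n n3n; move: a1 b1 => /=.
rewrite !ler_norml => /andP[? ?] /andP[? ?] /andP[? ?] /andP[? ?] /andP[? ?].
by apply/andP; split; lra.
Qed.

Lemma Phi_ndecr (s t : R) : s <= t -> Phi s <= Phi t.
Proof. exact: normal_cdf_ndecr. Qed.

Lemma Phi_bounds (t : R) : 0 <= Phi t <= 1.
Proof. exact: normal_cdf_bounds. Qed.

Lemma Phi_continuous : continuous (@Phi R).
Proof.
move=> t; apply: differentiable_continuous; apply/derivable1_diffP.
by have /@ex_derive := Phi_is_derive t.
Qed.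

(** For zero variance it serves only at [z != 0], where strict and large inequalities agree. *)
Definition gauss_limit z (s2 : R) : R := if s2 == 0 then (0 < z)%R%:R else Phi (z / Num.sqrt s2).

(** Thresholds are moved by [dl] while the smoothing has variance [dl^4]: the shift amounts to
    [j + 1] standard deviations, so the error vanishes with [j] although both scales tend to 0. *)
Let dl (j : nat) : R := (j.+1%:R)^-1.

Let dl_cvg0 : dl j @[j --> \oo] --> (0 : R).
Proof. exact: cvg_harmonic. Qed.

Lemma mul_sqr_cvg_pinfty (u : nat -> R) z : 0 < z -> u j @[j --> \oo] --> z ->
  u j * j.+1%:R ^+ 2 @[j --> \oo] --> +oo.
Proof.
move=> z0 uz; apply/cvgryPge => A.
have z2 : z / 2 < z by lra.
have [n1 _ h1] := cvgr_gt _ uz _ z2.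
have [K AK] : exists K : nat, `|A| / (z / 2) <= K%:R.
  by have [K _ hK] := nbhs_infty_ger (`|A| / (z / 2)); exists K; apply: hK => /=.
exists (maxn n1 K) => // n /=; rewrite geq_max => /andP[n1n Kn].
have un : z / 2 < u n := h1 n n1n.
have nK : K%:R <= n.+1%:R :> R by rewrite ler_nat leqW.
have n1' : 1 <= n.+1%:R :> R by rewrite ler1n.
have z20 : 0 < z / 2 by rewrite divr_gt0.
apply: (le_trans (ler_norm A)).
rewrite ler_pdivrMr// in AK.
apply: (@le_trans _ _ (n.+1%:R * (z / 2))).
  by apply: (le_trans AK); apply: ler_wpM2r; [exact: ltW|].
rewrite mulrC; apply: ler_pM; rewrite ?(ltW z20)// ?(ltW un)//.
by rewrite expr2 ler_peMr.
Qed.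

Lemma powR_cvg (u : nat -> R) (r c : R) : 0 < c -> u n @[n --> \oo] --> c ->
  u n `^ r @[n --> \oo] --> c `^ r.
Proof.
move=> c0; apply: (@cvgn_comp R _ _ (fun t : R => t `^ r)).
have d := @is_derive1_powR R r c c0.
by apply: differentiable_continuous; apply/derivable1_diffP; exact: (@ex_derive _ _ _ _ _ _ _ d).
Qed.

Let dl4_powR j : (dl j ^+ 4) `^ (- (1 / 2)) = j.+1%:R ^+ 2.
Proof.
rewrite -powR_mulrn ?invr_ge0// -powRrM (_ : 4%:R * - (1 / 2) = - (2%:R) :> R); last by field.
by rewrite powRN powR_mulrn ?invr_ge0// /dl -exprVn invrK.
Qed.

(** For [s2 = 0] the argument grows like [z (j + 1)^2], to the infinity given by the sign of [z]. *)
Lemma Phi_cvg_smoothing z (s2 sg : R) : 0 <= s2 -> (s2 = 0 -> z != 0) ->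
  Phi ((z + sg * dl j) * (dl j ^+ 4 + s2) `^ (- (1 / 2))) @[j --> \oo] --> gauss_limit z s2.
Proof.
move=> s20 zs; rewrite /gauss_limit.
have zc : z + sg * dl j @[j --> \oo] --> z.
  have c : z @[j --> \oo] --> z by exact: cvg_cst.
  by have := cvgnD c (cvgnZ sg dl_cvg0); rewrite mulr0 addr0.
case: eqP => [s0|/eqP sn0]; last first.
  have s2_gt0 : 0 < s2 by rewrite lt_def sn0.
  have c1 : dl j ^+ 4 + s2 @[j --> \oo] --> s2.
    have c : s2 @[j --> \oo] --> s2 by exact: cvg_cst.
    by have := cvgnD (cvgnX 4 dl_cvg0) c; rewrite expr0n/= add0r.
  have c3 := cvgnM zc (powR_cvg _ (- (1 / 2)) _ s2_gt0 c1).
  have pw : s2 `^ (- (1 / 2)) = (Num.sqrt s2)^-1.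
    by rewrite powRN (_ : 1 / 2 = 2^-1 :> R) ?div1r// powR12_sqrt.
  rewrite pw in c3; exact: (@cvgn_comp R _ _ (@Phi R) (Phi_continuous _) c3).
have E j : (z + sg * dl j) * (dl j ^+ 4 + s2) `^ (- (1 / 2)) = (z + sg * dl j) * j.+1%:R ^+ 2.
  by rewrite s0 addr0 dl4_powR.
have z0 := zs s0.
have [zp|zn] := ltP 0 z.
  apply: (@cvg_comp _ _ _ _ (@Phi R) _ +oo); last exact: normal_cdf_cvgy.
  apply: cvg_trans (mul_sqr_cvg_pinfty _ z zp zc).
  by apply: near_eq_cvg; near=> j; rewrite E.
have zn0 : 0 < - z by rewrite oppr_gt0 lt_neqAle z0.
apply: (@cvg_comp _ _ _ _ (@Phi R) _ -oo); last exact: normal_cdf_cvgNy.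
apply/cvgNry.
have nzc : - (z + sg * dl j) @[j --> \oo] --> - z by exact: cvgN.
apply: cvg_trans (mul_sqr_cvg_pinfty _ (- z) zn0 nzc).
by apply: near_eq_cvg; near=> j; rewrite /= fctE E mulNr.
Unshelve. all: by end_near. Qed.

Lemma Phi_nat_cvg1 : Phi (j.+1%:R : R) @[j --> \oo] --> (1 : R).
Proof.
apply: (@cvg_comp _ _ _ _ (@Phi R) _ +oo); last exact: normal_cdf_cvgy.
apply/cvgryPge => A; have [K _ hK] := nbhs_infty_ger A.
by exists K => // n /= Kn; apply: (hK n.+1) => /=; exact: leqW.
Qed.

Lemma Phi_nat_cvg0 : Phi (- j.+1%:R : R) @[j --> \oo] --> (0 : R).
Proof.
apply: (@cvg_comp _ _ _ _ (@Phi R) _ -oo); last exact: normal_cdf_cvgNy.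
apply/cvgrNyPle => A; have [K _ hK] := nbhs_infty_ger (- A).
by exists K => // n /= Kn; rewrite lerNl; apply: (hK n.+1) => /=; exact: leqW.
Qed.

Variables (x : R) (f : R -> R) (gam : nat -> R) (N : nat -> nat) (b : nat -> R).
Hypothesis gam0 : forall n, (0 < n)%N -> 0 < gam n.
Hypothesis pr0 : forall n k, (0 < n)%N -> (k <= N n)%N -> 0 <= piece_prob f (N n) k.
Hypothesis b0 : forall n, (0 < n)%N -> 0 <= b n.
Hypothesis pvb : forall n k, (0 < n)%N -> (k <= N n)%N ->
  `|piece_value x (N n) k - kernel_mean x f (N n)| <= b n.

Local Notation claw := (centered_law x f gam N).

Lemma centered_law_le n H1 H2 : (forall t, H1 t <= H2 t) -> claw n H1 <= claw n H2.
Proof. by move=> h; apply: est_law_le. Qed.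

Lemma centered_lawDc n H c : claw n (fun t => H t + c) = claw n H + c.
Proof. by rewrite /centered_law est_lawD est_law_cst. Qed.

Variables (h z : nat -> R) (zl s2 : R).
Hypothesis h0 : forall n, (0 < n)%N -> 0 < h n.
Hypothesis zc : z n @[n --> \oo] --> zl.
Hypothesis varc : h n ^+ 2 * est_var x f gam N n @[n --> \oo] --> s2.
Hypothesis lyapc : h n ^+ 3 * est_lyap x f gam N b n @[n --> \oo] --> (0 : R).
Hypothesis var_sqc : h n ^+ 4 * est_var_sq x f gam N n @[n --> \oo] --> (0 : R).

Lemma limit_var_ge0 : 0 <= s2.
Proof.
rewrite leNgt; apply/negP => s2n.
have [n1 _ h1] := cvgr_lt _ varc _ s2n.
have := h1 n1 (leqnn _); rewrite /= ltNge mulr_ge0 ?sqr_ge0//.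
exact: est_var_ge0.
Qed.

Lemma smoothed_law_cvg (tau c : R) : 0 < tau ->
  claw n (fun s => Phi ((z n + c - h n * s) * tau `^ (- (1 / 2)))) @[n --> \oo]
    --> Phi ((zl + c) * (tau + s2) `^ (- (1 / 2))).
Proof.
move=> tau0.
have [C C0 HC] := centered_law_gauss x f gam N b gam0 pr0 b0 pvb tau tau0.
have s20 := limit_var_ge0.
pose err n := C * (h n ^+ 3 * est_lyap x f gam N b n + h n ^+ 4 * est_var_sq x f gam N n).
have errc : err n @[n --> \oo] --> (0 : R).
  by have := cvgnZ C (cvgnD lyapc var_sqc); rewrite addr0 mulr0.
pose G n := Phi ((z n + c) * (tau + h n ^+ 2 * est_var x f gam N n) `^ (- (1 / 2))).
have Gc : G n @[n --> \oo] --> Phi ((zl + c) * (tau + s2) `^ (- (1 / 2))).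
  apply: cvgn_comp; first exact: Phi_continuous.
  apply: cvgnM; first by apply: cvgnD => //; exact: cvg_cst.
  apply: powR_cvg; first by rewrite ltr_wpDr.
  by apply: cvgnD => //; exact: cvg_cst.
apply/cvgrPdist_le => e e0.
have e2 : 0 < e / 2 by rewrite divr_gt0.
move/cvgrPdist_le : Gc => /(_ _ e2)[n1 _ h1].
have [n2 _ h2] := cvgr_lt _ errc _ e2.
exists (maxn 1 (maxn n1 n2)) => // n /=; rewrite !geq_max => /and3P[n_gt0 n1n n2n].
have := HC n tau (h n) (z n + c) (lexx _); rewrite (gtr0_norm (h0 n n_gt0)) -/(G n) -/(err n).
have := h1 n n1n; have := h2 n n2n => /=.
set u := claw n _; rewrite !ler_norml => ? /andP[? ?] /andP[? ?].
by apply/andP; split; lra.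
Qed.

Lemma centered_law_cvg : (s2 = 0 -> zl != 0) ->
  claw n (fun s => (h n * s <= z n)%R%:R) @[n --> \oo] --> gauss_limit zl s2.
Proof.
move=> zs; have s20 := limit_var_ge0.
pose tau j := dl j ^+ 4.
have tau0 j : 0 < tau j by rewrite exprn_gt0// invr_gt0.
pose S (sg : R) j n := claw n (fun s => Phi ((z n + sg * dl j - h n * s) * tau j `^ (- (1 / 2)))).
have dE j : dl j * j.+1%:R ^+ 2 = j.+1%:R.
  by rewrite expr2 mulrA mulVf ?mul1r// pnatr_eq0.
(* The indicator of [h s <= z] lies between the smoothed steps shifted by [dl] to either side, up to
   [Phi (- (j + 1))] and [1 - Phi (j + 1)]. *)
apply: (cvg_sandwich _ _ (fun j n => S (-1) j n + - Phi (- j.+1%:R)) (fun j n => S 1 j n + (1 - Phi (j.+1%:R)))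
  (fun j => Phi ((zl + -1 * dl j) * (tau j + s2) `^ (- (1 / 2))) + - Phi (- j.+1%:R))
  (fun j => Phi ((zl + 1 * dl j) * (tau j + s2) `^ (- (1 / 2))) + (1 - Phi (j.+1%:R)))).
- move=> j; exists 0%N => // n _ /=.
  have j2 : 0 < j.+1%:R ^+ 2 :> R by rewrite exprn_gt0.
  rewrite -!centered_lawDc; apply/andP; split; apply: centered_law_le => s; rewrite dl4_powR.
    have [hs|hs] := leP (h n * s) (z n); rewrite /=.
      have /andP[_ p1] := Phi_bounds ((z n + -1 * dl j - h n * s) * j.+1%:R ^+ 2).
      have /andP[p2 _] := Phi_bounds (- j.+1%:R).
      by move: p1 p2; lra.
    rewrite subr_le0; apply: Phi_ndecr; rewrite -[X in _ <= - X]dE -(mulNr (dl j)); apply: ler_wpM2r; first exact: ltW.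
    by move: hs; lra.
  have [hs|hs] := leP (h n * s) (z n); rewrite /=.
    have p1 : Phi j.+1%:R <= Phi ((z n + 1 * dl j - h n * s) * j.+1%:R ^+ 2).
      by apply: Phi_ndecr; rewrite -[X in X <= _]dE; apply: ler_wpM2r; [exact: ltW|move: hs; lra].
    by move: p1; lra.
  have /andP[p1 _] := Phi_bounds ((z n + 1 * dl j - h n * s) * j.+1%:R ^+ 2).
  have /andP[_ p2] := Phi_bounds (j.+1%:R).
  by move: p1 p2; lra.
- move=> j; apply: cvgnD; last exact: cvg_cst.
  exact: smoothed_law_cvg.
- move=> j; apply: cvgnD; last exact: cvg_cst.
  exact: smoothed_law_cvg.
- have := cvgnB (Phi_cvg_smoothing zl s2 (-1) s20 zs) Phi_nat_cvg0; rewrite subr0; exact.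
- have c1 : (1 : R) @[j --> \oo] --> (1 : R) by exact: cvg_cst.
  have := cvgnD (Phi_cvg_smoothing zl s2 1 s20 zs) (cvgnB c1 Phi_nat_cvg1).
  by rewrite subrr addr0; exact.
Qed.

End Smoothing.

Section GaussianCdf.
Context {R : realType}.
Local Opaque Phi.
Implicit Types (mu v t : R).

Lemma gaussian0_cdf mu t : gaussian mu 0 `]-oo, t]%classic = (mu <= t)%R%:R%:E.
Proof.
rewrite /gaussian eqxx /= diracE; congr (nat_of_bool _)%:R%:E.
by apply/idP/idP; rewrite inE/= in_itv.
Qed.

Lemma gaussian_cdf mu v t : 0 <= v -> (v = 0 -> t - mu != 0) ->
  gaussian mu v `]-oo, t]%classic = (gauss_limit (t - mu) v)%:E.
Proof.
move=> v0 vt; rewrite /gauss_limit; case: eqP => [e|/eqP vn].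
  rewrite e gaussian0_cdf subr_gt0 le_eqVlt eq_sym -subr_eq0.
  by rewrite (negbTE (vt e)).
rewrite /gaussian (negbTE vn) [LHS]normal_cdfE normal_cdf_std//.
by rewrite sqrtr_gt0 lt_def vn.
Qed.

(** The distribution function of the point mass is 0 along [mu - 1 / (n + 1)] and 1 at [mu]. *)
Lemma gaussian0_cdf_continuous mu t :
  {for t, continuous (fun s => gaussian mu 0 `]-oo, s]%classic)} -> t - mu != 0.
Proof.
move=> c; apply/eqP => /subr0_eq e; rewrite e in c.
pose u n : R := mu - (n.+1%:R)^-1.
have uc : u n @[n --> \oo] --> mu.
  have m1 : mu @[n --> \oo] --> mu by exact: cvg_cst.
  have h0 : (n.+1%:R : R)^-1 @[n --> \oo] --> (0 : R) by exact: cvg_harmonic.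
  by have := cvgnB m1 h0; rewrite subr0.
have := cvg_comp _ _ uc c; rewrite gaussian0_cdf lexx => H.
have H0 : (0 : \bar R) @[n --> \oo] --> (1 : R)%:E.
  apply: cvg_trans H; apply: near_eq_cvg; exists 0%N => // n _ /=.
  rewrite gaussian0_cdf (_ : (mu <= u n) = false)//.
  by apply/negbTE; rewrite -ltNge /u ltrBlDr ltrDl invr_gt0.
have c0 : (0 : \bar R) @[n --> \oo] --> (0 : \bar R) by exact: cvg_cst.
have : (0 : \bar R) = 1%:E by exact: (cvg_unique _ c0 H0).
by move/eqP; rewrite eqe eq_sym oner_eq0.
Qed.

End GaussianCdf.

Theorem theorem1 (R : realType) (d : measure_display) (T : measurableType d)
  (P : probability T R) (X : nat -> {RV P >-> R}) (f : R -> R)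
  (alpha a : R) (gam m : nat -> R) (N : nat -> nat) (l : \bar R)
  (hX : iid_density01 X f)
  (hf : Ck_on 4 `[0, 1]%classic f)
  (halpha : 1 / 2 < alpha <= 1)
  (hgam : GS (- alpha) gam)
  (ha : 0 < a < 1)
  (hm : GS a m)
  (hN : even_orders m N)
  (hl : (n%:R * gam n)%:E @[n --> \oo] --> l)
  (hlmin : ((Num.min (2 * a) ((2 * alpha - a) / 4))%:E < l)%E)
  (x : R) (hx : 0 < x < 1) :
  let xi : R := limn (fun n => (n%:R * gam n)^-1) in
  let fn := recursive_estimator gam N X x in
  (forall c : R, 0 <= c ->
     gam n `^ (- (1 / 2)) * m n `^ (- (9 / 4)) @[n --> \oo] --> c ->
     cvg_in_law P
       (fun n w => gam n `^ (- (1 / 2)) * m n `^ (- (1 / 4)) * (fn n w - f x))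
       (gaussian (- (2 * c / (1 - 2 * a * xi)) * Delta2 f x)
                 (2 / (4 - (2 * alpha - a) * xi) * C3 * f x * psi x)))
  /\
  (gam n `^ (- (1 / 2)) * m n `^ (- (9 / 4)) @[n --> \oo] --> +oo ->
   cvg_in_prob P
     (fun n w => m n ^+ 2 * (fn n w - f x))
     (- (2 / (1 - 2 * a * xi)) * Delta2 f x)).
Proof.
case: hX => indX densX _; case: hf => g [g0 dg _].
have [mf _ _] := densX 1%N isT.
have /andP[alpha1 _] := halpha; have /andP[a0 a1] := ha.
have fint := density_cell_integrable f g mf g0 dg.
have PE := prob_est x f gam N _ _ P X indX densX hN.1 fint.
have pr0 n k : (0 < n)%N -> (k <= N n)%N -> 0 <= piece_prob f (N n) k.
  by move=> n0; apply: (piece_prob_ge0 f _ _ P X densX fint); exact: (hN.1 n n0).1.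
have gam0 := hgam.1.
pose kap := rate_index alpha a.
have kap0 : 0 < kap by exact: rate_index_gt0.
have M0 : 0 < Num.min (2 * a) kap by rewrite lt_min kap0 mulr_gt0.
have [xi0 xi0E Mxi] := stepsize_cvg_inv alpha gam hgam l _ hl hlmin M0.
move=> xi fn; have xiE : xi = xi0 by exact: (cvg_lim _ xi0E).
split=> [c c0 cc|uoo e e0].
- move=> t; rewrite -/fn => ct.
  (* A finite limit makes [kap] the minimum in the hypothesis on [l]. *)
  have kap_le : kap <= 2 * a by exact: (rate_index_le alpha a gam m hgam hm c cc).
  have kxi : 0 < 1 - kap * xi0 by move: Mxi; rewrite min_r.
  have cc' : rate gam m n / m n ^+ 2 @[n --> \oo] --> c.
    by apply: eqn_cvg cc; exists 1%N => // n /= n0; exact: (rate_bias a gam m hm n n0).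
  have mc := rate_mean_cvg alpha a gam m N alpha1 hgam a0 hm hN x f g hx mf g0 dg xi0 xi0E kxi c cc'.
  have vc := rate_var_cvg alpha a gam m N alpha1 hgam a0 hm hN x f g hx mf g0 dg xi0 xi0E kxi.
  have [b [b0 pvb [B bB]]] := piece_value_deviation a m N a0 hm hN x f hx pr0.
  have lc := rate_lyap_cvg0 alpha a gam m N alpha1 hgam a0 a1 hm hN x f g hx mf g0 dg xi0 b B xi0E bB kxi.
  have qc := rate_var_sq_cvg0 alpha a gam m N alpha1 hgam a0 hm hN x f g hx mf g0 dg xi0 xi0E kxi.
  have h0 := rate_gt0 alpha a gam m hgam hm.
  (* The recursion yields the denominator [1 - kap xi]. For [c = 0] both sides vanish; otherwise
     [kap = 2 a]. *)
  have muE : - (2 * c * Delta2 f x) / (1 - kap * xi0) = - (2 * c / (1 - 2 * a * xi)) * Delta2 f x.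
    rewrite xiE; have [->|cn0] := eqVneq c 0; first by rewrite !(mulr0, mul0r, oppr0).
    by rewrite -(rate_index_eq alpha a gam m hgam hm c cc cn0) -/kap; ring.
  have varE : C3 * f x * psi x / (2%:R - (kap + kap) * xi0) =
      2 / (4 - (2 * alpha - a) * xi) * C3 * f x * psi x.
    have nz : 4 - (2 * alpha - a) * xi0 != 0.
      by rewrite gt_eqF//; move: kxi; rewrite /kap /rate_index; lra.
    rewrite xiE (_ : 2%:R - (kap + kap) * xi0 = (4 - (2 * alpha - a) * xi0) / 2); last first.
      by rewrite /kap /rate_index; field.
    by field.
  rewrite muE in mc; rewrite varE in vc.
  set mu := (- (2 * c / _) * _) in ct mc *; set v := (2 / _ * _ * _ * _) in ct vc *.
  have v0 : 0 <= v by exact: (limit_var_ge0 x f gam N pr0 (rate gam m) v vc).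
  (* In the degenerate case, continuity of the limit distribution function at [t] excludes
     [t = mu]. *)
  have vt : v = 0 -> t - mu != 0 :> R.
    by move=> e; apply: gaussian0_cdf_continuous; move: ct; rewrite e.
  rewrite gaussian_cdf//.
  (* Centring at [est_mean] moves the deterministic bias into the threshold. *)
  pose z n := t - rate gam m n * (est_mean x f gam N n - f x).
  have zc : z n @[n --> \oo] --> t - mu by apply: cvgnB => //; exact: cvg_cst.
  have b0' n : (0 < n)%N -> 0 <= b n by [].
  have main := centered_law_cvg x f gam N b gam0 pr0 b0' pvb (rate gam m) z (t - mu) v h0 zc vc lc qc vt.
  have E n : P [set w | rate gam m n * (fn n w - f x) <= t] =
      (centered_law x f gam N n (fun s => (rate gam m n * s <= z n)%R%:R))%:E.
    pose C := [set s : R | rate gam m n * (s - f x) <= t].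
    have mC : measurable C.
      have mh : measurable_fun [set: R] (fun s => rate gam m n * (s - f x)).
        by apply: measurable_funM => //; apply: measurable_funB.
      have := mh measurableT _ (measurable_itv `]-oo, t]); rewrite setTI.
      by congr measurable; apply/seteqP; split => s /=; rewrite in_itv.
    rewrite -[X in P X]/(recursive_estimator gam N X x n @^-1` C) PE//; congr (_%:E).
    apply: eq_est_law => s; rewrite indicE; congr (nat_of_bool _)%:R.
    by apply/idP/idP; rewrite inE /C /z /=; move: (rate _ _ _) => h; lra.
  have : (centered_law x f gam N n (fun s => (rate gam m n * s <= z n)%R%:R))%:E @[n --> \oo]
      --> (gauss_limit (t - mu) v)%:E.
    by apply: cvg_EFin => //; near=> n.
  by under eq_fun do rewrite -E.
(* An infinite limit makes [2 a] the minimum instead. *)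
- have kap_ge : 2 * a <= kap by exact: (rate_index_ge alpha a gam m hgam hm uoo).
  have axi : 0 < 1 - 2 * a * xi0 by move: Mxi; rewrite min_l.
  have u0 : (rate gam m n / m n ^+ 2)^-1 @[n --> \oo] --> (0 : R).
    have pos : \forall n \near \oo, 0 < gam n `^ (- (1 / 2)) * m n `^ (- (9 / 4)).
      by exists 1%N => // n /= n0; rewrite mulr_gt0// powR_gt0 ?gam0 ?hm.1.
    apply: (eqn_cvg _ ((gtr0_cvgV0 pos).2 uoo)); exists 1%N => // n /= n0.
    by rewrite (rate_bias a gam m hm n n0).
  have mc := order_mean_cvg alpha a gam m N alpha1 hgam a0 hm hN x f g hx mf g0 dg xi0 xi0E axi.
  have vc := order_var_cvg0 alpha a gam m N alpha1 hgam a0 hm hN x f g hx mf g0 dg xi0 xi0E axi u0.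
  set L := (- _ * _).
  have LE : - (2 * Delta2 f x) / (1 - (a + a) * xi0) = L.
    by rewrite /L xiE (_ : a + a = 2 * a); ring.
  rewrite LE in mc.
  have e2 : 0 < e / 2 by rewrite divr_gt0.
  move/cvgrPdist_le : mc => /(_ _ e2) mc.
  pose K := (e / 2) ^- 2.
  (* Chebyshev's inequality: the scaled mean error is within [e / 2] of [L], so a deviation above
     [e] makes the centred part at least [e / 2]. *)
  have bound : \forall n \near \oo, (P [set w | (e < `|m n ^+ 2 * (fn n w - f x) - L|)%R] <=
      (K * (m n ^+ 4 * est_var x f gam N n))%:E)%E.
    case: mc => n1 _ mc; exists n1 => // n /= nn1; have := mc n nn1 => /= mcn.
    pose C := [set s : R | e < `|m n ^+ 2 * (s - f x) - L|].
    have mC : measurable C.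
      have mh : measurable_fun [set: R] (fun s => `|m n ^+ 2 * (s - f x) - L|).
        apply: measurableT_comp => //; apply: measurable_funB => //.
        by apply: measurable_funM => //; apply: measurable_funB.
      have := mh measurableT _ (measurable_itv `]e, +oo[); rewrite setTI.
      by congr measurable; apply/seteqP; split => s /=; rewrite in_itv/= andbT.
    rewrite -[X in P X]/(recursive_estimator gam N X x n @^-1` C) PE// lee_fin.
    rewrite -(centered_law_sqr x f gam N n) /centered_law -!est_lawZ.
    apply: est_law_le => // s; rewrite indicE.
    have [sC|_] := boolP (s \in C); last by rewrite mulr_ge0 ?invr_ge0 ?sqr_ge0// mulr_ge0 ?exprn_even_ge0 ?sqr_ge0.
    have ge : e / 2 <= `|m n ^+ 2 * (s - est_mean x f gam N n)|.
      move: sC; rewrite inE /C /= => sC.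
      have E : m n ^+ 2 * (s - est_mean x f gam N n) = (m n ^+ 2 * (s - f x) - L) + (L - m n ^+ 2 * (est_mean x f gam N n - f x)) by ring.
      rewrite E; have := lerB_normD (m n ^+ 2 * (s - f x) - L) (L - m n ^+ 2 * (est_mean x f gam N n - f x)).
      move: mcn sC; lra.
    rewrite mulrC ler_pdivlMr ?exprn_gt0// mul1r.
    rewrite (_ : m n ^+ 4 * _ = `|m n ^+ 2 * (s - est_mean x f gam N n)| ^+ 2); last first.
      by rewrite real_normK ?num_real//; ring.
    by apply: lerXn2r => //; rewrite nnegrE ltW.
  apply: (@squeeze_cvge _ _ _ _ (fun=> 0%E) _ (fun n => (K * (m n ^+ 4 * est_var x f gam N n))%:E)).
  + by apply: filterS bound => n ->; rewrite andbT.
  + exact: cvg_cst.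
  + by apply: cvg_EFin; [near=> n|have := cvgnZ K vc; rewrite mulr0].
Unshelve. all: by end_near. Qed.
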